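(* Fix $\bar\tau_0,\bar\tau_1>0$, $n\ge1$, $\lambda_i>0$ with $\sum_{i=1}^n\lambda_i=1$, $a_i>0$, $\mu_i=\mathcal N(m_i,\Sigma_i)\in\mathcal G_d^1$, and use the notation of the context, with $\mathsf Z_0(\nu)=\sum_{i=1}^n\lambda_ia_i^\theta\rho_\theta(\mu_i,\nu)$. Every positive superlevel set $\{\nu\in\mathcal G_d^1:\mathsf Z_0(\nu)\ge\eta\}$, $\eta>0$, is compact in mean--covariance coordinates. Consequently, $\mathsf Z_0$ attains its global maximum on $\mathcal G_d^1$, and its maximizer set $\mathcal A_0:=\operatorname*{argmax}_{\nu\in\mathcal G_d^1}\mathsf Z_0(\nu)$ is nonempty and compact. Moreover, $$\sup_{\nu\in\operatorname*{argmin}_{\eta\in\mathcal G_d^1}\Phi_\kappa(\eta)}d_{\rm par}(\nu,\mathcal A_0)\longrightarrow0\qquad(\kappa\downarrow0).$$ In particular, every cluster point (as $\kappa\downarrow0$) of any selection of global minimizers $\nu_\kappa$ of $\Phi_\kappa$ belongs to $\mathcal A_0$; if $\mathcal A_0=\{\nu_0\}$, then every selection converges to $\nu_0$. Moreover, $$\frac1\kappa\min_{\nu\in\mathcal G_d^1}\Phi_\kappa(\nu)\longrightarrow\bar\tau_0\left[\bar a-\left(\max_{\nu\in\mathcal G_d^1}\mathsf Z_0(\nu)\right)^{1/\theta}\right],$$ and for every selection of global minimizers $\nu_\kappa\in\operatorname*{argmin}_{\mathcal G_d^1}\Phi_\kappa$, $$b_\kappa(\nu_\kappa)\longrightarrow\left(\max_{\nu\in\mathcal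 G_d^1}\mathsf Z_0(\nu)\right)^{1/\theta}\qquad(\kappa\downarrow0).$$
   Context: $\mathcal G_d^1=\{\mathcal N(m,\Sigma):m\in\mathbb R^d,\Sigma\in\mathbb S_{++}^d\}$ (with $\mathbb S_{++}^d$ the symmetric positive-definite matrices), identified with the open set $\mathbb R^d\times\mathbb S_{++}^d$, with $d_{\rm par}(\mathcal N(m,\Sigma),\mathcal N(m',\Sigma'))=(\|m-m'\|^2+\|\Sigma-\Sigma'\|_F^2)^{1/2}$ and $d_{\rm par}(\nu,\mathcal A)=\inf_{\eta\in\mathcal A}d_{\rm par}(\nu,\eta)$. For $\mu,\nu\in\mathcal G_d^1$ with densities $f_\mu,f_\nu$, the order-$\theta$ Chernoff affinity is $\rho_\theta(\mu,\nu)=\int_{\mathbb R^d}f_\mu(x)^\theta f_\nu(x)^{1-\theta}dx$. For $\kappa>0$ the penalties are $\tau_j=\kappa\bar\tau_j$, $j=0,1$; $\bar s=\bar\tau_0+\bar\tau_1$, $\theta=\bar\tau_0/\bar s$, $\bar a=\sum_i\lambda_ia_i$. Define $$A_i^{(\kappa)}(\nu)=\inf_{p,q\in\mathcal P(\mathbb R^d)}\{W_2^2(p,q)+\kappa\bar\tau_0\mathrm{KL}(p\mid\mu_i)+\kappa\bar\tau_1\mathrm{KL}(q\mid\nu)\},$$ with $\mathrm{KL}$ the relative entropy and $W_2$ the quadratic Wasserstein distance ($W_2^2\in[0,\infty]$); $$\mathsf Z_\kappa(\nu)=\sum_i\lambda_ia_i^\theta e^{-A_i^{(\kappa)}(\nu)/(\kappa\bar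 s)},\quad b_\kappa(\nu)=\mathsf Z_\kappa(\nu)^{1/\theta},\quad \Phi_\kappa(\nu)=\kappa\bar\tau_0\big(\bar a-\mathsf Z_\kappa(\nu)^{1/\theta}\big).$$ ($\Phi_\kappa(\nu)$ is the infimum over $b>0$ of $\sum_i\lambda_i\mathsf U_{\kappa\bar\tau_0,\kappa\bar\tau_1}(a_i\mu_i,b\nu)$, where $\mathsf U$ is the quadratic-cost two-sided KL-unbalanced transport cost, attained at $b_\kappa(\nu)$; $\Phi_\kappa$ is known to attain its minimum on $\mathcal G_d^1$ for every $\kappa>0$.) *)

(* Defs.v *)
From HB Require Import structures.
From mathcomp Require Import all_boot all_order all_algebra.
From mathcomp Require Import all_classical all_reals all_analysis.
From mathcomp Require Import measurable_realfun.

Set Implicit Arguments.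
Unset Strict Implicit.
Unset Printing Implicit Defensive.

Import Order.TTheory GRing.Theory Num.Theory.
Import numFieldNormedType.Exports.

Local Open Scope classical_set_scope.
Local Open Scope ring_scope.

(* Points of R^d at which measures live are d-tuples, which the library equips
   with the product (= Borel) sigma-algebra.  Means and covariances are
   matrices, which the library equips with the Euclidean topology. *)
Notation euclid R d := (d.-tuple (measurableTypeR R)).

Section lebesgue_euclid.
Variable R : realType.
Local Open Scope ereal_scope.

Section cons.
Variables (d : nat) (m : {sigma_finite_measure set (euclid R d) -> \bar R}).

Definition consp (p : measurableTypeR R * euclid R d) : euclid R d.+1 :=
  [the d.+1.-tuple _ of p.1 :: p.2].

Definition unconsp (x : euclid R d.+1) : measurableTypeR R * euclid R d :=
  (tnth x ord0, [tuple of behead x]).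

Lemma measurable_consp : measurable_fun setT consp.
Proof. exact: measurable_cons. Qed.

Lemma measurable_unconsp : measurable_fun setT unconsp.
Proof.
apply/measurable_fun_pairP; split.
  exact: measurable_tnth.
exact: measurable_behead.
Qed.

Lemma conspK : cancel consp unconsp.
Proof.
by move=> [x t]; rewrite /unconsp /consp/=; congr pair; exact/val_inj.
Qed.

Definition lebesgue_cons : set (euclid R d.+1) -> \bar R :=
  pushforward (lebesgue_measure \x m) consp.

Let cons0 : lebesgue_cons set0 = 0.
Proof. by rewrite /lebesgue_cons /pushforward preimage_set0 measure0. Qed.

Let cons_ge0 A : 0 <= lebesgue_cons A.
Proof. by rewrite /lebesgue_cons /pushforward; exact: measure_ge0. Qed.

Let cons_sigma_additive : semi_sigma_additive lebesgue_cons.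
Proof.
move=> F mF tF mUF; rewrite /lebesgue_cons /pushforward preimage_bigcup.
apply: measure_semi_sigma_additive.
- by move=> n; rewrite -[X in measurable X]setTI; exact: measurable_consp.
- apply/trivIsetP => /= i j _ _ ij; rewrite -preimage_setI.
  by move/trivIsetP : tF => /(_ _ _ _ _ ij) ->//; rewrite preimage_set0.
- rewrite -preimage_bigcup -[X in measurable X]setTI.
  exact: measurable_consp.
Qed.

HB.instance Definition _ := isMeasure.Build _ _ _ lebesgue_cons
  cons0 cons_ge0 cons_sigma_additive.

Let cons_sigma_finite : sigma_finite setT lebesgue_cons.
Proof.
have /sigma_finiteP[F [TF ndF Foo]] := sigma_finiteT (@lebesgue_measure R).
have /sigma_finiteP[G [TG ndG Goo]] := sigma_finiteT m.
exists (fun i => unconsp @^-1` (F i `*` G i)).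
  rewrite -preimage_bigcup (_ : \bigcup_i _ = setT) ?preimage_setT//.
  apply/seteqP; split=> // -[x y] _.
  have : setT x by []. rewrite TF => -[i _ Fix].
  have : setT y by []. rewrite TG => -[j _ Gjy].
  exists (maxn i j) => //; split => /=.
  - by move: x Fix; exact/subsetPset/ndF/leq_maxl.
  - by move: y Gjy; exact/subsetPset/ndG/leq_maxr.
move=> i; have [mF Fi] := Foo i; have [mG Gi] := Goo i; split.
  rewrite -[X in measurable X]setTI; apply: measurable_unconsp => //.
  exact: measurableX.
rewrite /lebesgue_cons /pushforward -comp_preimage.
rewrite (_ : unconsp \o consp = id); last first.
  by apply/funext => p /=; rewrite conspK.
by rewrite preimage_id product_measure1E// lte_mul_pinfty// ge0_fin_numE.
Qed.

HB.instance Definition _ := Measure_isSigmaFinite.Build _ _ _ lebesgue_cons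
  cons_sigma_finite.

End cons.

Fixpoint lebesgue_euclid (d : nat) :
    {sigma_finite_measure set (euclid R d) -> \bar R} :=
  match d with
  | 0 => [the {sigma_finite_measure set (euclid R 0) -> \bar R} of
           dirac ([tuple] : euclid R 0)]
  | d'.+1 => [the {sigma_finite_measure set (euclid R d'.+1) -> \bar R} of
           lebesgue_cons (lebesgue_euclid d')]
  end.

End lebesgue_euclid.

Section gaussian_family.
Variables (R : realType) (d : nat).

(* Mean and covariance (m, Sigma), with the product topology. *)
Definition gparam : Type := ('rV[R]_d * 'M[R]_d)%type.

Definition posdef (S : 'M[R]_d) : Prop :=
  S^T = S /\ forall x : 'rV[R]_d, x != 0 -> 0 < (x *m S *m x^T) 0 0.

Definition gaussians : set gparam := [set nu | posdef nu.2].

(* Squared Frobenius norm; on row vectors, the squared Euclidean norm. *)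
Definition sqnorm (k l : nat) (M : 'M[R]_(k, l)) : R :=
  \sum_i \sum_j M i j ^+ 2.

Definition dpar (nu eta : gparam) : R :=
  Num.sqrt (sqnorm (nu.1 - eta.1) + sqnorm (nu.2 - eta.2)).

Definition dpar_set (nu : gparam) (A : set gparam) : R :=
  inf [set dpar nu eta | eta in A].

Definition rowv (x : euclid R d) : 'rV[R]_d := \row_i tnth x i.

Definition gauss_pdf (nu : gparam) (x : euclid R d) : R :=
  let z := rowv x - nu.1 in
  (Num.sqrt ((2 * pi) ^+ d * \det nu.2))^-1 *
  expR (- ((z *m invmx nu.2 *m z^T) 0 0) / 2).

Definition gauss (nu : gparam) (A : set (euclid R d)) : \bar R :=
  (\int[lebesgue_euclid R d]_(x in A) (gauss_pdf nu x)%:E)%E.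

Lemma gauss_pdf_ge0 (nu : gparam) x : 0 <= gauss_pdf nu x.
Proof. by rewrite mulr_ge0 ?expR_ge0// invr_ge0 sqrtr_ge0. Qed.

Lemma measurable_gauss_pdf (nu : gparam) : measurable_fun setT (gauss_pdf nu).
Proof.
apply: measurable_funM => //; apply: measurableT_comp => //.
apply: measurable_funM => //; apply: measurableT_comp => //.
under eq_fun do rewrite mxE.
apply: measurable_sum => i.
have mz j : measurable_fun setT
    (fun x : euclid R d => ((rowv x - nu.1) 0 j : measurableTypeR R)).
  under eq_fun do rewrite !mxE.
  by apply: measurable_funB => //; exact: measurable_tnth.
apply: measurable_funM; last by under eq_fun do rewrite mxE; exact: mz.
under eq_fun do rewrite mxE.
apply: measurable_sum => j.
by apply: measurable_funM => //; exact: mz.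
Qed.

Section gauss_measure.
Variable nu : gparam.
Local Open Scope ereal_scope.

Let gauss0 : gauss nu set0 = 0.
Proof. by rewrite /gauss integral_set0. Qed.

Let gauss_ge0 A : 0 <= gauss nu A.
Proof. by apply: integral_ge0 => x _; rewrite lee_fin gauss_pdf_ge0. Qed.

Let gauss_sigma_additive : semi_sigma_additive (gauss nu).
Proof.
move=> F mF tF mUF; rewrite /gauss ge0_integral_bigcup//.
- apply: is_cvg_ereal_nneg_natsum_cond => n _ _.
  by apply: integral_ge0 => x _; rewrite lee_fin gauss_pdf_ge0.
- apply/measurable_EFinP; apply: measurable_funTS.
  exact: measurable_gauss_pdf.
- by move=> x _; rewrite lee_fin gauss_pdf_ge0.
Qed.

HB.instance Definition _ := isMeasure.Build _ _ _ (gauss nu)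
  gauss0 gauss_ge0 gauss_sigma_additive.

Let gauss_sigma_finite : sigma_finite setT (gauss nu).
Proof.
have /sigma_finiteP[F [TF ndF Foo]] := sigma_finiteT (lebesgue_euclid R d).
pose G n := [set x | (gauss_pdf nu x <= n%:R)%R].
have mG n : measurable (G n).
  rewrite (_ : G n = gauss_pdf nu @^-1` `]-oo, n%:R]); last first.
    by apply/seteqP; split=> x; rewrite /G/= in_itv.
  rewrite -[X in measurable X]setTI.
  exact: measurable_gauss_pdf.
exists (fun n => F n `&` G n).
  apply/seteqP; split=> // x _.
  have : setT x by []. rewrite TF => -[i _ Fix].
  pose j := Num.truncn (gauss_pdf nu x).
  exists (maxn i j.+1) => //; split.
    have /subsetPset := ndF _ _ (leq_maxl i j.+1); exact.
  rewrite /G/=; apply: (@le_trans _ _ j.+1%:R); last by rewrite ler_nat leq_maxr.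
  by apply: ltW; rewrite truncnS_gt.
move=> n; have [mF Fn] := Foo n; split; first exact: measurableI.
apply: (@le_lt_trans _ _ (\int[lebesgue_euclid R d]_(x in F n `&` G n)
    (n%:R)%:E)).
  apply: ge0_le_integral => //.
  - exact: measurableI.
  - by move=> x _; rewrite lee_fin gauss_pdf_ge0.
  - by apply/measurable_EFinP/measurable_funTS; exact: measurable_gauss_pdf.
  - by move=> x [_ Gx]; rewrite lee_fin.
rewrite integral_cst/=; last exact: measurableI.
apply: lte_mul_pinfty => //.
apply: le_lt_trans Fn; apply: le_measure; rewrite ?inE//.
exact: measurableI.
Qed.

HB.instance Definition _ := Measure_isSigmaFinite.Build _ _ _ (gauss nu)
  gauss_sigma_finite.

End gauss_measure.

Definition chernoff_affinity (theta : R) (mu nu : gparam) : R :=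
  \int[lebesgue_euclid R d]_x
    (gauss_pdf mu x `^ theta * gauss_pdf nu x `^ (1 - theta)).

End gaussian_family.
Arguments gaussians R d _ : clear implicits.

Section divergences.
Variables (R : realType) (d : nat).
Local Open Scope ereal_scope.

(* The library's Radon-Nikodym derivative is finite everywhere when p is
   absolutely continuous with respect to m, and nonpositive only on a p-null
   set, so the conventions fine +oo = 0 and ln 0 = 0 play no role. *)
Definition KL (p : probability (euclid R d) R)
    (m : {sigma_finite_measure set (euclid R d) -> \bar R}) : \bar R :=
  if `[< p `<< m >] then
    \int[p]_x (ln (fine (Radon_Nikodym (charge_of_finite_measure p) m x)))%:E
  else +oo.

Definition coupling (p q : probability (euclid R d) R)
    (c : probability (euclid R d * euclid R d)%type R) : Prop :=
  forall A, measurable A ->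
    c (fst @^-1` A) = p A /\ c (snd @^-1` A) = q A.

Definition W2sq (p q : probability (euclid R d) R) : \bar R :=
  ereal_inf [set \int[c]_z (sqnorm (rowv z.1 - rowv z.2))%:E
            | c in coupling p q].

(* The penalties at scale kappa are kappa * tau0 and kappa * tau1. *)
Definition transport_div (tau0 tau1 kappa : R) (mu nu : gparam R d) : \bar R :=
  ereal_inf [set W2sq pq.1 pq.2 + (kappa * tau0)%:E * KL pq.1 (gauss mu)
                                + (kappa * tau1)%:E * KL pq.2 (gauss nu)
            | pq in [set: probability (euclid R d) R *
                          probability (euclid R d) R]].

End divergences.

Section barycenter.
Variables (R : realType) (d n : nat) (tau0 tau1 : R) (lam a : 'I_n -> R).
Variable mu : 'I_n -> gparam R d.

Definition chernoff_order : R := tau0 / (tau0 + tau1).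

Definition mean_mass : R := \sum_i lam i * a i.

Definition Z0 (nu : gparam R d) : R :=
  \sum_i lam i * a i `^ chernoff_order *
    chernoff_affinity chernoff_order (mu i) nu.

(* The infimum is taken in \bar R, hence expeR, for which expeR -oo = 0. *)
Definition Zkappa (kappa : R) (nu : gparam R d) : R :=
  \sum_i lam i * a i `^ chernoff_order *
    fine (expeR (- (transport_div tau0 tau1 kappa (mu i) nu *
                    ((kappa * (tau0 + tau1))^-1)%:E))).

Definition bkappa (kappa : R) (nu : gparam R d) : R :=
  Zkappa kappa nu `^ chernoff_order^-1.

Definition Phikappa (kappa : R) (nu : gparam R d) : R :=
  kappa * tau0 * (mean_mass - bkappa kappa nu).

End barycenter.

Section optimizers.
Variables (R : realType) (T : Type) (G : set T) (f : T -> R).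

Definition argmax : set T :=
  [set x | G x /\ forall y, G y -> f y <= f x].

Definition argmin : set T :=
  [set x | G x /\ forall y, G y -> f x <= f y].

End optimizers.

(* Main.v *)
(* Write E_k(mu, nu) = exp (- A_k(nu) / (k s)), where A_k is the transport
   divergence at scale k.  Taking p = q equal to the normalized geometric mean
   of mu and nu gives E_k >= rho, the Chernoff affinity, and E_k decreases as
   k does.  Conversely, Kantorovich duality for W_2 and the Donsker-Varadhan
   inequality for both entropies give
     E_k <= (int e^(-f/tau0) dmu)^theta * (int e^(-g/tau1) dnu)^(1 - theta)
   whenever k (f(x) + g(y)) <= |x - y|^2.  Only explicit quadratic test
   functions are needed.  Multiples of ln f_mu - ln f_nu, regularized by
   eps (1 + |x|^2), yield E_k -> rho as k -> 0.  Functions of one linear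
   coordinate <e, x> yield coercivity: for small k, a lower bound on E_k bounds
   the mean and the covariance of nu, and keeps the covariance away from the
   degenerate matrices.  (For a fixed k degenerate covariances are not penalized
   enough, so the scale has to depend on the level.)  Finally E_k is upper
   semicontinuous in nu: perturbing nu changes KL(q | nu) by at most
   eps int (1 + |x|^2) dq, which is controlled by KL(q | nu) itself.  Hence
   Z_k decreases to Z_0 with locally uniform upper semicontinuity and coercive
   superlevel sets, and the maximizers converge by compactness.  The same
   compactness provides the minimizers of Phi_k for small k. *)
From HB Require Import structures.
Require Import Defs.
From mathcomp Require Import all_boot all_order all_algebra.
From mathcomp Require Import all_classical all_reals all_analysis.
From mathcomp Require Import measurable_realfun ring lra.

Set Implicit Arguments.
Unset Strict Implicit.
Unset Printing Implicit Defensive.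

Import Order.TTheory GRing.Theory Num.Theory.
Import numFieldNormedType.Exports.

Local Open Scope classical_set_scope.
Local Open Scope ring_scope.

(** * Quadratic forms and positive definite matrices *)

(** The test functions come from the limit k = 0, where p = q is forced and the potentials must
    cancel on the diagonal. With h = ln f_mu - ln f_nu, the pair f = tau0 (1 - theta) h, g = - tau1
    theta h cancels because tau0 (1 - theta) = tau1 theta, and it turns both exponential integrals
    into rho, since e^(-(1 - theta) h) f_mu = e^(theta h) f_nu = f_mu^theta f_nu^(1 - theta). For k
    > 0 the obstacle is that h is quadratic: h(x) - h(y) grows like |x| |x - y|, which no multiple
    of |x - y|^2 dominates. The term eps (1 + |x|^2) pays for this growth, and the exponential
    moments of Gaussians keep its price small. In one coordinate the constraint reads k (al X^2 - be
    Y^2) <= (X - Y)^2, with sharp case 1/al = 1/be + k. Hence al < 1/k however narrow nu is, which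
    is why excluding degenerate covariances at a given level takes a small scale. Phi_k is a
    decreasing function of Z_k, so every statement about its minimizers becomes one about maximizers
    of Z_k. *)

Definition bform (R : realType) (d : nat) (P : 'M[R]_d) (x y : 'rV[R]_d) : R :=
  (x *m P *m y^T) 0 0.

Definition qform (R : realType) (d : nat) (P : 'M[R]_d) (x : 'rV[R]_d) : R :=
  bform P x x.

Section quadratic_forms.
Context {R : realType} {d : nat}.
Implicit Types (P Q S : 'M[R]_d) (x y z e : 'rV[R]_d) (t : R).

Lemma bformDl P x y z : bform P (x + y) z = bform P x z + bform P y z.
Proof. by rewrite /bform !mulmxDl mxE. Qed.

Lemma bformDr P x y z : bform P z (x + y) = bform P z x + bform P z y.
Proof. by rewrite /bform linearD mulmxDr mxE. Qed.

Lemma bformZl P t x z : bform P (t *: x) z = t * bform P x z.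
Proof. by rewrite /bform -!scalemxAl mxE. Qed.

Lemma bformZr P t x z : bform P z (t *: x) = t * bform P z x.
Proof. by rewrite /bform linearZ/= -scalemxAr mxE. Qed.

Lemma bformNl P x z : bform P (- x) z = - bform P x z.
Proof. by rewrite -scaleN1r bformZl mulN1r. Qed.

Lemma bformNr P x z : bform P z (- x) = - bform P z x.
Proof. by rewrite -scaleN1r bformZr mulN1r. Qed.

Lemma bform_sym P x y : P^T = P -> bform P x y = bform P y x.
Proof.
move=> Psym; rewrite /bform.
have -> : x *m P *m y^T = (y *m P *m x^T)^T by rewrite !trmx_mul trmxK Psym mulmxA.
by rewrite mxE.
Qed.

Lemma bformDm P Q x y : bform (P + Q) x y = bform P x y + bform Q x y.
Proof. by rewrite /bform mulmxDr mulmxDl mxE. Qed.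

Lemma bformZm t P x y : bform (t *: P) x y = t * bform P x y.
Proof. by rewrite /bform -scalemxAr -scalemxAl mxE. Qed.

Lemma qformD P x y : P^T = P ->
  qform P (x + y) = qform P x + 2 * bform P x y + qform P y.
Proof.
by move=> Ps; rewrite /qform !bformDl !bformDr (bform_sym y x Ps); ring.
Qed.

Lemma qformB P x y : P^T = P ->
  qform P (x - y) = qform P x - 2 * bform P x y + qform P y.
Proof.
by move=> Ps; rewrite qformD// /qform !bformNr !bformNl; ring.
Qed.

Lemma qformN P x : qform P (- x) = qform P x.
Proof. by rewrite /qform bformNl bformNr opprK. Qed.

Lemma qformZ P t x : qform P (t *: x) = t ^+ 2 * qform P x.
Proof. by rewrite /qform bformZl bformZr mulrA expr2. Qed.

Lemma qformDm P Q x : qform (P + Q) x = qform P x + qform Q x.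
Proof. exact: bformDm. Qed.

Lemma qformZm t P x : qform (t *: P) x = t * qform P x.
Proof. exact: bformZm. Qed.

Lemma qform0 P : qform P 0 = 0.
Proof. by rewrite /qform /bform !mul0mx mxE. Qed.

Lemma bformE P x y : bform P x y = \sum_i \sum_j x 0 i * P i j * y 0 j.
Proof.
rewrite /bform mxE exchange_big/=; apply: eq_bigr => j _.
by rewrite !mxE mulr_suml.
Qed.

Lemma posdef_ge0 P x : posdef P -> 0 <= qform P x.
Proof.
move=> [_ Pp]; have [->|/Pp/ltW//] := eqVneq x 0; by rewrite qform0.
Qed.

End quadratic_forms.

Lemma measurable_rowv (R : realType) (d : nat) (j : 'I_d) :
  measurable_fun setT (fun x : euclid R d => rowv x 0 j : measurableTypeR R).
Proof. by under eq_fun do rewrite mxE; exact: measurable_tnth. Qed.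

Lemma measurable_bform (R : realType) (d : nat) (P : 'M[R]_d) m y :
  measurable_fun setT (fun x : euclid R d => bform P (rowv x - m) y).
Proof.
under eq_fun do rewrite bformE.
apply: measurable_sum => i; apply: measurable_sum => j.
apply: measurable_funM => //; apply: measurable_funM => //.
under eq_fun do rewrite mxE.
by apply: measurable_funD => //; exact: measurable_rowv.
Qed.

Lemma measurable_qform (R : realType) (d : nat) (P : 'M[R]_d) m :
  measurable_fun setT (fun x : euclid R d => qform P (rowv x - m)).
Proof.
rewrite /qform; under eq_fun do rewrite bformE.
have mz j : measurable_fun setT
    (fun x : euclid R d => ((rowv x - m) 0 j : measurableTypeR R)).
  under eq_fun do rewrite mxE.
  by apply: measurable_funD => //; exact: measurable_rowv.
apply: measurable_sum => i; apply: measurable_sum => j.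
apply: measurable_funM; last exact: mz.
by apply: measurable_funM => //; exact: mz.
Qed.

Section schur_complement.
Context {R : realType} {d : nat}.
Variables (a : R) (b : 'rV[R]_d) (C : 'M[R]_d).
Hypothesis a_neq0 : a != 0.

Definition schur : 'M[R]_d := C - a^-1 *: (b^T *m b).

(** One step of block elimination: the left factor is unit lower triangular and clears [b^T]. The
    pivot may be negative, as in [det_rank1]. *)
Lemma det_schur :
  \det (block_mx a%:M b b^T C : 'M[R]_(1 + d)) = a * \det schur.
Proof.
have : \det (block_mx 1%:M 0 ((- a^-1) *: b^T) 1%:M *m
  (block_mx a%:M b b^T C : 'M[R]_(1 + d))) = a * \det schur.
  rewrite mulmx_block !mul1mx !mul0mx !addr0 mul_mx_scalar scalerA.
  rewrite mulrN mulfV// scaleN1r addNr det_ublock det_scalar1.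
  by rewrite -scalemxAl addrC scaleNr.
by rewrite det_mulmx det_lblock !det1 !mul1r.
Qed.

(** Completes the square in the first coordinate, so that a Gaussian integral factors into a line
    integral and a lower-dimensional one. *)
Lemma qform_schur (s : R) (y : 'rV[R]_d) :
  qform (block_mx a%:M b b^T C : 'M[R]_(1 + d)) (row_mx s%:M y) =
  a * (s + a^-1 * (y *m b^T) 0 0) ^+ 2 + qform schur y.
Proof.
pose c := (y *m b^T) 0 0.
have cE : y *m b^T = c%:M by rewrite [LHS]mx11_scalar.
have cE' : b *m y^T = c%:M.
  by rewrite -(trmxK b) -trmx_mul cE tr_scalar_mx.
have -> : qform schur y = qform C y - a^-1 * c ^+ 2.
  rewrite /qform /schur bformDm -scaleNr bformZm mulNr; congr (_ - _ * _).
  by rewrite /bform mulmxA cE -mulmxA cE' -scalar_mxM mxE.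
rewrite -/c /qform /bform mul_row_block tr_row_mx mul_row_col.
rewrite tr_scalar_mx cE !mulmxDl -!scalar_mxM -(mulmxA _ b) cE' -scalar_mxM.
rewrite !mxE !mulr1n.
by field.
Qed.

End schur_complement.

(** * Gaussian integrals *)

Section gaussian_line.
Context {R : realType}.
Local Notation mu := (@lebesgue_measure R).

Lemma integral_gauss_line (a c : R) : 0 < a ->
  (\int[mu]_s (expR (- (a * (s + c) ^+ 2) / 2))%:E =
   (Num.sqrt (2 * pi / a))%:E)%E.
Proof.
move=> a0; pose sg := Num.sqrt a^-1.
have sg0 : 0 < sg by rewrite sqrtr_gt0 invr_gt0.
have sg2 : sg ^+ 2 = a^-1 by rewrite sqr_sqrtr// invr_ge0 ltW.
have pk : (normal_peak sg)^-1 = Num.sqrt (2 * pi / a).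
  by rewrite /normal_peak invrK sg2; congr Num.sqrt; rewrite -mulr_natr; ring.
under eq_integral => s _.
  have -> : expR (- (a * (s + c) ^+ 2) / 2) =
      Num.sqrt (2 * pi / a) * normal_pdf (- c) sg s.
    have -> : normal_pdf (- c) sg s = normal_peak sg * normal_fun (- c) sg s.
      by rewrite normal_pdfE ?gt_eqF.
    rewrite -pk mulKf; last first.
      by rewrite gt_eqF// normal_peak_gt0 ?gt_eqF.
    rewrite /normal_fun sg2 opprK; congr expR; rewrite -mulr_natr.
    by field; rewrite gt_eqF.
  rewrite EFinM; over.
rewrite ge0_integralZl_EFin//=.
- by rewrite integral_normal_pdf ?mule1// gt_eqF.
- by move=> x _; rewrite lee_fin normal_pdf_ge0.
- by apply/measurable_EFinP; exact: measurable_normal_pdf.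
Qed.

End gaussian_line.

(** The first coordinate of the test vector is chosen to annihilate the square in [qform_schur],
    leaving exactly the Schur complement. *)
Lemma posdef_schur (R : realType) (d : nat) (a : R) (b : 'rV[R]_d) C :
    posdef (block_mx a%:M b b^T C : 'M[R]_(1 + d)) ->
  0 < a /\ posdef (schur a b C).
Proof.
move=> [Ps Pp].
have a0 : 0 < a.
  have := Pp (row_mx 1%:M 0); rewrite mul_row_block tr_row_mx mul_row_col.
  rewrite !mul0mx trmx0 mulmx0 !addr0 tr_scalar_mx mulmx1 mul1mx mxE mulr1n.
  apply; apply/eqP => /(congr1 (fun x : 'rV_(1 + d) => lsubmx x 0 0)).
  by rewrite row_mxKl !mxE => /eqP; rewrite oner_eq0.
split=> //; split.
  move: Ps; rewrite tr_block_mx => /eq_block_mx[_ _ _ Cs].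
  by rewrite /schur linearB linearZ/= trmx_mul trmxK Cs.
move=> y y0; have := Pp (row_mx (- (a^-1 * (y *m b^T) 0 0))%:M y).
rewrite -/(bform _ _ _) -/(qform _ _) qform_schur ?gt_eqF// addNr expr0n mulr0.
rewrite add0r; apply; apply: contra_neq y0.
by move=> /(congr1 (fun x : 'rV_(1 + d) => rsubmx x)); rewrite row_mxKr linear0.
Qed.

Lemma rowv_consp (R : realType) (d : nat) s (t : euclid R d) :
  rowv (consp (s, t)) = row_mx s%:M (rowv t) :> 'rV[R]_(1 + d).
Proof.
apply/rowP => i; rewrite mxE; case: (split_ordP i) => j ->.
  by rewrite row_mxEl mxE ord1 eqxx mulr1n (tnth_nth 0).
by rewrite row_mxEr mxE !(tnth_nth 0).
Qed.

Lemma integral_lebesgue_euclidS (R : realType) (d : nat)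
    (f : euclid R d.+1 -> \bar R) :
    measurable_fun setT f -> (forall x, 0 <= f x)%E ->
  (\int[lebesgue_euclid R d.+1]_x f x =
   \int[lebesgue_euclid R d]_t \int[lebesgue_measure]_s f (consp (s, t)))%E.
Proof.
move=> mf f0; rewrite [LHS]ge0_integral_pushforward//; last exact: measurable_consp.
rewrite preimage_setT fubini_tonelli2//; last by move=> x; exact: f0.
by apply: (measurableT_comp mf); exact: measurable_consp.
Qed.

(* The first coordinate is integrated out; its Schur complement remains. *)
Lemma integral_gauss_posdef (R : realType) (d : nat) (P : 'M[R]_d) (m : 'rV_d) :
    posdef P ->
  0 < \det P /\
  (\int[lebesgue_euclid R d]_x (expR (- qform P (rowv x - m) / 2))%:E =
   (Num.sqrt ((2 * pi) ^+ d / \det P))%:E)%E.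
Proof.
elim: d P m => [|d IH] P m Pp.
  split; first by rewrite det_mx00.
  rewrite det_mx00 expr0 divr1 sqrtr1 integral_dirac//; last first.
    apply/measurable_EFinP; apply: measurableT_comp => //.
    by apply: measurable_funM => //; apply: measurableT_comp => //; exact: measurable_qform.
  by rewrite diracT mul1e /qform bformE big_ord0 oppr0 mul0r expR0.
(* Retyped at [1 + d], convertible with [d.+1], so that the block operations apply. *)
pose P' : 'M[R]_(1 + d) := P.
have Ps : P'^T = P' := Pp.1.
pose a := ulsubmx P' 0 0; pose b := ursubmx P'; pose C := drsubmx P'.
have PE : P' = block_mx a%:M b b^T C.
  rewrite -[P']submxK; congr block_mx; first exact: mx11_scalar.
  by rewrite /b trmx_ursub Ps.
have Pp' : posdef P' by [].
rewrite PE in Pp'; have [a0 Sp] := posdef_schur Pp'.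
have detP : \det P = a * \det (schur a b C).
  by rewrite -det_schur ?gt_eqF// -PE.
pose m' : 'rV[R]_(1 + d) := m.
pose m0 := lsubmx m' 0 0; pose m1 := rsubmx m'.
have mE : m' = row_mx m0%:M m1 by rewrite -[LHS]hsubmxK; congr row_mx; exact: mx11_scalar.
have [detS IHS] := IH _ m1 Sp.
split; first by rewrite detP mulr_gt0.
rewrite integral_lebesgue_euclidS; first last.
- by move=> x; rewrite lee_fin expR_ge0.
- apply/measurable_EFinP; apply: measurableT_comp => //.
  by apply: measurable_funM => //; apply: measurableT_comp => //; exact: measurable_qform.
(* The line Gaussian in [s] has a centre depending on [t], but its integral does not, so it leaves
   the outer integral as a constant. *)
have sE s t : expR (- qform P (rowv (consp (s, t)) - m) / 2) =
    expR (- (a * (s + (a^-1 * ((rowv t - m1) *m b^T) 0 0 - m0)) ^+ 2) / 2) *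
    expR (- qform (schur a b C) (rowv t - m1) / 2).
  have -> : rowv (consp (s, t)) - m = row_mx (s - m0)%:M (rowv t - m1) :> 'rV_(1 + d).
    transitivity (row_mx s%:M (rowv t) - row_mx m0%:M m1 : 'rV_(1 + d)).
      by rewrite -rowv_consp -mE.
    by rewrite opp_row_mx add_row_mx raddfB.
  rewrite -/P' PE qform_schur ?gt_eqF// -expRD; congr expR.
  by field; rewrite gt_eqF.
under eq_integral => t _.
  under eq_integral => s _ do rewrite sE EFinM.
  rewrite ge0_integralZr//=; last first.
    apply/measurable_EFinP; apply: measurableT_comp => //.
    apply: measurable_funM => //; apply: measurableT_comp => //.
    apply: measurable_funM => //; apply: measurable_funX => //.
    exact: measurable_funD.
  rewrite integral_gauss_line//.
  over.
rewrite ge0_integralZl//=; last first.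
  apply/measurable_EFinP; apply: measurableT_comp => //.
  by apply: measurable_funM => //; apply: measurableT_comp => //; exact: measurable_qform.
rewrite IHS -EFinM -sqrtrM; last by rewrite divr_ge0 ?mulr_ge0 ?pi_ge0// ltW.
congr ((Num.sqrt _)%:E); rewrite detP exprS.
by field; rewrite !gt_eqF.
Qed.

(** * Positive definite matrices: coercivity, Cauchy-Schwarz and rank-one updates *)

Section posdef_theory.
Context {R : realType} {d : nat}.
Implicit Types (P S : 'M[R]_d) (x y e m : 'rV[R]_d) (t : R).

Lemma posdef_unitmx P : posdef P -> P \in unitmx.
Proof.
by move=> /(integral_gauss_posdef 0)[d0 _]; rewrite unitmxE unitfE gt_eqF.
Qed.

Lemma posdef_det_gt0 P : posdef P -> 0 < \det P.
Proof. by move=> /(integral_gauss_posdef 0)[]. Qed.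

Lemma posdef_gt0 P x : posdef P -> x != 0 -> 0 < qform P x.
Proof. by move=> [_]; exact. Qed.

Lemma qform_mul_inv P x : posdef P -> qform (invmx P) (x *m P) = qform P x.
Proof.
move=> Pp; rewrite /qform /bform trmx_mul Pp.1 mulmxK ?mulmxA//.
exact: posdef_unitmx.
Qed.

Lemma bform_mul_inv P x y : posdef P -> bform (invmx P) (x *m P) y = bform 1%:M x y.
Proof. by move=> Pp; rewrite /bform mulmxK ?mulmx1//; exact: posdef_unitmx. Qed.

Lemma posdef_inv P : posdef P -> posdef (invmx P).
Proof.
move=> Pp; have uP := posdef_unitmx Pp; split; first by rewrite trmx_inv Pp.1.
move=> x x0; pose y := x *m invmx P.
have xE : x = y *m P by rewrite mulmxKV.
rewrite -/(bform _ _ _) -/(qform _ _) xE qform_mul_inv//.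
apply: posdef_gt0 => //; apply: contra_neq x0 => y0.
by rewrite xE y0 mul0mx.
Qed.

Lemma posdef1 : posdef (1%:M : 'M[R]_d).
Proof.
split; first exact: trmx1.
move=> x; rewrite mulmx1 => x0.
have nn (i : 'I_d) : 0 <= x 0 i * x^T i 0 by rewrite mxE -expr2 sqr_ge0.
rewrite mxE lt_neqAle sumr_ge0 ?andbT//; last first.
apply: contra_neq x0 => /esym/psumr_eq0P H.
apply/rowP => i; have := H (fun j _ => nn j) i isT; rewrite !mxE -expr2 => /eqP.
by rewrite sqrf_eq0 => /eqP.
Qed.

Lemma bform1E x y : bform 1%:M x y = \sum_i x 0 i * y 0 i.
Proof. by rewrite /bform mulmx1 mxE; apply: eq_bigr => i _; rewrite mxE. Qed.

Lemma sqnormE x : sqnorm x = qform 1%:M x.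
Proof.
by rewrite /qform bform1E /sqnorm big_ord1; apply: eq_bigr => i _; rewrite expr2.
Qed.

Lemma sqnorm_ge0 k l (M : 'M[R]_(k, l)) : 0 <= sqnorm M.
Proof. by apply: sumr_ge0 => i _; apply: sumr_ge0 => j _; exact: sqr_ge0. Qed.

Lemma sqr_coord_le x i : x 0 i ^+ 2 <= sqnorm x.
Proof.
by rewrite /sqnorm big_ord1 (bigD1 i)//= lerDl sumr_ge0// => j _; exact: sqr_ge0.
Qed.

Lemma bform_bound P : exists2 C, 0 < C &
  forall x y, `|bform P x y| <= C * (sqnorm x + sqnorm y).
Proof.
exists (1 + \sum_i \sum_j `|P i j|).
  by apply: ltr_wpDr => //; apply: sumr_ge0 => i _; apply: sumr_ge0.
move=> x y; rewrite mulrDl mul1r; apply: ler_wpDl.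
  by rewrite addr_ge0 ?sqnorm_ge0.
rewrite bformE (le_trans (ler_norm_sum _ _ _))// mulr_suml ler_sum// => i _.
rewrite (le_trans (ler_norm_sum _ _ _))// mulr_suml ler_sum// => j _.
rewrite mulrAC normrM mulrC ler_wpM2l//.
have := sqr_coord_le x i; have := sqr_coord_le y j.
have : 0 <= (`|x 0 i| - `|y 0 j|) ^+ 2 by exact: sqr_ge0.
rewrite normrM -(real_normK (num_real (x 0 i))) -(real_normK (num_real (y 0 j))).
have := sqr_ge0 `|x 0 i|; have := sqr_ge0 `|y 0 j|; nra.
Qed.

(** A substitute for the least eigenvalue: nonnegativity of the form at [x - t *: (x *m invmx P)]
    reads 0 <= P(x) - 2 t |x|^2 + t^2 P^-1(x), and for this [t] the last term is at most t |x|^2. *)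
Lemma posdef_lower P : posdef P ->
  exists2 c, 0 < c & forall x, c * sqnorm x <= qform P x.
Proof.
move=> Pp; have [B B0 HB] := bform_bound (invmx P).
exists (2 * B)^-1; first by rewrite invr_gt0 mulr_gt0.
move=> x; pose t := (2 * B)^-1.
have t0 : 0 < t by rewrite invr_gt0 mulr_gt0.
have := posdef_ge0 (x - t *: (x *m invmx P)) Pp.
have Ps := Pp.1.
rewrite qformB// qformZ bformZr.
have -> : bform P x (x *m invmx P) = sqnorm x.
  rewrite sqnormE (bform_sym _ _ Ps) /qform.
  by rewrite -{1}(invmxK P) bform_mul_inv//; exact: posdef_inv.
have -> : qform P (x *m invmx P) = qform (invmx P) x.
  by rewrite -{1}(invmxK P) qform_mul_inv//; exact: posdef_inv.
have := HB x x; rewrite -/(qform _ _) ger0_norm; last exact/posdef_ge0/posdef_inv.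
have tB : t * B = 2^-1 by rewrite /t; field; rewrite gt_eqF.
have := sqnorm_ge0 x; set N := sqnorm x => N0 h1 h2.
have h3 : t ^+ 2 * qform (invmx P) x <= t * N.
  apply: (@le_trans _ _ (t ^+ 2 * (B * (N + N)))); first by rewrite ler_wpM2l// sqr_ge0.
  by rewrite (_ : _ * _ = (t * B) * (2 * (t * N))); [rewrite tB; lra|ring].
rewrite -/t; lra.
Qed.

(** Cauchy-Schwarz for the inner product of [P] between [x] and [e *m invmx P]; the test vector is
    the unnormalized residual of the projection. *)
Lemma posdef_cauchy_schwarz P e x : posdef P ->
  bform 1%:M x e ^+ 2 <= qform (invmx P) e * qform P x.
Proof.
move=> Pp; have [->|e0] := eqVneq e 0.
  by rewrite /bform trmx0 mulmx0 mxE expr0n/= qform0 mul0r.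
have s0 : 0 < qform (invmx P) e by apply: posdef_gt0 => //; exact: posdef_inv.
set s := qform _ e in s0 *; pose b := bform 1%:M x e.
have := posdef_ge0 (s *: x - b *: (e *m invmx P)) Pp.
have Ps := Pp.1.
rewrite qformB// !qformZ bformZr bformZl.
have -> : bform P x (e *m invmx P) = b.
  rewrite (bform_sym _ _ Ps) -{1}(invmxK P) bform_mul_inv; last exact: posdef_inv.
  by rewrite (bform_sym _ _ (trmx1 _ _)).
have -> : qform P (e *m invmx P) = s.
  by rewrite -{1}(invmxK P) qform_mul_inv//; exact: posdef_inv.
rewrite -/b => h; rewrite -subr_ge0 -(pmulr_rge0 _ s0); nra.
Qed.

Lemma posdefD P S : posdef P -> posdef S -> posdef (P + S).
Proof.
move=> Pp Sp; split; first by rewrite linearD/= Pp.1 Sp.1.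
move=> x x0; rewrite -/(bform _ _ _) -/(qform _ _) qformDm.
by rewrite addr_gt0//; exact: posdef_gt0.
Qed.

Lemma posdefZ t P : 0 < t -> posdef P -> posdef (t *: P).
Proof.
move=> t0 Pp; split; first by rewrite linearZ/= Pp.1.
move=> x x0; rewrite -/(bform _ _ _) -/(qform _ _) qformZm.
by rewrite mulr_gt0//; exact: posdef_gt0.
Qed.

(** The precision matrix obtained when a Gaussian density of precision [P] is multiplied by exp(- t
    <x, e>^2 / 2); negative [t] is allowed. *)
Definition rank1_update P t e : 'M[R]_d := P + t *: (e^T *m e).

Lemma qform_rank1 P t e x :
  qform (rank1_update P t e) x = qform P x + t * bform 1%:M x e ^+ 2.
Proof.
rewrite qformDm qformZm; congr (_ + _ * _).
rewrite /qform /bform mulmx1 mulmxA -mulmxA mxE big_ord1 expr2; congr *%R.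
have -> : e *m x^T = (x *m e^T)^T by rewrite trmx_mul trmxK.
by rewrite mxE.
Qed.

(** The matrix determinant lemma: the bordered matrix with corner - 1/t is expanded by eliminating
    either the corner or the block [P]. *)
Lemma det_rank1 P t e : P \in unitmx ->
  \det (rank1_update P t e) = \det P * (1 + t * qform (invmx P) e).
Proof.
move=> uP; have [->|t0] := eqVneq t 0.
  by rewrite mul0r addr0 mulr1 /rank1_update scale0r addr0.
have a0 : - t^-1 != 0 by rewrite oppr_eq0 invr_eq0.
have := @det_schur _ _ (- t^-1) e P a0.
have -> : schur (- t^-1) e P = rank1_update P t e.
  by rewrite /schur /rank1_update invrN invrK scaleNr opprK.
have : \det (block_mx (- t^-1)%:M e e^T P *m
   (block_mx 1%:M 0 (- (invmx P *m e^T)) 1%:M : 'M[R]_(1 + d))) =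
   (- t^-1 - qform (invmx P) e) * \det P.
  rewrite mulmx_block !mulmx1 !mulmx0 !add0r !mulmxN mulKVmx// subrr.
  rewrite det_ublock; congr *%R.
  rewrite det_mx11 mulmxA [LHS]mxE; congr (_ + _).
    by rewrite mxE mulr1n.
  by rewrite mxE.
rewrite det_mulmx det_lblock !det1 !mulr1 => -> h.
apply: (mulfI a0); rewrite -h; field.
by [].
Qed.

(** For negative [t], Cauchy-Schwarz bounds the loss and leaves the factor
    [1 + t * qform (invmx P) e] in front of [qform P x]. *)
Lemma posdef_rank1 P t e : posdef P -> 0 < 1 + t * qform (invmx P) e ->
  posdef (rank1_update P t e).
Proof.
move=> Pp te; split.
  by rewrite linearD linearZ/= Pp.1 trmx_mul trmxK.
move=> x x0; rewrite -/(bform _ _ _) -/(qform _ _) qform_rank1.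
have x1 := posdef_gt0 Pp x0; have cs := posdef_cauchy_schwarz e x Pp.
have [t0|t0] := leP 0 t; first by rewrite ltr_wpDr// mulr_ge0 ?sqr_ge0.
apply: (@lt_le_trans _ _ ((1 + t * qform (invmx P) e) * qform P x)).
  exact: mulr_gt0.
by rewrite mulrDl mul1r lerD2l -mulrA ler_wnM2l// ltW.
Qed.

(* Sherman-Morrison gives the center of the completed square. *)
Lemma qform_rank1_square P t e z c : posdef P -> 1 + t * qform (invmx P) e != 0 ->
  qform P z + t * (bform 1%:M z e - c) ^+ 2 =
  qform (rank1_update P t e)
    (z - (t * c / (1 + t * qform (invmx P) e)) *: (e *m invmx P)) +
  t * c ^+ 2 / (1 + t * qform (invmx P) e).
Proof.
move=> Pp D0; set D := 1 + _ in D0 *; have Ps := Pp.1.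
have ipp := posdef_inv Pp.
have h1 : bform P z (e *m invmx P) = bform 1%:M z e.
  rewrite (bform_sym _ _ Ps) -{1}(invmxK P) bform_mul_inv//.
  by rewrite (bform_sym _ _ (trmx1 _ _)).
have h2 : qform P (e *m invmx P) = qform (invmx P) e.
  by rewrite -{1}(invmxK P) qform_mul_inv.
have h3 : bform 1%:M (e *m invmx P) e = qform (invmx P) e.
  by rewrite /qform /bform mulmx1.
rewrite qform_rank1 qformB// bformZr qformZ h1 h2 bformDl bformNl bformZl h3.
have DE : qform (invmx P) e * t = D - 1 by rewrite /D; ring.
have [t0|t0] := eqVneq t 0; first by rewrite t0; ring.
have -> : qform (invmx P) e = (D - 1) / t by rewrite -DE mulfK.
by field; rewrite t0 D0.
Qed.

End posdef_theory.

(** [f] agrees almost everywhere with the Radon-Nikodym derivative, both integrating to [nu] on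
    every measurable set, so the change of variables for the latter transfers to [f]. *)
Lemma ge0_integral_density (disp : measure_display) (T : measurableType disp)
    (R : realType) (nu : {finite_measure set T -> \bar R})
    (mu : {sigma_finite_measure set T -> \bar R}) (f : T -> R) (g : T -> \bar R) :
    measurable_fun setT f -> (forall x, 0 <= f x) ->
    (forall A, measurable A -> nu A = (\int[mu]_(x in A) (f x)%:E)%E) ->
    measurable_fun setT g -> (forall x, 0 <= g x)%E ->
  (\int[nu]_x g x = \int[mu]_x (g x * (f x)%:E))%E.
Proof.
move=> mf f0 nuE mg g0.
have numu : nu `<< mu.
  apply/null_content_dominatesP => A mA A0; rewrite nuE// null_set_integral//.
  by apply/measurable_EFinP; exact: measurable_funTS.
rewrite -(Radon_Nikodym_SigmaFinite.change_of_variables numu)//.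
apply: ae_eq_integral => //.
- apply: emeasurable_funM => //.
  exact: measurable_int (Radon_Nikodym_SigmaFinite.f_integrable numu).
- by apply: emeasurable_funM => //; exact/measurable_EFinP.
- apply: ae_eqe_mul2l; apply: integral_ae_eq => //.
  + exact: Radon_Nikodym_SigmaFinite.f_integrable.
  + exact/measurable_EFinP.
  + by move=> A _ mA; rewrite -Radon_Nikodym_SigmaFinite.f_integral// nuE.
Qed.

Section gaussian_measures.
Context {R : realType} {d : nat}.
Implicit Types (nu : gparam R d).
Local Notation L := (lebesgue_euclid R d).

Definition gauss_cst nu : R := (Num.sqrt ((2 * pi) ^+ d * \det nu.2))^-1.

Lemma gauss_pdfE nu x : gauss_pdf nu x =
  gauss_cst nu * expR (- qform (invmx nu.2) (rowv x - nu.1) / 2).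
Proof. by []. Qed.

Lemma gauss_cst_gt0 nu : posdef nu.2 -> 0 < gauss_cst nu.
Proof.
move=> Sp; rewrite invr_gt0 sqrtr_gt0 mulr_gt0 ?exprn_gt0 ?mulr_gt0 ?pi_gt0//.
exact: posdef_det_gt0.
Qed.

Lemma gauss_pdf_gt0 nu x : posdef nu.2 -> 0 < gauss_pdf nu x.
Proof. by move=> Sp; rewrite mulr_gt0 ?expR_gt0 ?gauss_cst_gt0. Qed.

Lemma measurable_expR_qform (P : 'M[R]_d) m :
  measurable_fun setT (fun x : euclid R d => (expR (- qform P (rowv x - m) / 2))%:E).
Proof.
apply/measurable_EFinP; apply: measurableT_comp => //.
by apply: measurable_funM => //; apply: measurableT_comp => //; exact: measurable_qform.
Qed.

Lemma gaussT nu : posdef nu.2 -> gauss nu setT = 1%E.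
Proof.
move=> Sp; rewrite /gauss; under eq_integral do rewrite gauss_pdfE EFinM.
rewrite ge0_integralZl//=; last 2 first.
- exact: measurable_expR_qform.
- by rewrite lee_fin ltW// gauss_cst_gt0.
have [_ ->] := integral_gauss_posdef nu.1 (posdef_inv Sp).
rewrite det_inv invrK -EFinM mulVf// gt_eqF// sqrtr_gt0 mulr_gt0//.
  by rewrite exprn_gt0 ?mulr_gt0 ?pi_gt0.
exact: posdef_det_gt0.
Qed.

(** The set function [gauss nu] repackaged with its total mass, so that it can serve as a marginal
    and as the first argument of [KL]. *)
Definition pgauss nu (Sp : posdef nu.2) : probability (euclid R d) R :=
  HB.pack (gauss nu)
    (Measure_isProbability.Build _ _ _ (gauss nu) (gaussT Sp)).

Lemma ge0_integral_gauss nu (g : euclid R d -> \bar R) : posdef nu.2 ->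
    measurable_fun setT g -> (forall x, 0 <= g x)%E ->
  (\int[gauss nu]_x g x = \int[L]_x (g x * (gauss_pdf nu x)%:E))%E.
Proof.
move=> Sp mg g0.
rewrite -(@ge0_integral_density _ _ _ (pgauss Sp))//.
- exact: measurable_gauss_pdf.
- by move=> x; exact: gauss_pdf_ge0.
Qed.

Lemma gauss_dominates nu : gauss nu `<< L.
Proof.
apply/null_content_dominatesP => A mA A0; rewrite /= /gauss null_set_integral//.
by apply/measurable_EFinP; apply: measurable_funTS; exact: measurable_gauss_pdf.
Qed.

Lemma dominates_gauss nu : posdef nu.2 -> L `<< gauss nu.
Proof.
move=> Sp; apply/null_content_dominatesP => A mA A0.
have : ae_eq L A (EFin \o gauss_pdf nu) (cst 0%E).
  apply/ae_eq_integral_abs => //.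
    by apply/measurable_EFinP; apply: measurable_funTS; exact: measurable_gauss_pdf.
  rewrite -[RHS]A0 /gauss; apply: eq_integral => x _ /=.
  by rewrite ger0_norm// gauss_pdf_ge0.
move=> [N [mN N0 sN]].
apply/eqP; rewrite eq_le measure_ge0 andbT -N0.
apply: le_measure; rewrite ?inE// => x Ax; apply: sN => /= /(_ Ax) /eqP.
by rewrite eqe gt_eqF// gauss_pdf_gt0.
Qed.

(** For negative [t] the integrand grows, but the rank-one updated precision stays positive
    definite, so a completed square still gives a Gaussian integral. *)
Lemma integral_gauss_rank1 nu (e : 'rV[R]_d) (t c : R) : posdef nu.2 ->
    0 < 1 + t * qform nu.2 e ->
  (\int[gauss nu]_x (expR (- (t * (bform 1%:M (rowv x) e - c) ^+ 2) / 2))%:E =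
   ((Num.sqrt (1 + t * qform nu.2 e))^-1 *
    expR (- (t * (bform 1%:M nu.1 e - c) ^+ 2 / (1 + t * qform nu.2 e)) / 2))%:E)%E.
Proof.
move=> Sp; set D := 1 + _ => D0.
have Pp := posdef_inv Sp; set P := invmx nu.2 in Pp.
have DE : D = 1 + t * qform (invmx P) e by rewrite /P invmxK.
have D0' := D0; rewrite DE in D0'.
rewrite ge0_integral_gauss//; last first.
  apply/measurable_EFinP; apply: measurableT_comp => //.
  apply: measurable_funM => //; apply: measurableT_comp => //.
  apply: measurable_funM => //; apply: measurable_funX.
  apply: measurable_funB => //; under eq_fun do rewrite -(subr0 (rowv _)).
  exact: measurable_bform.
pose c' := c - bform 1%:M nu.1 e.
pose z0 := (t * c' / D) *: (e *m invmx P).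
pose K := gauss_cst nu * expR (- (t * c' ^+ 2 / D) / 2).
transitivity (\int[L]_x (K%:E * (expR (- qform (rank1_update P t e)
    (rowv x - (nu.1 + z0)) / 2))%:E))%E.
  apply: eq_integral => x _; rewrite gauss_pdfE -!EFinM /K mulrCA -!mulrA -!expRD.
  congr (_ * expR _)%:E.
  have := @qform_rank1_square _ _ P t e (rowv x - nu.1) c' Pp.
  rewrite -DE gt_eqF// => /(_ isT).
  have -> : rowv x - (nu.1 + z0) = rowv x - nu.1 - z0 by rewrite opprD addrA.
  rewrite -/z0 /c' bformDl bformNl => /(congr1 (fun u => - u / 2)).
  rewrite -/P => h; apply: etrans (etrans _ h) _; ring.
rewrite ge0_integralZl//=; last 2 first.
- exact: measurable_expR_qform.
- by rewrite lee_fin mulr_ge0 ?expR_ge0// ltW// gauss_cst_gt0.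
have [_ ->] := integral_gauss_posdef (nu.1 + z0) (posdef_rank1 Pp D0').
rewrite -EFinM; congr EFin; rewrite /K mulrAC; congr (_ * expR _); last first.
  by rewrite /c' -opprB sqrrN.
rewrite det_rank1 ?posdef_unitmx// -DE /gauss_cst /P det_inv.
have det0 := posdef_det_gt0 Sp.
have pi0 : 0 < (2 * pi : R) ^+ d by rewrite exprn_gt0 ?mulr_gt0 ?pi_gt0.
rewrite -[X in X * _]sqrtrV ?mulr_ge0 ?ltW// -sqrtrM ?invr_ge0 ?mulr_ge0 ?ltW//.
rewrite -sqrtrV ?ltW//; congr Num.sqrt; field.
by rewrite !gt_eqF.
Qed.

Lemma gauss_exp_moment nu : posdef nu.2 -> exists del B : R, [/\ 0 < del, 0 < B &
  (\int[gauss nu]_x (expR (del * (1 + sqnorm (rowv x))))%:E <= B%:E)%E].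
Proof.
move=> Sp; have Pp := posdef_inv Sp; set P := invmx nu.2 in Pp.
have [c c0 Hc] := posdef_lower Pp.
have P2 : posdef (2^-1 *: P) by apply: posdefZ => //; rewrite invr_gt0.
have [dP2 HP2] := integral_gauss_posdef nu.1 P2.
(* Since |x|^2 <= 2 |x - m|^2 + 2 |m|^2 and c |x - m|^2 <= Q, this [del] spends at most Q/4 of the
   exponent Q/2; what remains is a Gaussian of precision P/2. *)
pose del := c / 8.
pose K := gauss_cst nu * expR (del * (1 + 2 * sqnorm nu.1)).
have K0 : 0 < K by rewrite mulr_gt0 ?expR_gt0 ?gauss_cst_gt0.
exists del, (K * Num.sqrt ((2 * pi) ^+ d / \det (2^-1 *: P))); split.
- by rewrite divr_gt0.
- by rewrite mulr_gt0// sqrtr_gt0 divr_gt0// exprn_gt0 ?mulr_gt0 ?pi_gt0.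
have mw : measurable_fun setT (fun x : euclid R d =>
    (expR (del * (1 + sqnorm (rowv x))))%:E).
  apply/measurable_EFinP; apply: measurableT_comp => //.
  apply: measurable_funM => //; apply: measurable_funD => //.
  under eq_fun do rewrite sqnormE -(subr0 (rowv _)).
  exact: measurable_qform.
rewrite ge0_integral_gauss//.
rewrite EFinM -HP2 -ge0_integralZl//=; last 2 first.
- exact: measurable_expR_qform.
- by rewrite lee_fin ltW.
apply: ge0_le_integral => //=.
- by move=> x _; rewrite lee_fin mulr_ge0 ?expR_ge0// gauss_pdf_ge0.
- by apply: emeasurable_funM => //; apply/measurable_EFinP; exact: measurable_gauss_pdf.
- by apply: emeasurable_funM => //; exact: measurable_expR_qform.
move=> x _; rewrite -EFinM lee_fin gauss_pdfE /K mulrCA -!mulrA -!expRD.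
apply: ler_wpM2l; first by rewrite ltW// gauss_cst_gt0.
rewrite ler_expR qformZm.
have := Hc (rowv x - nu.1); have := posdef_ge0 (rowv x - nu.1 - nu.1) posdef1.
have := sqnorm_ge0 (rowv x - nu.1).
rewrite -!sqnormE /del -/P.
have -> : sqnorm (rowv x) =
    sqnorm (rowv x - nu.1) + 2 * bform 1%:M (rowv x - nu.1) nu.1 + sqnorm nu.1.
  by rewrite !sqnormE -qformD ?trmx1// subrK.
rewrite [X in _ -> 0 <= X -> _](_ : _ =
    sqnorm (rowv x - nu.1) - 2 * bform 1%:M (rowv x - nu.1) nu.1 + sqnorm nu.1);
  last first.
  by rewrite !sqnormE qformB ?trmx1.
move: (sqnorm (rowv x - nu.1)) (bform _ _ _) (sqnorm nu.1) (qform _ _).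
move=> A b M Q A0 h hQ; nra.
Qed.

End gaussian_measures.

(** * Relative entropy and the Donsker-Varadhan inequality *)

Lemma integral_eq_add (disp : measure_display) (T : measurableType disp)
    (R : realType) (m : {measure set T -> \bar R}) (f g h : T -> R) :
    m.-integrable setT (EFin \o f) -> m.-integrable setT (EFin \o g) ->
    (forall x, h x = f x + g x) ->
  (\int[m]_x (h x)%:E = \int[m]_x (f x)%:E + \int[m]_x (g x)%:E)%E.
Proof.
move=> mf mg hE; rewrite -integralD//.
by apply: eq_integral => x _; rewrite hE.
Qed.

Lemma integral_lincomb (disp : measure_display) (T : measurableType disp)
    (R : realType) (m : {measure set T -> \bar R}) (f g h : T -> R)
    (a b A B : R) :
    m.-integrable setT (EFin \o f) -> m.-integrable setT (EFin \o g) ->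
    (\int[m]_x (f x)%:E = A%:E)%E -> (\int[m]_x (g x)%:E = B%:E)%E ->
    (forall x, h x = a * f x + b * g x) ->
  (\int[m]_x (h x)%:E = (a * A + b * B)%:E)%E.
Proof.
move=> mf mg fA gB hE.
rewrite (@integral_eq_add _ _ _ m (fun x => a * f x) (fun x => b * g x))//.
- rewrite EFinD !EFinM -fA -gB -!integralZl//.
- exact: (integrableZl measurableT a mf).
- exact: (integrableZl measurableT b mg).
Qed.

Lemma integral_probability_cst (disp : measure_display)
    (T : measurableType disp) (R : realType) (p : probability T R) (c : R) :
  (\int[p]_x c%:E = c%:E)%E.
Proof.
rewrite (integral_cst p measurableT c%:E) [X in (_ * X)%E](_ : _ = 1%E) ?mule1//.
exact: probability_setT.
Qed.

(* [l] plays the role of [ln (dp/dm)]: the last hypothesis says that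
   [expR (- l)] is dominated by the density of [m] with respect to [p]. *)
Section entropy.
Context {disp : measure_display} {T : measurableType disp} {R : realType}.
Variables (p : probability T R) (m : {measure set T -> \bar R}) (l : T -> R).
Hypothesis mT : (m setT <= 1)%E.
Hypothesis ml : measurable_fun setT l.
Hypothesis dens_le : forall psi : T -> \bar R, measurable_fun setT psi ->
  (forall x, 0 <= psi x)%E ->
  (\int[p]_x (psi x * (expR (- l x))%:E) <= \int[m]_x psi x)%E.

(** [expR (phi x - ln I - l x)] is the density, relative to [p], of [m] tilted by [phi] and divided
    by [I]; its mass is therefore at most 1. *)
Lemma tilt_integrable (phi : T -> R) (I : R) : measurable_fun setT phi ->
    0 < I -> (\int[m]_x (expR (phi x))%:E <= I%:E)%E ->
  p.-integrable setT (fun x => (expR (phi x - ln I - l x))%:E) /\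
  (\int[p]_x (expR (phi x - ln I - l x))%:E <= 1)%E.
Proof.
move=> mphi I0 HI.
have me : measurable_fun setT (fun x => (expR (phi x - ln I))%:E).
  apply/measurable_EFinP; apply: measurableT_comp => //.
  exact: measurable_funB.
have mr : measurable_fun setT (fun x => (expR (phi x - ln I - l x))%:E).
  apply/measurable_EFinP; apply: measurableT_comp => //.
  by apply: measurable_funB => //; exact: measurable_funB.
have le1 : (\int[p]_x (expR (phi x - ln I - l x))%:E <= 1)%E.
  under eq_integral do rewrite expRD EFinM.
  apply: le_trans (dens_le me _) _; first by move=> x; rewrite lee_fin expR_ge0.
  under eq_integral do rewrite expRD mulrC EFinM.
  rewrite ge0_integralZl//=; last first.
    by apply/measurable_EFinP; apply: measurableT_comp.
  apply: (@le_trans _ _ ((expR (- ln I))%:E * I%:E)%E).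
    by rewrite lee_wpmul2l// lee_fin expR_ge0.
  by rewrite -EFinM expRN lnK ?posrE// mulVf// gt_eqF.
split=> //; apply/integrableP; split => //.
rewrite (le_lt_trans _ (ltry 1))//.
under eq_integral do rewrite /= ger0_norm ?expR_ge0//.
exact: le1.
Qed.

Let exp_integrable : p.-integrable setT (fun x => (expR (- l x))%:E) /\
  (\int[p]_x (expR (- l x))%:E <= 1)%E.
Proof.
have H : (\int[m]_x (expR ((cst 0 : T -> R) x))%:E <= 1%:E)%E.
  by under eq_integral do rewrite expR0; rewrite integral_cst//= mul1e.
have := tilt_integrable (@measurable_cst _ _ _ _ setT (0 : R)) ltr01 H.
rewrite (_ : (fun x => _) = (fun x => (expR (- l x))%:E))//.
by apply/funext => x; rewrite ln1 subr0 sub0r.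
Qed.

(** The negative part of [l] is at most [expR (- l x)], which is integrable, so only the positive
    part can diverge. *)
Let entropy_integrable_or : p.-integrable setT (EFin \o l) \/
  (\int[p]_x (l x)%:E = +oo)%E.
Proof.
have [er er1] := exp_integrable.
have neg : (\int[p]_x ((EFin \o l)^\- x) < +oo)%E.
  rewrite (le_lt_trans _ (ltry 1))// (le_trans _ er1)//.
  apply: ge0_le_integral => //=.
  - by apply: measurable_funeneg; exact/measurable_EFinP.
  - by case/integrableP : er.
  move=> x _; rewrite funenegE /= -EFin_max lee_fin ge_max expR_ge0 andbT.
  by apply: le_trans (expR_ge1Dx _); lra.
have [posy|pos] := eqVneq (\int[p]_x ((EFin \o l)^\+ x))%E +oo%E.
  by right; rewrite integralE/= posy addye// -ltNye lteNr.
left; apply/integrableP; split; first exact/measurable_EFinP.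
have mabs : measurable_fun setT (EFin \o l) by exact/measurable_EFinP.
rewrite (_ : (fun x => _) = ((EFin \o l)^\+ \+ (EFin \o l)^\-)%E); last first.
  by rewrite -fune_abse.
rewrite ge0_integralD//.
- by rewrite lte_add_pinfty// ltey.
- exact: measurable_funepos.
- exact: measurable_funeneg.
Qed.

(** Integrate l >= 1 - e^(-l), where e^(-l) has [p]-mass at most 1. *)
Lemma entropy_ge0 : (0 <= \int[p]_x (l x)%:E)%E.
Proof.
have [il|->] := entropy_integrable_or; last exact: leey.
have [er er1] := exp_integrable.
apply: (@le_trans _ _ (\int[p]_x (1%:E - (expR (- l x))%:E))%E).
  rewrite integralB_EFin//=; last exact: finite_measure_integrable_cst.
  rewrite integral_cst//= probability_setT mule1.
  by rewrite sube_ge0 ?orbT.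
apply: le_integral => //.
  by apply: integrableB => //; exact: finite_measure_integrable_cst.
move=> x _; rewrite -EFinB lee_fin.
by have := expR_ge1Dx (- l x); lra.
Qed.

Lemma entropy_integrable : (\int[p]_x (l x)%:E < +oo)%E ->
  p.-integrable setT (EFin \o l).
Proof. by have [//|->] := entropy_integrable_or; rewrite ltxx. Qed.

(** The pointwise form of Donsker-Varadhan: 1 + u <= e^u at u = phi - ln I - l takes the place of
    Jensen's inequality. *)
Let tilt_ge (phi : T -> R) (I : R) x :
  phi x <= l x + (ln I - 1 + expR (phi x - ln I - l x)).
Proof. by have := expR_ge1Dx (phi x - ln I - l x); lra. Qed.

Let tilt_bound_integrable (phi : T -> R) (I : R) :
    measurable_fun setT phi -> 0 < I ->
    (\int[m]_x (expR (phi x))%:E <= I%:E)%E ->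
    (\int[p]_x (l x)%:E < +oo)%E ->
  p.-integrable setT (fun x => (l x + (ln I - 1 + expR (phi x - ln I - l x)))%:E).
Proof.
move=> mphi I0 HI /entropy_integrable il.
have [it _] := tilt_integrable mphi I0 HI.
have ic : p.-integrable setT (EFin \o cst (ln I - 1)).
  exact: finite_measure_integrable_cst.
exact: (integrableD measurableT il (integrableD measurableT ic it)).
Qed.

(** As [phi] is nonnegative, the one-sided bound [tilt_ge] by an integrable function suffices. *)
Lemma entropy_exp_moment (phi : T -> R) (I : R) : measurable_fun setT phi ->
    (forall x, 0 <= phi x) -> 0 < I ->
    (\int[m]_x (expR (phi x))%:E <= I%:E)%E -> (\int[p]_x (l x)%:E < +oo)%E ->
  p.-integrable setT (EFin \o phi).
Proof.
move=> mphi phi0 I0 HI il.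
apply: le_integrable (tilt_bound_integrable mphi I0 HI il) => //.
  exact/measurable_EFinP.
move=> x _; rewrite /= lee_fin ger0_norm// (le_trans (tilt_ge phi I x))//.
exact: ler_norm.
Qed.

Lemma donsker_varadhan (phi : T -> R) (I : R) :
    p.-integrable setT (EFin \o phi) -> 0 < I ->
    (\int[m]_x (expR (phi x))%:E <= I%:E)%E ->
  (\int[p]_x (phi x)%:E <= \int[p]_x (l x)%:E + (ln I)%:E)%E.
Proof.
move=> iphi I0 HI; have [il|->] := entropy_integrable_or; last first.
  by rewrite addye// leey.
have mphi : measurable_fun setT phi by apply/measurable_EFinP; exact: measurable_int iphi.
have [it it1] := tilt_integrable mphi I0 HI.
apply: (@le_trans _ _ (\int[p]_x (l x + (ln I - 1 + expR (phi x - ln I - l x)))%:E)%E).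
  apply: le_integral => //.
    apply: tilt_bound_integrable => //.
    by rewrite ltey_eq (integrable_fin_num _ il).
  by move=> x _; rewrite lee_fin tilt_ge.
have ic c : p.-integrable setT (EFin \o cst c) by exact: finite_measure_integrable_cst.
under eq_integral do rewrite EFinD.
rewrite integralD//; last exact: (integrableD measurableT (ic _) it).
rewrite leeD2lE ?integrable_fin_num//.
under eq_integral do rewrite EFinD.
rewrite integralD//; last exact: ic.
have -> : (\int[p]_x (ln I - 1)%:E = (ln I - 1)%:E)%E.
  exact: integral_probability_cst.
(* The tilt has [p]-mass at most 1, which makes up for the 1 subtracted in [tilt_ge]. *)
rewrite -[leRHS](_ : (ln I - 1)%:E + 1%:E = _)%E; first by rewrite leeD2lE.
by rewrite -EFinD subrK.
Qed.

End entropy.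

(** * Relative entropy with respect to a Gaussian, expressed through Lebesgue densities *)

Section relative_entropy_to_gaussians.
Context {R : realType} {d : nat}.
Implicit Types (nu : gparam R d) (p : probability (euclid R d) R).
Local Notation L := (lebesgue_euclid R d).

Definition lebesgue_density p (x : euclid R d) : R :=
  fine (Radon_Nikodym_SigmaFinite.f p L x).

(** Both densities are taken against Lebesgue measure, so that replacing the Gaussian changes one
    summand only; [KL_change] rests on this. *)
Definition log_ratio p nu (x : euclid R d) : R :=
  ln (lebesgue_density p x) - ln (gauss_pdf nu x).

Lemma lebesgue_densityE p x : p `<< L ->
  (lebesgue_density p x)%:E = Radon_Nikodym_SigmaFinite.f p L x.
Proof. by move=> pL; rewrite fineK// Radon_Nikodym_SigmaFinite.f_fin_num. Qed.

Lemma lebesgue_density_ge0 p x : p `<< L -> 0 <= lebesgue_density p x.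
Proof. by move=> pL; rewrite fine_ge0// Radon_Nikodym_SigmaFinite.f_ge0. Qed.

Lemma measurable_lebesgue_density p : p `<< L ->
  measurable_fun setT (lebesgue_density p).
Proof.
move=> pL; apply/measurable_EFinP.
rewrite (_ : EFin \o _ = Radon_Nikodym_SigmaFinite.f p L); last first.
  by apply/funext => x /=; rewrite lebesgue_densityE.
exact: measurable_int (Radon_Nikodym_SigmaFinite.f_integrable pL).
Qed.

Lemma measurable_ln_gauss_pdf nu : measurable_fun setT (fun x => ln (gauss_pdf nu x)).
Proof. by apply: measurableT_comp => //; exact: measurable_gauss_pdf. Qed.

Lemma measurable_log_ratio p nu : p `<< L -> measurable_fun setT (log_ratio p nu).
Proof.
move=> pL; apply: measurable_funB; last exact: measurable_ln_gauss_pdf.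
by apply: measurableT_comp => //; exact: measurable_lebesgue_density.
Qed.

Lemma lebesgue_density_gt0 p : p `<< L ->
  {ae p, forall x, 0 < lebesgue_density p x}.
Proof.
move=> pL; exists [set x | lebesgue_density p x <= 0].
have mN : measurable [set x | lebesgue_density p x <= 0].
  rewrite (_ : mkset _ = lebesgue_density p @^-1` `]-oo, 0]); last first.
    by apply/seteqP; split=> x; rewrite /= in_itv.
  by rewrite -[X in measurable X]setTI; exact: measurable_lebesgue_density.
split=> //; last by move=> x /= /negP; rewrite -leNgt.
rewrite (Radon_Nikodym_SigmaFinite.f_integral pL)//.
apply: integral0_eq => x /= x0; rewrite -lebesgue_densityE//; congr EFin.
by apply/eqP; rewrite eq_le x0 lebesgue_density_ge0.
Qed.

(** Supplies the hypothesis [dens_le] of the entropy section. It is an inequality because [gauss nu]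
    also charges the set where the density of [p] vanishes. *)
Lemma exp_log_ratio_le p nu (psi : euclid R d -> \bar R) : posdef nu.2 ->
    p `<< L -> measurable_fun setT psi -> (forall x, 0 <= psi x)%E ->
  (\int[p]_x (psi x * (expR (- log_ratio p nu x))%:E) <= \int[gauss nu]_x psi x)%E.
Proof.
move=> Sp pL mpsi psi0.
have me : measurable_fun setT (fun x => (expR (- log_ratio p nu x))%:E).
  apply/measurable_EFinP; apply: measurableT_comp => //.
  by apply: measurableT_comp => //; exact: (measurable_log_ratio _ pL).
rewrite -(Radon_Nikodym_SigmaFinite.change_of_variables pL)//=; last 2 first.
- by move=> x; rewrite mule_ge0.
- exact: emeasurable_funM.
rewrite ge0_integral_gauss//.
apply: ge0_le_integral => //.
- move=> x _; rewrite !mule_ge0// -lebesgue_densityE// lee_fin.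
  exact: lebesgue_density_ge0.
- apply: emeasurable_funM; first exact: emeasurable_funM.
  exact: measurable_int (Radon_Nikodym_SigmaFinite.f_integrable pL).
- by apply: emeasurable_funM => //; apply/measurable_EFinP; exact: measurable_gauss_pdf.
move=> x _; rewrite -muleA lee_wpmul2l// -lebesgue_densityE// -EFinM lee_fin.
have f0 := gauss_pdf_gt0 x Sp.
have := lebesgue_density_ge0 x pL; rewrite le_eqVlt => /predU1P[<-|g0].
  by rewrite mulr0 ltW.
by rewrite opprB expRD expRN !lnK ?posrE// mulfVK// gt_eqF.
Qed.

Lemma dominates_gaussP p nu : posdef nu.2 -> p `<< gauss nu <-> p `<< L.
Proof.
move=> Sp; split=> h; apply: null_dominates_trans h _.
  exact: gauss_dominates.
exact: dominates_gauss.
Qed.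

(** [gauss nu] and [pgauss Sp] put different structures on one set function, and [Radon_Nikodym]
    takes the structure as argument; proof irrelevance identifies them. *)
Lemma sigma_finite_measure_eq (disp : measure_display) (T : measurableType disp)
    (m1 m2 : {sigma_finite_measure set T -> \bar R}) :
  m1 = m2 :> (set T -> \bar R) -> m1 = m2.
Proof.
move: m1 m2 => [m1 c1] [m2 c2] /= m12; move: c1 c2; rewrite -m12 => c1 c2.
move: c1 c2 => [[p1 p2] [p3] [p4] [p5]] [[q1 q2] [q3] [q4] [q5]].
rewrite (Prop_irrelevance p1 q1) (Prop_irrelevance p2 q2).
by rewrite (Prop_irrelevance p3 q3) (Prop_irrelevance p4 q4) (Prop_irrelevance p5 q5).
Qed.

(** Chain rule along p << gauss nu << Lebesgue, divided by the positive Gaussian density. *)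
Lemma Radon_Nikodym_gauss p nu : posdef nu.2 -> p `<< L ->
  ae_eq p setT (fun x => fine (Radon_Nikodym (charge_of_finite_measure p) (gauss nu) x))
    (fun x => lebesgue_density p x / gauss_pdf nu x).
Proof.
move=> Sp pL; apply: (null_dominates_ae_eq measurableT pL).
have pm : p `<< pgauss Sp by apply/(dominates_gaussP _ Sp).
have mL : pgauss Sp `<< L by exact: gauss_dominates.
have h1 := @Radon_Nikodym_chain_rule _ _ _ (charge_of_finite_measure p) L
  (pgauss Sp) pm mL.
have h2 : ae_eq L setT (Radon_Nikodym (charge_of_finite_measure (pgauss Sp)) L)
    (EFin \o gauss_pdf nu).
  apply: integral_ae_eq => //.
  - exact: Radon_Nikodym_integrable.
  - by apply/measurable_EFinP; exact: measurable_gauss_pdf.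
  - by move=> A _ mA; rewrite -Radon_Nikodym_integral.
have h3 := ae_eq_Radon_Nikodym_SigmaFinite pL measurableT.
have -> : Radon_Nikodym (charge_of_finite_measure p) (gauss nu) =
    Radon_Nikodym (charge_of_finite_measure p) (pgauss Sp).
  congr Radon_Nikodym; exact: sigma_finite_measure_eq.
move: h1 h2 h3; apply: filterS3 => x h1 h2 h3 _.
have f0 := gauss_pdf_gt0 x Sp.
have := h1 I; rewrite -(h3 I) /= (h2 I) -lebesgue_densityE//.
have := @Radon_Nikodym_fin_num _ _ _ (charge_of_finite_measure p) (pgauss Sp) x pm.
case: (Radon_Nikodym _ _ _) => // r _ /= [->].
by rewrite mulfK// gt_eqF.
Qed.

Lemma KL_lebesgue p nu : posdef nu.2 -> p `<< L ->
  KL p (gauss nu) = (\int[p]_x (log_ratio p nu x)%:E)%E.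
Proof.
move=> Sp pL; have pm := (dominates_gaussP p Sp).2 pL.
rewrite /KL asboolT//; apply: ae_eq_integral => //.
- by apply/measurable_EFinP; do 2!apply: measurableT_comp => //.
- by apply/measurable_EFinP; exact: (measurable_log_ratio _ pL).
move: (lebesgue_density_gt0 pL) (Radon_Nikodym_gauss Sp pL).
apply: filterS2 => x g0 /(_ I) -> _.
by rewrite ln_div ?posrE// gauss_pdf_gt0.
Qed.

Lemma KL_lty p nu : posdef nu.2 -> (KL p (gauss nu) < +oo)%E -> p `<< L.
Proof.
rewrite /KL => Sp; case: asboolP; first by move=> /(dominates_gaussP _ Sp).
by rewrite ltxx.
Qed.

Lemma KL_ge0 p nu : posdef nu.2 -> (0 <= KL p (gauss nu))%E.
Proof.
move=> Sp; have [pL|npL] := pselect (p `<< L); last first.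
  by rewrite /KL asboolF// => /(dominates_gaussP _ Sp).
rewrite KL_lebesgue//; apply: (@entropy_ge0 _ _ _ _ (gauss nu)).
- by have /eqP := gaussT Sp; rewrite eq_le => /andP[].
- exact: measurable_log_ratio.
- by move=> psi mpsi psi0; exact: exp_log_ratio_le.
Qed.

Lemma KL_exp_moment p nu (phi : euclid R d -> R) (I : R) : posdef nu.2 ->
    measurable_fun setT phi -> (forall x, 0 <= phi x) -> 0 < I ->
    (\int[gauss nu]_x (expR (phi x))%:E <= I%:E)%E ->
    (KL p (gauss nu) < +oo)%E ->
  p.-integrable setT (EFin \o phi).
Proof.
move=> Sp mphi phi0 I0 HI kl; have pL := KL_lty Sp kl.
apply: (@entropy_exp_moment _ _ _ _ (gauss nu) (log_ratio p nu)) HI _ => //.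
- by have /eqP := gaussT Sp; rewrite eq_le => /andP[].
- exact: measurable_log_ratio.
- by move=> psi mpsi psi0; exact: exp_log_ratio_le.
- by rewrite -KL_lebesgue.
Qed.

Lemma KL_donsker_varadhan p nu (phi : euclid R d -> R) (I : R) : posdef nu.2 ->
    p.-integrable setT (EFin \o phi) -> 0 < I ->
    (\int[gauss nu]_x (expR (phi x))%:E <= I%:E)%E ->
  (\int[p]_x (phi x)%:E <= KL p (gauss nu) + (ln I)%:E)%E.
Proof.
move=> Sp iphi I0 HI; have [pL|npL] := pselect (p `<< L); last first.
  by rewrite /KL asboolF ?addye ?leey// => /(dominates_gaussP _ Sp).
rewrite KL_lebesgue//.
apply: (@donsker_varadhan _ _ _ _ (gauss nu)) => //.
- by have /eqP := gaussT Sp; rewrite eq_le => /andP[].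
- exact: measurable_log_ratio.
- by move=> psi mpsi psi0; exact: exp_log_ratio_le.
Qed.

Lemma KL_log_ratio_integrable p nu : posdef nu.2 -> (KL p (gauss nu) < +oo)%E ->
  p.-integrable setT (EFin \o log_ratio p nu).
Proof.
move=> Sp kl; have pL := KL_lty Sp kl.
apply: (@entropy_integrable _ _ _ _ (gauss nu)).
- by have /eqP := gaussT Sp; rewrite eq_le => /andP[].
- exact: measurable_log_ratio.
- by move=> psi mpsi psi0; exact: exp_log_ratio_le.
- by rewrite -KL_lebesgue.
Qed.

(** Finite entropy transfers the exponential moment of the Gaussian to a second moment of [p], which
    makes every test function of quadratic growth integrable. *)
Lemma KL_second_moment p nu : posdef nu.2 -> (KL p (gauss nu) < +oo)%E ->
  p.-integrable setT (fun x => (1 + sqnorm (rowv x))%:E).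
Proof.
move=> Sp kl; have [del [B [del0 B0 HB]]] := gauss_exp_moment Sp.
have mw : measurable_fun setT (fun x : euclid R d => 1 + sqnorm (rowv x)).
  apply: measurable_funD => //.
  under eq_fun do rewrite sqnormE -(subr0 (rowv _)).
  exact: measurable_qform.
have w0 (x : euclid R d) : 0 <= 1 + sqnorm (rowv x) by rewrite addr_ge0// sqnorm_ge0.
have mphi : measurable_fun setT (fun x : euclid R d => del * (1 + sqnorm (rowv x))).
  exact: measurable_funM.
have := KL_exp_moment Sp mphi _ B0 HB kl.
move=> /(_ (fun x => mulr_ge0 (ltW del0) (w0 x))).
move=> /(integrableZl measurableT del^-1); apply: eq_integrable => // x _ /=.
by rewrite -EFinM mulKf// gt_eqF.
Qed.

Lemma KL_change p nu nu' : posdef nu.2 -> posdef nu'.2 ->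
    (KL p (gauss nu) < +oo)%E ->
    p.-integrable setT (fun x => (ln (gauss_pdf nu x) - ln (gauss_pdf nu' x))%:E) ->
  KL p (gauss nu') = (KL p (gauss nu) +
    \int[p]_x (ln (gauss_pdf nu x) - ln (gauss_pdf nu' x))%:E)%E.
Proof.
move=> Sp Sp' kl il; have pL := KL_lty Sp kl.
have il' := KL_log_ratio_integrable Sp kl.
rewrite [LHS](KL_lebesgue Sp' pL) [X in (X + _)%E](KL_lebesgue Sp pL).
by apply: (integral_eq_add il' il) => x; rewrite /log_ratio addrA subrK.
Qed.

Lemma KL_gauss_gauss nu nu' (Sp : posdef nu.2) : posdef nu'.2 ->
  KL (pgauss Sp) (gauss nu') =
  (\int[pgauss Sp]_x (ln (gauss_pdf nu x) - ln (gauss_pdf nu' x))%:E)%E.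
Proof.
move=> Sp'; have pL : pgauss Sp `<< L by exact: gauss_dominates.
rewrite KL_lebesgue//; apply: ae_eq_integral => //.
- by apply/measurable_EFinP; exact: (measurable_log_ratio _ pL).
- by apply/measurable_EFinP; apply: measurable_funB; exact: measurable_ln_gauss_pdf.
have : ae_eq L setT (Radon_Nikodym_SigmaFinite.f (pgauss Sp) L)
    (EFin \o gauss_pdf nu).
  apply: integral_ae_eq => //.
  - exact: Radon_Nikodym_SigmaFinite.f_integrable.
  - by apply/measurable_EFinP; exact: measurable_gauss_pdf.
  - by move=> A _ mA; rewrite -Radon_Nikodym_SigmaFinite.f_integral.
move=> /(null_dominates_ae_eq measurableT pL).
apply: filterS => x /(_ I) h _.
by rewrite /log_ratio /lebesgue_density h.
Qed.

End relative_entropy_to_gaussians.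

(** * Logarithms of Gaussian densities *)

Section log_density.
Context {R : realType} {d : nat}.
Implicit Types (P : 'M[R]_d) (x y m e : 'rV[R]_d) (nu mu : gparam R d).
Local Notation L := (lebesgue_euclid R d).

Lemma sqnormB_le x y : sqnorm (x - y) <= 2 * sqnorm x + 2 * sqnorm y.
Proof.
have := posdef_ge0 (x + y) posdef1.
by rewrite !sqnormE qformB ?qformD ?trmx1//; lra.
Qed.

Lemma sqnormN x : sqnorm (- x) = sqnorm x.
Proof. by rewrite !sqnormE qformN. Qed.

Lemma measurable_sqnorm :
  measurable_fun setT (fun x : euclid R d => 1 + sqnorm (rowv x)).
Proof.
apply: measurable_funD => //.
under eq_fun do rewrite sqnormE -(subr0 (rowv _)).
exact: measurable_qform.
Qed.

Lemma ln_gauss_pdf nu (z : euclid R d) : posdef nu.2 ->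
  ln (gauss_pdf nu z) =
  ln (gauss_cst nu) - qform (invmx nu.2) (rowv z - nu.1) / 2.
Proof.
move=> Sp; rewrite gauss_pdfE lnM ?posrE ?expR_gt0 ?gauss_cst_gt0//.
by rewrite expRK mulNr.
Qed.

Lemma ln_gauss_pdf_bound nu : posdef nu.2 -> exists2 C, 0 < C &
  forall z : euclid R d, `|ln (gauss_pdf nu z)| <= C * (1 + sqnorm (rowv z)).
Proof.
move=> Sp; have [C C0 HC] := bform_bound (invmx nu.2).
have m0 := sqnorm_ge0 nu.1.
exists (`|ln (gauss_cst nu)| + 2 * C * (1 + sqnorm nu.1)).
  by apply: ltr_wpDl => //; rewrite !mulr_gt0// ltr_pwDl.
move=> z; rewrite ln_gauss_pdf//.
have z0 := sqnorm_ge0 (rowv z).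
have h : `|qform (invmx nu.2) (rowv z - nu.1) / 2| <=
    2 * C * (sqnorm (rowv z) + sqnorm nu.1).
  rewrite normrM (ger0_norm (_ : 0 <= 2^-1 :> R))//.
  have := HC (rowv z - nu.1) (rowv z - nu.1); rewrite -/(qform _ _).
  by have := ler_wpM2l (ltW C0) (sqnormB_le (rowv z) nu.1); lra.
apply: (le_trans (ler_normB _ _)).
have := mulr_ge0 (normr_ge0 (ln (gauss_cst nu))) z0.
have := mulr_ge0 (ltW C0) (mulr_ge0 m0 z0).
lra.
Qed.

(** The increment is of order |x - m| |x - y| + |x - y|^2. Young's inequality with weight [r] moves
    the mixed term into a small multiple of 1 + |x|^2 and a large multiple of |x - y|^2. *)
Lemma qform_modulus P m (eps : R) : P^T = P -> 0 < eps ->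
  exists2 K, 0 < K & forall x y,
  `|qform P (x - m) - qform P (y - m)| <=
    eps * (1 + sqnorm x) + K * sqnorm (x - y).
Proof.
move=> Ps eps0; have [C C0 HC] := bform_bound P.
have m0 := sqnorm_ge0 m.
(* Chosen so that 2 C r |x - m|^2 <= eps (1 + |x|^2), using |x - m|^2 <= 2 (1 + |m|^2) (1 +
   |x|^2). *)
pose r := eps / (4 * C * (1 + sqnorm m)).
have r0 : 0 < r by rewrite divr_gt0// !mulr_gt0// ltr_pwDl.
have C2 : 0 < 2 * C by rewrite mulr_gt0.
exists (2 * C / r + 2 * C); first by rewrite addr_gt0// divr_gt0.
move=> x y; pose a := x - m; pose h := y - x.
have -> : y - m = a + h by rewrite /a /h [RHS]addrC addrA subrK.
have -> : sqnorm (x - y) = sqnorm h by rewrite -sqnormN opprB.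
rewrite -/a (qformD _ _ Ps).
have h0 := sqnorm_ge0 h.
have b1 : `|bform P a h| <= C * (r * sqnorm a + sqnorm h / r).
  have := HC (r *: a) h; rewrite bformZl normrM (gtr0_norm r0) sqnormE qformZ -sqnormE.
  move=> hc; rewrite -(ler_pM2l r0); apply: le_trans hc _.
  by rewrite le_eqVlt; apply/orP; left; apply/eqP; field; exact: lt0r_neq0.
have b2 : `|qform P h| <= 2 * C * sqnorm h.
  by have := HC h h; rewrite -/(qform _ _); lra.
have b3 : 2 * C * (r * sqnorm a) <= eps * (1 + sqnorm x).
  have := sqnormB_le x m; rewrite -/a => ha.
  have x0 := sqnorm_ge0 x.
  apply: (@le_trans _ _ (2 * C * (r * (2 * (1 + sqnorm m) * (1 + sqnorm x))))).
    rewrite (ler_pM2l C2) (ler_pM2l r0).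
    by have := mulr_ge0 m0 x0; lra.
  rewrite le_eqVlt; apply/orP; left; apply/eqP; rewrite /r; field.
  by rewrite !gt_eqF ?ltr_pwDl.
have -> : qform P a - (qform P a + 2 * bform P a h + qform P h) =
    - (2 * bform P a h + qform P h) by ring.
rewrite normrN (le_trans (ler_normD _ _))// normrM (ger0_norm (_ : 0 <= 2 :> R))//.
have -> : (2 * C / r + 2 * C) * sqnorm h = 2 * C * (sqnorm h / r) + 2 * C * sqnorm h.
  by ring.
lra.
Qed.

Lemma ln_gauss_pdf_modulus nu (eps : R) : posdef nu.2 -> 0 < eps ->
  exists2 K, 0 < K & forall y z : euclid R d,
  `|ln (gauss_pdf nu y) - ln (gauss_pdf nu z)| <=
    eps * (1 + sqnorm (rowv y)) + K * sqnorm (rowv y - rowv z).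
Proof.
move=> Sp eps0; have [K K0 HK] := qform_modulus nu.1 (posdef_inv Sp).1 eps0.
exists K => // y z; rewrite !ln_gauss_pdf//.
have := HK (rowv y) (rowv z); rewrite distrC.
move: (qform _ _) (qform _ _) => a b h.
have -> : ln (gauss_cst nu) - a / 2 - (ln (gauss_cst nu) - b / 2) = (b - a) / 2.
  by field.
rewrite normrM (ger0_norm (_ : 0 <= 2^-1 :> R))//.
have := normr_ge0 (b - a); move: h; move: `|_| => u; lra.
Qed.

Lemma qform_add_square (P1 P2 : 'M[R]_d) m1 m2 : posdef P1 -> posdef P2 ->
  exists m c, forall x,
    qform P1 (x - m1) + qform P2 (x - m2) = qform (P1 + P2) (x - m) + c.
Proof.
move=> p1 p2; have pp := posdefD p1 p2.
pose m := (m1 *m P1 + m2 *m P2) *m invmx (P1 + P2).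
have bE x : bform (P1 + P2) x m = bform P1 x m1 + bform P2 x m2.
  rewrite (bform_sym _ _ pp.1) (bform_sym _ _ p1.1) (bform_sym _ _ p2.1).
  by rewrite /bform /m mulmxKV ?posdef_unitmx// mulmxDl mxE.
exists m, (qform P1 m1 + qform P2 m2 - qform (P1 + P2) m) => x.
rewrite (qformB _ _ p1.1) (qformB _ _ p2.1) (qformB _ _ pp.1) bE qformDm.
by ring.
Qed.

(* The normalized product [f_mu^theta f_nu^(1 - theta)] is again Gaussian. *)
Lemma chernoff_gauss (theta : R) mu nu : 0 < theta < 1 ->
    posdef mu.2 -> posdef nu.2 -> exists pi : gparam R d,
  [/\ posdef pi.2, 0 < chernoff_affinity theta mu nu & forall z : euclid R d,
   theta * ln (gauss_pdf mu z) + (1 - theta) * ln (gauss_pdf nu z) =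
   ln (chernoff_affinity theta mu nu) + ln (gauss_pdf pi z)].
Proof.
move=> /andP[t0 t1] mp np.
have t1' : 0 < 1 - theta by rewrite subr_gt0.
have [m [c mcE]] := qform_add_square mu.1 nu.1
  (posdefZ t0 (posdef_inv mp)) (posdefZ t1' (posdef_inv np)).
set P := (_ *: _ + _ *: _) in mcE.
have Pp : posdef P by apply: posdefD; apply: posdefZ => //; exact: posdef_inv.
pose pi : gparam R d := (m, invmx P).
have pip : posdef pi.2 by exact: posdef_inv.
pose k := theta * ln (gauss_cst mu) + (1 - theta) * ln (gauss_cst nu) - c / 2 -
  ln (gauss_cst pi).
have kE z : theta * ln (gauss_pdf mu z) + (1 - theta) * ln (gauss_pdf nu z) =
    k + ln (gauss_pdf pi z).
  rewrite !ln_gauss_pdf// /= invmxK; have := mcE (rowv z); rewrite !qformZm => mcEz.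
  have -> : qform P (rowv z - m) = theta * qform (invmx mu.2) (rowv z - mu.1) +
    (1 - theta) * qform (invmx nu.2) (rowv z - nu.1) - c by rewrite mcEz addrK.
  by rewrite /k; field.
(* Exponentiate [kE] and integrate: [pi] has mass 1, so the constant is the affinity. *)
have rhoE : chernoff_affinity theta mu nu = expR k.
  rewrite /chernoff_affinity /Rintegral.
  under eq_integral => z _.
    have f1 := gauss_pdf_gt0 z mp; have f2 := gauss_pdf_gt0 z np.
    have f3 := gauss_pdf_gt0 z pip.
    rewrite /powR !gt_eqF// -expRD kE expRD lnK ?posrE// EFinM.
    over.
  rewrite ge0_integralZl//=; last 2 first.
  - by apply/measurable_EFinP; exact: measurable_gauss_pdf.
  - by move=> x _; rewrite lee_fin gauss_pdf_ge0.
  have -> : (\int[L]_x (gauss_pdf pi x)%:E = 1)%E by exact: (gaussT pip).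
  by rewrite mule1.
by exists pi; rewrite rhoE expRK expR_gt0.
Qed.

End log_density.

(** * Transport divergence: duality and small-scale limit *)

Lemma integral_marginal (dX dZ : measure_display) (X : measurableType dX)
    (Z : measurableType dZ) (R : realType) (p : probability X R)
    (c : probability Z R) (phi : Z -> X) (g : X -> R) :
    measurable_fun setT phi ->
    (forall A, measurable A -> c (phi @^-1` A) = p A) ->
    p.-integrable setT (EFin \o g) ->
  c.-integrable setT (EFin \o (g \o phi)) /\
  (\int[c]_z (g (phi z))%:E = \int[p]_x (g x)%:E)%E.
Proof.
move=> mphi cp ig.
have mg : measurable_fun setT (EFin \o g) by exact: measurable_int ig.
have E (h : X -> \bar R) : (\int[p]_x h x = \int[pushforward c phi]_x h x)%E.
  by apply: eq_measure_integral => A mA _; exact/esym/cp.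
have igc : c.-integrable setT (EFin \o (g \o phi)).
  apply/integrableP; split.
    by apply: measurableT_comp => //; apply: measurableT_comp => //; exact/measurable_EFinP.
  have /integrableP[_] := ig; rewrite E.
  by rewrite ge0_integral_pushforward//; exact: measurableT_comp.
split=> //.
by rewrite E integral_pushforward.
Qed.

Section transport_duality.
Context {R : realType} {d : nat}.
Implicit Types (mu nu : gparam R d) (p q : probability (euclid R d) R).
Local Notation L := (lebesgue_euclid R d).

Definition quad_bounded (f : euclid R d -> R) :=
  exists C : R, forall x, `|f x| <= C * (1 + sqnorm (rowv x)).

Lemma quad_bounded_integrable p nu (f : euclid R d -> R) : posdef nu.2 ->
    (KL p (gauss nu) < +oo)%E -> measurable_fun setT f -> quad_bounded f ->
  p.-integrable setT (EFin \o f).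
Proof.
move=> Sp kl mf [C HC].
have := integrableZl measurableT C (KL_second_moment Sp kl).
apply: le_integrable => //; first exact/measurable_EFinP.
by move=> x _; rewrite /= lee_fin (le_trans (HC x))// ler_norm.
Qed.

Lemma W2sq_ge0 p q : (0 <= W2sq p q)%E.
Proof.
apply: le_ereal_inf_tmp => _ [c _ <-].
by apply: integral_ge0 => z _; rewrite lee_fin sqnorm_ge0.
Qed.

Lemma measurable_cost : measurable_fun setT
  (fun z : euclid R d * euclid R d => sqnorm (rowv z.1 - rowv z.2)).
Proof.
rewrite /sqnorm; apply: measurable_sum => i; apply: measurable_sum => j.
apply: measurable_funX; under eq_fun do rewrite !mxE.
apply: measurable_funB.
  exact: (measurableT_comp (measurable_tnth j) measurable_fst).
exact: (measurableT_comp (measurable_tnth j) measurable_snd).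
Qed.

Lemma W2sq_diag p : (W2sq p p <= 0)%E.
Proof.
have mdiag : measurable_fun setT
    (fun x : euclid R d => (x, x) : (euclid R d * euclid R d)%type).
  exact: measurable_fun_pair.
pose diag : {mfun euclid R d >-> (euclid R d * euclid R d)%type} :=
  HB.pack (fun x : euclid R d => (x, x)) (isMeasurableFun.Build _ _ _ _ _ mdiag).
pose c : probability (euclid R d * euclid R d)%type R := distribution p diag.
apply: ereal_inf_lbound; exists c; first by move=> A mA; split.
rewrite /c /distribution ge0_integral_pushforward//=; last 2 first.
- by apply/measurable_EFinP; exact: measurable_cost.
- by move=> z _; rewrite lee_fin sqnorm_ge0.
apply: integral0_eq => x _; rewrite /= subrr; congr EFin.
by rewrite /sqnorm big1// => i _; rewrite big1// => j _; rewrite mxE expr0n.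
Qed.

(** The constraint is integrated against an arbitrary coupling. The factor [kappa] keeps [f] and [g]
    on the scale of the entropy terms. *)
Lemma W2sq_dual p q (kappa : R) (f g : euclid R d -> R) : 0 < kappa ->
    p.-integrable setT (EFin \o f) -> q.-integrable setT (EFin \o g) ->
    (forall x y, kappa * (f x + g y) <= sqnorm (rowv x - rowv y)) ->
  (kappa%:E * (\int[p]_x (f x)%:E + \int[q]_x (g x)%:E) <= W2sq p q)%E.
Proof.
move=> k0 fi gi fg; apply: le_ereal_inf_tmp => _ [c cpq <-].
have [fic fE] := integral_marginal (@measurable_fst _ _ _ _) (fun A mA => (cpq A mA).1) fi.
have [gic gE] := integral_marginal (@measurable_snd _ _ _ _) (fun A mA => (cpq A mA).2) gi.
have mc : measurable_fun setT
    (fun z : euclid R d * euclid R d => (sqnorm (rowv z.1 - rowv z.2))%:E).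
  by apply/measurable_EFinP; exact: measurable_cost.
set I := (\int[c]_z _)%E; have [->|Ioo] := eqVneq I +oo%E; first exact: leey.
have ic : c.-integrable setT (fun z => (sqnorm (rowv z.1 - rowv z.2))%:E).
  apply/integrableP; split => //.
  under eq_integral do rewrite /= ger0_norm ?sqnorm_ge0//.
  by rewrite ltey.
rewrite -fE -gE -integralD// -integralZl//; last exact: integrableD.
apply: le_integral => //; first by apply: integrableZl => //; exact: integrableD.
by move=> z _; rewrite -EFinD -EFinM lee_fin.
Qed.

End transport_duality.

Section scaled_affinity.
Context {R : realType} {d : nat}.
Variables (tau0 tau1 : R).
Hypotheses (tau0_gt0 : 0 < tau0) (tau1_gt0 : 0 < tau1).
Implicit Types (mu nu : gparam R d) (p q : probability (euclid R d) R).
Local Notation L := (lebesgue_euclid R d).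
Local Notation s := (tau0 + tau1).
Local Notation theta := (chernoff_order tau0 tau1).
Local Notation T := (transport_div tau0 tau1).

Let s_gt0 : 0 < s. Proof. exact: addr_gt0. Qed.

Lemma chernoff_order_in01 : 0 < theta < 1.
Proof.
by rewrite /chernoff_order divr_gt0//= ltr_pdivrMr// mul1r ltrDl.
Qed.

(** The E_k of the overview, written exactly as in [Zkappa] so that [ZE] holds by conversion. *)
Definition scaled_affinity (kappa : R) mu nu : R :=
  fine (expeR (- (T kappa mu nu * ((kappa * s)^-1)%:E))).

(** Three nonnegative terms with positive weights: one infinite term makes the sum infinite, so only
    competitors with finite terms need a bound. *)
Lemma transport_div_ge kappa mu nu (b : R) : 0 < kappa ->
    posdef mu.2 -> posdef nu.2 ->
    (forall p q (w u v : R), W2sq p q = w%:E -> KL p (gauss mu) = u%:E ->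
      KL q (gauss nu) = v%:E -> 0 <= w -> 0 <= u -> 0 <= v ->
      b <= w + kappa * tau0 * u + kappa * tau1 * v) ->
  (b%:E <= T kappa mu nu)%E.
Proof.
move=> k0 mp np H; apply: le_ereal_inf_tmp => _ [[p q] _ <-] /=.
have := W2sq_ge0 p q; have := KL_ge0 p mp; have := KL_ge0 q np.
move: (H p q); case: (W2sq p q) => [w||]; case: (KL p _) => [u||];
  case: (KL q _) => [v||] // Hpq v0 u0 w0; rewrite ?gt0_muley ?lte_fin ?mulr_gt0//=;
  rewrite ?addye ?addey ?leey//.
by rewrite -!EFinM -!EFinD lee_fin; apply: Hpq.
Qed.

Lemma transport_div_le kappa mu nu p q (w u v : R) : W2sq p q = w%:E ->
    KL p (gauss mu) = u%:E -> KL q (gauss nu) = v%:E ->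
  (T kappa mu nu <= (w + kappa * tau0 * u + kappa * tau1 * v)%:E)%E.
Proof.
by move=> wE uE vE; apply: ereal_inf_lbound; exists (p, q) => //=; rewrite wE uE vE.
Qed.

(* Take both marginals equal to the normalized geometric mean of [mu] and [nu]. *)
Lemma transport_div_fin kappa mu nu : 0 < kappa -> posdef mu.2 -> posdef nu.2 ->
  exists t : R, [/\ T kappa mu nu = t%:E, 0 <= t &
    t <= - (kappa * s * ln (chernoff_affinity theta mu nu))].
Proof.
move=> k0 mp np.
have [pi [pip rho0 H]] := chernoff_gauss chernoff_order_in01 mp np.
set rho := chernoff_affinity _ _ _ in rho0 H *.
have T0 : (0%:E <= T kappa mu nu)%E.
  apply: transport_div_ge => // p q w u v _ _ _ w0 u0 v0.
  by rewrite !addr_ge0// ?mulr_ge0// ltW// mulr_gt0.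
pose p := pgauss pip.
have klpp : KL p (gauss pi) = 0%E.
  rewrite (KL_gauss_gauss pip pip); apply: integral0_eq => x _.
  by rewrite subrr.
have lin nu' : posdef nu'.2 ->
    p.-integrable setT (EFin \o (fun x => ln (gauss_pdf nu' x))).
  move=> np'; apply: (quad_bounded_integrable pip).
  - by rewrite klpp ltry.
  - exact: measurable_ln_gauss_pdf.
  - by have [C _ HC] := ln_gauss_pdf_bound np'; exists C.
have W0 : W2sq p p = 0%E by apply/eqP; rewrite eq_le W2sq_diag W2sq_ge0.
have [F FE] : exists F : gparam R d -> R, forall nu', posdef nu'.2 ->
    (\int[p]_x (ln (gauss_pdf nu' x))%:E)%E = (F nu')%:E.
  exists (fun nu' => fine (\int[p]_x (ln (gauss_pdf nu' x))%:E)%E) => nu' np'.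
  by rewrite fineK// integrable_fin_num//; exact: lin.
have KLE nu' : posdef nu'.2 -> KL p (gauss nu') = (1 * F pi + -1 * F nu')%:E.
  move=> np'; apply: etrans (KL_gauss_gauss pip np') _.
  by apply: (integral_lincomb (lin _ pip) (lin _ np') (FE _ pip) (FE _ np')) => x; ring.
(* The logarithmic identity of [chernoff_gauss], integrated against [p], shows that the entropies
   weighted by theta and 1 - theta sum to - ln rho. *)
have FF : theta * F mu + (1 - theta) * F nu = ln rho * 1 + 1 * F pi.
  apply: EFin_inj.
  rewrite -(@integral_lincomb _ _ _ p _ _
    (fun x => ln rho + ln (gauss_pdf pi x)) _ _ _ _ (lin _ mp) (lin _ np) (FE _ mp) (FE _ np))//.
  apply: (@integral_lincomb _ _ _ p (cst 1)) (lin _ pip) _ (FE _ pip) _.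
  - exact: finite_measure_integrable_cst.
  - exact: integral_probability_cst.
  - by move=> x /=; ring.
have Tle := transport_div_le kappa W0 (KLE _ mp) (KLE _ np).
have Tfin : T kappa mu nu \is a fin_num.
  by rewrite ge0_fin_numE// (le_lt_trans Tle)// ltry.
exists (fine (T kappa mu nu)); rewrite fineK//; split => //.
  by rewrite -lee_fin fineK.
rewrite -lee_fin fineK//; apply: (le_trans Tle); rewrite lee_fin add0r.
have s0 : s != 0 by rewrite gt_eqF.
have sE X Y : kappa * tau0 * X + kappa * tau1 * Y =
    kappa * s * (theta * X + (1 - theta) * Y) by rewrite /chernoff_order; field.
rewrite sE [X in _ * X <= _](_ : _ = F pi - (theta * F mu + (1 - theta) * F nu)); last by ring.
by rewrite FF le_eqVlt; apply/orP; left; apply/eqP; ring.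
Qed.

Lemma scaled_affinity_le kappa mu nu (b : R) : 0 < kappa ->
    posdef mu.2 -> posdef nu.2 -> (b%:E <= T kappa mu nu)%E ->
  scaled_affinity kappa mu nu <= expR (- (b / (kappa * s))).
Proof.
move=> k0 mp np; rewrite /scaled_affinity.
have [t [-> t0 _]] := transport_div_fin k0 mp np.
rewrite lee_fin -EFinM -EFinN /= ler_expR lerN2 => bt.
by rewrite ler_wpM2r// invr_ge0 ltW// mulr_gt0.
Qed.

Lemma scaled_affinityE kappa mu nu (t : R) : T kappa mu nu = t%:E ->
  scaled_affinity kappa mu nu = expR (- (t / (kappa * s))).
Proof. by rewrite /scaled_affinity => ->. Qed.

Lemma scaled_affinity_ge0 kappa mu nu : 0 <= scaled_affinity kappa mu nu.
Proof. by rewrite fine_ge0// expeR_ge0. Qed.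

Lemma chernoff_le_scaled_affinity kappa mu nu : 0 < kappa ->
    posdef mu.2 -> posdef nu.2 ->
  chernoff_affinity theta mu nu <= scaled_affinity kappa mu nu.
Proof.
move=> k0 mp np; have [t [tE t0 tle]] := transport_div_fin k0 mp np.
have [pi [_ rho0 _]] := chernoff_gauss chernoff_order_in01 mp np.
have ks : 0 < kappa * s by rewrite mulr_gt0.
rewrite (scaled_affinityE tE) -[leLHS]lnK ?posrE// ler_expR lerNr.
by rewrite ler_pdivrMr// mulNr mulrC.
Qed.

(** Divided by the scale, the objective is W_2^2 / kappa plus terms free of kappa, hence
    nonincreasing in kappa. *)
Lemma scaled_affinity_nd kappa kappa' mu nu : 0 < kappa -> kappa <= kappa' ->
    posdef mu.2 -> posdef nu.2 ->
  scaled_affinity kappa mu nu <= scaled_affinity kappa' mu nu.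
Proof.
move=> k0 kk mp np; have k'0 := lt_le_trans k0 kk.
have [t [tE t0 _]] := transport_div_fin k'0 mp np.
rewrite (scaled_affinityE tE).
have -> : t / (kappa' * s) = (kappa / kappa' * t) / (kappa * s).
  by field; rewrite !gt_eqF.
apply: scaled_affinity_le => //; apply: transport_div_ge => //.
move=> p q w u v wE uE vE w0 u0 v0.
have := transport_div_le kappa' wE uE vE; rewrite tE lee_fin => ht.
have r0 : 0 < kappa / kappa' by rewrite divr_gt0.
have r1 : kappa / kappa' <= 1 by rewrite ler_pdivrMr// mul1r.
have := ler_wpM2l (ltW r0) ht.
have -> : kappa / kappa' * (w + kappa' * tau0 * u + kappa' * tau1 * v) =
  kappa / kappa' * w + kappa * tau0 * u + kappa * tau1 * v.
  by field; rewrite gt_eqF.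
have := ler_piMl w0 r1; lra.
Qed.

(* Weak Kantorovich duality, then Donsker-Varadhan for each marginal. *)
Lemma scaled_affinity_dual kappa mu nu (f g : euclid R d -> R) (I J : R) :
    0 < kappa -> posdef mu.2 -> posdef nu.2 ->
    measurable_fun setT f -> measurable_fun setT g ->
    quad_bounded f -> quad_bounded g ->
    (forall x y, kappa * (f x + g y) <= sqnorm (rowv x - rowv y)) ->
    0 < I -> (\int[gauss mu]_x (expR (- f x / tau0))%:E <= I%:E)%E ->
    0 < J -> (\int[gauss nu]_x (expR (- g x / tau1))%:E <= J%:E)%E ->
  scaled_affinity kappa mu nu <= expR (theta * ln I + (1 - theta) * ln J).
Proof.
move=> k0 mp np mf mg qf qg fg I0 HI J0 HJ.
pose b := - (kappa * (tau0 * ln I + tau1 * ln J)).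
have ks : 0 < kappa * s by rewrite mulr_gt0.
have -> : theta * ln I + (1 - theta) * ln J = - (b / (kappa * s)).
  by rewrite /b /chernoff_order; field; rewrite !gt_eqF.
apply: scaled_affinity_le => //; apply: transport_div_ge => //.
move=> p q w u v wE uE vE w0 u0 v0.
have pkl : (KL p (gauss mu) < +oo)%E by rewrite uE ltry.
have qkl : (KL q (gauss nu) < +oo)%E by rewrite vE ltry.
have fi := quad_bounded_integrable mp pkl mf qf.
have gi := quad_bounded_integrable np qkl mg qg.
have := W2sq_dual k0 fi gi fg; rewrite wE.
have dv (m : gparam R d) (r : probability (euclid R d) R) (h : euclid R d -> R)
    (c K : R) : 0 < c ->
    r.-integrable setT (EFin \o h) -> posdef m.2 -> 0 < K ->
    (\int[gauss m]_x (expR (- h x / c))%:E <= K%:E)%E ->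
  ((- c^-1)%:E * \int[r]_x (h x)%:E <= KL r (gauss m) + (ln K)%:E)%E.
  move=> c0 hi Sp K0 HK.
  rewrite -integralZl//.
  have hi' : r.-integrable setT (EFin \o (fun x => - h x / c)).
    apply: eq_integrable (integrableZl measurableT (- c^-1) hi) => // x _ /=.
    by rewrite -EFinM mulrC mulrN mulNr.
  have := KL_donsker_varadhan Sp hi' K0 HK.
  congr (_ <= _)%E; apply: eq_integral => x _ /=.
  by rewrite -EFinM mulNr mulrC -mulNr.
have := dv _ _ _ _ _ tau0_gt0 fi mp I0 HI; rewrite uE.
have := dv _ _ _ _ _ tau1_gt0 gi np J0 HJ; rewrite vE.
have := integrable_fin_num measurableT fi; have := integrable_fin_num measurableT gi.
rewrite /comp; case: (\int[q]_x _)%E => // G _; case: (\int[p]_x _)%E => // F _.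
rewrite -!EFinM -!EFinD !lee_fin => h1 h2 h3.
have h1' : - G <= tau1 * (v + ln J).
  by rewrite -ler_pdivrMl//; move: h1; rewrite mulNr mulrN.
have h2' : - F <= tau0 * (u + ln I).
  by rewrite -ler_pdivrMl//; move: h2; rewrite mulNr mulrN.
have := ler_wpM2l (ltW k0) (lerD h1' h2'); rewrite /b; lra.
Qed.

End scaled_affinity.

(** Convexity between 0 and [t]. It makes the price of the regularizer linear in [r] given a single
    exponential moment. *)
Lemma expR_convex_le (R : realType) (r t : R) : 0 <= r <= 1 ->
  expR (r * t) <= 1 + r * expR t.
Proof.
move=> /andP[r0 r1].
have h1 := expR_ge1Dx ((1 - r) * t); have h2 := expR_ge1Dx (- (r * t)).
have e0 := expR_gt0 (r * t).
have e1 : expR t = expR (r * t) * expR ((1 - r) * t) by rewrite -expRD; congr expR; ring.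
have e2 : 1 = expR (r * t) * expR (- (r * t)) by rewrite -expRD subrr expR0.
have r1' : 0 <= 1 - r by rewrite subr_ge0.
have := ler_wpM2l r0 (ler_wpM2l (ltW e0) h1); rewrite -e1 => h3.
have := ler_wpM2l r1' (ler_wpM2l (ltW e0) h2); rewrite -e2 => h4.
by move: h3 h4; lra.
Qed.

Section vanishing_scale_limits.
Context {R : realType} {d : nat}.
Variables (tau0 tau1 : R).
Hypotheses (tau0_gt0 : 0 < tau0) (tau1_gt0 : 0 < tau1).
Implicit Types (mu nu : gparam R d).
Local Notation L := (lebesgue_euclid R d).
Local Notation s := (tau0 + tau1).
Local Notation theta := (chernoff_order tau0 tau1).
Local Notation affinity := (scaled_affinity tau0 tau1).

Let th01 : 0 < theta < 1. Proof. exact: chernoff_order_in01. Qed.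
Let th0 : 0 < theta. Proof. by case/andP: th01. Qed.
Let th1 : 0 < 1 - theta. Proof. by case/andP: th01; rewrite subr_gt0. Qed.

Lemma integral_gauss_expR mu pi (k : R) (phi psi : euclid R d -> R) : posdef mu.2 ->
    posdef pi.2 -> 0 < k -> measurable_fun setT phi -> measurable_fun setT psi ->
    (forall x, phi x + ln (gauss_pdf mu x) = ln k + psi x + ln (gauss_pdf pi x)) ->
  (\int[gauss mu]_x (expR (phi x))%:E =
   k%:E * \int[gauss pi]_x (expR (psi x))%:E)%E.
Proof.
move=> mp pip k0 mphi mpsi H.
have mexp (f : euclid R d -> R) : measurable_fun setT f ->
    measurable_fun setT (fun x => (expR (f x))%:E).
  by move=> mf; apply/measurable_EFinP; exact: measurableT_comp.
rewrite [LHS](ge0_integral_gauss mp)//; last exact: mexp.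
rewrite [X in (_ * X)%E](ge0_integral_gauss pip)//; last exact: mexp.
rewrite -ge0_integralZl//; last 3 first.
- by apply: emeasurable_funM; [exact: mexp|apply/measurable_EFinP; exact: measurable_gauss_pdf].
- by move=> x _; rewrite mule_ge0// lee_fin gauss_pdf_ge0.
- by rewrite lee_fin ltW.
apply: eq_integral => x _; rewrite -!EFinM; congr EFin.
have f1 := gauss_pdf_gt0 x mp; have f2 := gauss_pdf_gt0 x pip.
rewrite -[gauss_pdf mu x]lnK ?posrE// -[gauss_pdf pi x in RHS]lnK ?posrE//.
by rewrite -[k in RHS]lnK ?posrE// -!expRD H addrA.
Qed.

Lemma scaled_affinity_cvg mu nu (e : R) : posdef mu.2 -> posdef nu.2 -> 0 < e ->
  exists2 kappa, 0 < kappa &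
    affinity kappa mu nu <= chernoff_affinity theta mu nu + e.
Proof.
move=> mp np e0.
have [pi [pip rho0 H]] := chernoff_gauss th01 mp np.
set rho := chernoff_affinity _ _ _ in rho0 H *.
have [del [B [del0 B0 HB]]] := gauss_exp_moment pip.
(* [r <= 1] is for [expR_convex_le]; the other bound keeps the final excess [rho * (r * B)] below
   [e]. *)
pose r := Num.min 1 (e / (rho * B)).
have r0 : 0 < r by rewrite lt_min ltr01 divr_gt0// mulr_gt0.
have r1 : r <= 1 by rewrite ge_min lexx.
have re : rho * (r * B) <= e.
  have : r <= e / (rho * B) by rewrite ge_min lexx orbT.
  by rewrite ler_pdivlMr ?mulr_gt0//; lra.
pose eps := r * del; have eps0 : 0 < eps by exact: mulr_gt0.
pose k := tau1 * theta; have k0 : 0 < k by exact: mulr_gt0.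
have kE : tau0 * (1 - theta) = k by rewrite /k /chernoff_order; field; rewrite gt_eqF ?addr_gt0.
(* The modulus of h costs 2 k eps1 (1 + |x|^2), which this choice matches with the regularizer tau0
   eps (1 + |x|^2) inside [f]. *)
pose eps1 := tau0 * eps / (2 * k).
have eps10 : 0 < eps1 by apply: divr_gt0; apply: mulr_gt0.
have [K1 K10 HK1] := ln_gauss_pdf_modulus mp eps10.
have [K2 K20 HK2] := ln_gauss_pdf_modulus np eps10.
pose h (x : euclid R d) := ln (gauss_pdf mu x) - ln (gauss_pdf nu x).
pose w (x : euclid R d) := 1 + sqnorm (rowv x).
pose f x := tau0 * ((1 - theta) * h x - eps * w x).
pose g x := - (tau1 * theta * h x).
have mh : measurable_fun setT h.
  by apply: measurable_funB; exact: measurable_ln_gauss_pdf.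
have mw : measurable_fun setT w by exact: measurable_sqnorm.
have mf : measurable_fun setT f.
  by apply: measurable_funM => //; apply: measurable_funB; exact: measurable_funM.
have mg : measurable_fun setT g.
  by apply: measurableT_comp => //; exact: measurable_funM.
have [C1 C10 HC1] := ln_gauss_pdf_bound mp.
have [C2 C20 HC2] := ln_gauss_pdf_bound np.
have w0 x : 0 < w x by rewrite ltr_pwDl// sqnorm_ge0.
have hC x : `|h x| <= (C1 + C2) * w x.
  by rewrite mulrDl (le_trans (ler_normB _ _))// lerD.
have qf : quad_bounded f.
  exists (tau0 * ((1 - theta) * (C1 + C2) + eps)) => x; rewrite -/(w x).
  rewrite normrM gtr0_norm// -mulrA ler_pM2l// (le_trans (ler_normB _ _))//.
  rewrite [leRHS]mulrDl (normrM (1 - theta)) (normrM eps).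
  rewrite (gtr0_norm th1) (gtr0_norm eps0) (gtr0_norm (w0 x)).
  by rewrite lerD2r -mulrA ler_pM2l.
have qg : quad_bounded g.
  exists (k * (C1 + C2)) => x; rewrite -/(w x) normrN normrM gtr0_norm//.
  by rewrite -mulrA ler_pM2l.
(* Once the regularizer has absorbed the growth, k (K1 + K2) |x - y|^2 is left. *)
pose kappa := (k * (K1 + K2))^-1.
have kap0 : 0 < kappa by rewrite invr_gt0 mulr_gt0// addr_gt0.
exists kappa => //.
have fg x y : kappa * (f x + g y) <= sqnorm (rowv x - rowv y).
  rewrite /kappa ler_pdivrMl; last by rewrite mulr_gt0// addr_gt0.
  have -> : f x + g y = k * (h x - h y) - tau0 * eps * w x.
    rewrite /f /g -/k mulrBr mulrA kE -/k; move: (h x) (h y) (w x) => a b c.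
    by rewrite mulrBr mulrA addrAC.
  have hh : h x - h y <= 2 * eps1 * w x + (K1 + K2) * sqnorm (rowv x - rowv y).
    have subACA (a b c e' : R) : a - b - (c - e') = (a - c) + - (b - e') by ring.
    rewrite /h subACA.
    have h1 := le_trans (ler_norm _) (HK1 x y).
    have h2 : - (ln (gauss_pdf nu x) - ln (gauss_pdf nu y)) <=
        eps1 * w x + K2 * sqnorm (rowv x - rowv y).
      by apply: le_trans (HK2 x y); rewrite -normrN; exact: ler_norm.
    apply: le_trans (lerD h1 h2) _; rewrite -/(w x).
    move: (w x) (sqnorm _) (eps1) => a b c.
    by rewrite le_eqVlt; apply/orP; left; apply/eqP; ring.
  have := ler_wpM2l (ltW k0) hh.
  have -> : k * (2 * eps1 * w x + (K1 + K2) * sqnorm (rowv x - rowv y)) =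
    tau0 * eps * w x + k * (K1 + K2) * sqnorm (rowv x - rowv y).
    move: (w x) (sqnorm _) => a b.
    by rewrite /eps1; field; rewrite gt_eqF.
  by rewrite lerBlDl.
have rB0 : 0 < 1 + r * B by rewrite ltr_pwDl// mulr_ge0// ltW.
have mg' : measurable_fun setT (fun x => - g x / tau1).
  by apply: measurable_funM => //; exact: measurableT_comp.
have mf' : measurable_fun setT (fun x => - f x / tau0).
  by apply: measurable_funM => //; exact: measurableT_comp.
have mw' : measurable_fun setT (fun x => eps * w x) by exact: measurable_funM.
have J1 : (\int[gauss nu]_x (expR (- g x / tau1))%:E <= rho%:E)%E.
  have E x : - g x / tau1 + ln (gauss_pdf nu x) =
      ln rho + (cst 0 : _ -> R) x + ln (gauss_pdf pi x).
    rewrite addr0 -H /g /h; move: (ln _) (ln _) => a b.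
    by field; exact: lt0r_neq0.
  rewrite [leLHS](integral_gauss_expR np pip rho0 mg' (@measurable_cst _ _ _ _ setT _) E).
  under eq_integral do rewrite expR0.
  by rewrite integral_cst//= mul1e -[leRHS]mule1 lee_pmul2l// gaussT.
have I1 : (\int[gauss mu]_x (expR (- f x / tau0))%:E <= (rho * (1 + r * B))%:E)%E.
  have E x : - f x / tau0 + ln (gauss_pdf mu x) =
      ln rho + eps * w x + ln (gauss_pdf pi x).
    rewrite addrAC -H /f /h; move: (ln _) (ln _) (w x) => a b c.
    by field; exact: lt0r_neq0.
  rewrite [leLHS](integral_gauss_expR mp pip rho0 mf' mw' E).
  rewrite EFinM lee_pmul2l//.
  have mexp : measurable_fun setT (fun x => (expR (del * w x))%:E).
    by apply/measurable_EFinP; apply: measurableT_comp => //; exact: measurable_funM.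
  apply: (@le_trans _ _ (\int[gauss pi]_x (1%:E + r%:E * (expR (del * w x))%:E))%E).
    apply: ge0_le_integral => //.
    - by apply/measurable_EFinP; apply: measurableT_comp => //; exact: measurable_funM.
    - by apply: emeasurable_funD => //; exact: emeasurable_funM.
    move=> x _; rewrite -EFinM -EFinD lee_fin /eps -mulrA expR_convex_le//.
    by rewrite (ltW r0).
  rewrite ge0_integralD//=; last 2 first.
  - by move=> x _; rewrite mule_ge0// lee_fin ltW.
  - exact: emeasurable_funM.
  rewrite integral_cst//= mul1e gaussT// ge0_integralZl//=; last by rewrite lee_fin ltW.
  by rewrite EFinD leeD2l// EFinM lee_pmul2l.
have rB1 : 0 < rho * (1 + r * B) by exact: mulr_gt0.
apply: (le_trans (scaled_affinity_dual tau0_gt0 tau1_gt0 kap0 mp np mf mg qf qg fg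
  rB1 I1 rho0 J1)).
apply: (@le_trans _ _ (rho * (1 + r * B))); last by lra.
rewrite -[leRHS]lnK ?posrE// ler_expR.
have : ln rho <= ln (rho * (1 + r * B)).
  by rewrite ler_ln ?posrE// ler_pMr// lerDl mulr_ge0// ltW.
by move=> /(ler_wpM2l (ltW th1)); lra.
Qed.

End vanishing_scale_limits.

(** * Upper semicontinuity in nu, and bounds along one linear coordinate *)

Section stability_and_coercivity.
Context {R : realType} {d : nat}.
Variables (tau0 tau1 : R).
Hypotheses (tau0_gt0 : 0 < tau0) (tau1_gt0 : 0 < tau1).
Implicit Types (mu nu : gparam R d) (e : 'rV[R]_d).
Local Notation s := (tau0 + tau1).
Local Notation theta := (chernoff_order tau0 tau1).
Local Notation affinity := (scaled_affinity tau0 tau1).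
Local Notation T := (transport_div tau0 tau1).

Let th01 : 0 < theta < 1. Proof. exact: chernoff_order_in01. Qed.
Let th0 : 0 < theta. Proof. by case/andP: th01. Qed.
Let th1 : 0 < 1 - theta. Proof. by case/andP: th01; rewrite subr_gt0. Qed.

(** Donsker-Varadhan bounds the moment of [q] by [v], the entropy relative to the fixed [nu]. So [v]
    stands on both sides, but [del] and [B] do not depend on the varying [nu']. *)
Lemma KL_perturbation (q : probability (euclid R d) R) nu nu' (eps del B v' : R) :
    posdef nu.2 -> posdef nu'.2 -> 0 < eps -> 0 < del -> 0 < B ->
    (\int[gauss nu]_x (expR (del * (1 + sqnorm (rowv x))))%:E <= B%:E)%E ->
    (forall x : euclid R d, ln (gauss_pdf nu' x) - ln (gauss_pdf nu x) <=
      eps * (1 + sqnorm (rowv x))) ->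
    KL q (gauss nu') = v'%:E ->
  exists2 v, KL q (gauss nu) = v%:E & v <= v' + eps / del * (v + ln B).
Proof.
move=> np np' eps0 del0 B0 HB H v'E.
have kl' : (KL q (gauss nu') < +oo)%E by rewrite v'E ltry.
pose w (x : euclid R d) := 1 + sqnorm (rowv x).
have iw : q.-integrable setT (EFin \o w) by exact: (KL_second_moment np' kl').
have idw : q.-integrable setT (EFin \o (fun x => del * w x)).
  exact: (integrableZl measurableT del iw).
have idiff : q.-integrable setT
    (EFin \o (fun x => ln (gauss_pdf nu' x) - ln (gauss_pdf nu x))).
  have il m : posdef m.2 -> q.-integrable setT (EFin \o (fun x => ln (gauss_pdf m x))).
    move=> mp; apply: (quad_bounded_integrable np' kl').
      exact: measurable_ln_gauss_pdf.
    by have [C _ HC] := ln_gauss_pdf_bound mp; exists C.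
  exact: (integrableB measurableT (il _ np') (il _ np)).
have [W WE] : exists W, (\int[q]_x (w x)%:E = W%:E)%E.
  by exists (fine (\int[q]_x (w x)%:E)); rewrite fineK//; exact: integrable_fin_num iw.
have [D DE] : exists D, (\int[q]_x
    (ln (gauss_pdf nu' x) - ln (gauss_pdf nu x))%:E = D%:E)%E.
  exists (fine (\int[q]_x (ln (gauss_pdf nu' x) - ln (gauss_pdf nu x))%:E)).
  by rewrite fineK//; exact: integrable_fin_num idiff.
have vE : KL q (gauss nu) = (v' + D)%:E.
  by apply: etrans (KL_change np' np kl' idiff) _; rewrite EFinD -DE -v'E.
exists (v' + D) => //; rewrite lerD2l.
have DW : D <= eps * W.
  rewrite -lee_fin -DE EFinM -WE -integralZl//.
  apply: le_integral => //; first exact: (integrableZl measurableT eps iw).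
  by move=> x _; rewrite -EFinM lee_fin; exact: H.
have := KL_donsker_varadhan np idw B0 HB; rewrite vE.
have -> : (\int[q]_x (del * w x)%:E = (del * W)%:E)%E.
  by rewrite EFinM -WE -integralZl.
rewrite -EFinD lee_fin => h; apply: (le_trans DW).
by rewrite -mulrA ler_pM2l// ler_pdivlMl.
Qed.

(** Absorbing [v] yields T(nu') >= (1 - eta) T(nu) - eta b, hence a multiplicative error e^(eta c)
    on the affinity; it becomes additive because the affinity is at most 1. *)
Lemma scaled_affinity_usc kappa mu nu (e : R) : 0 < kappa ->
    posdef mu.2 -> posdef nu.2 -> 0 < e ->
  exists2 eps, 0 < eps & forall nu', posdef nu'.2 ->
    (forall x : euclid R d, ln (gauss_pdf nu' x) - ln (gauss_pdf nu x) <=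
      eps * (1 + sqnorm (rowv x))) ->
    affinity kappa mu nu' <= affinity kappa mu nu + e.
Proof.
move=> k0 mp np e0.
have [t [tE t0 _]] := transport_div_fin tau0_gt0 tau1_gt0 k0 mp np.
have [del [B [del0 B0 HB]]] := gauss_exp_moment np.
(* [B] is enlarged to [1 + B] so that its logarithm is nonnegative. *)
have HB' : (\int[gauss nu]_x (expR (del * (1 + sqnorm (rowv x))))%:E <= (1 + B)%:E)%E.
  by apply: le_trans HB _; rewrite lee_fin lerDr.
have B1 : 0 < 1 + B by rewrite addr_gt0.
have lB0 : 0 <= ln (1 + B) by rewrite ln_ge0// lerDl ltW.
have ks : 0 < kappa * s by rewrite mulr_gt0// addr_gt0.
pose b := kappa * tau1 * ln (1 + B).
have b0 : 0 <= b by exact: mulr_ge0 (mulr_ge0 (ltW k0) (ltW tau1_gt0)) lB0.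
pose c := (t + b) / (kappa * s).
have c0 : 0 <= c by rewrite divr_ge0 ?addr_ge0// ltW.
have le0 : 0 < ln (1 + e) by rewrite ln_gt0// ltrDl.
(* The first bound lets (1 - eta) v be isolated; the second gives e^(eta c) <= 1 + e. *)
pose eta := Num.min 2^-1 (ln (1 + e) / (c + 1)).
have eta0 : 0 < eta by rewrite lt_min invr_gt0 ltr0n divr_gt0// ltr_wpDl.
have eta1 : eta < 1.
  by apply: (@le_lt_trans _ _ 2^-1); [rewrite ge_min lexx|rewrite invf_lt1// ltr1n].
have etac : eta * c <= ln (1 + e).
  have h : eta <= ln (1 + e) / (c + 1) by rewrite ge_min lexx orbT.
  apply: (@le_trans _ _ (eta * (c + 1))); first by rewrite ler_pM2l// lerDl.
  by rewrite -ler_pdivlMr// ltr_wpDl.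
exists (eta * del); first exact: mulr_gt0.
move=> nu' np' H.
have : (((1 - eta) * t - eta * b)%:E <= T kappa mu nu')%E.
  apply: transport_div_ge => // p q w u v' wE uE v'E w0 u0 v'0.
  have [v vE] := KL_perturbation np np' (mulr_gt0 eta0 del0) del0 B1 HB' H v'E.
  rewrite mulfK ?gt_eqF// => hv.
  have := transport_div_le tau0 tau1 kappa wE uE vE; rewrite tE lee_fin => ht.
  have e1 : 0 <= 1 - eta by rewrite subr_ge0 ltW.
  have h1 := ler_wpM2l e1 ht.
  have kt1 : 0 < kappa * tau1 by exact: mulr_gt0.
  have h2 : kappa * tau1 * ((1 - eta) * v) <= kappa * tau1 * (v' + eta * ln (1 + B)).
    by rewrite ler_pM2l//; move: hv; lra.
  have h3 : (1 - eta) * w <= w by rewrite ler_piMl// gerBl ltW.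
  have h4 : (1 - eta) * (kappa * tau0 * u) <= kappa * tau0 * u.
    apply: ler_piMl; last by rewrite gerBl ltW.
    exact: mulr_ge0 (mulr_ge0 (ltW k0) (ltW tau0_gt0)) u0.
  by move: h1 h2 h3 h4; rewrite /b; lra.
move=> /(scaled_affinity_le tau0_gt0 tau1_gt0 k0 mp np') h.
apply: (le_trans h); rewrite (scaled_affinityE tE).
have -> : - (((1 - eta) * t - eta * b) / (kappa * s)) =
    - (t / (kappa * s)) + eta * c by rewrite /c; field; rewrite gt_eqF ?addr_gt0// gt_eqF.
rewrite expRD.
have A1 : expR (- (t / (kappa * s))) <= 1.
  by rewrite -expR0 ler_expR oppr_le0 divr_ge0// ltW.
have A0 := expR_gt0 (- (t / (kappa * s))).
have E1 : expR (eta * c) <= 1 + e.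
  by rewrite -[leRHS]lnK ?posrE ?addr_gt0// ler_expR.
apply: (@le_trans _ _ (expR (- (t / (kappa * s))) * (1 + e))).
  by rewrite ler_pM2l.
by rewrite mulrDr mulr1 lerD2l ler_piMl// ltW.
Qed.

(** (be^-1 + kappa)^-1 is the largest admissible coefficient of X^2: the difference of the two sides
    is then a perfect square up to a positive factor. *)
Let parallel_square (be kappa X Y : R) : 0 < be -> 0 < kappa ->
  kappa * ((be^-1 + kappa)^-1 * X ^+ 2 - be * Y ^+ 2) <= (X - Y) ^+ 2.
Proof.
move=> be0 k0; have a0 : 0 < be^-1 by rewrite invr_gt0.
rewrite -subr_ge0.
have -> : (X - Y) ^+ 2 - kappa * ((be^-1 + kappa)^-1 * X ^+ 2 - be * Y ^+ 2) =
    (kappa * Y - be^-1 * (X - Y)) ^+ 2 * (be^-1 * (be^-1 + kappa))^-1.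
  have h1 : 1 + kappa * be != 0 by rewrite gt_eqF// addr_gt0// mulr_gt0.
  by field; rewrite h1 gt_eqF.
by rewrite mulr_ge0 ?sqr_ge0// invr_ge0 mulr_ge0 ?addr_ge0// ltW.
Qed.

Lemma bform1_sqr_le x e : sqnorm e <= 1 -> bform 1%:M x e ^+ 2 <= sqnorm x.
Proof.
move=> e1; apply: (le_trans (posdef_cauchy_schwarz e x posdef1)).
by rewrite invmx1 -!sqnormE ler_piMl// sqnorm_ge0.
Qed.

(* The test functions of the dual problem depend on the coordinate
   [bform 1%:M x e] only. *)
Lemma scaled_affinity_rank1 kappa mu nu e (c t0 t1 : R) : 0 < kappa ->
    posdef mu.2 -> posdef nu.2 -> sqnorm e <= 1 ->
    (forall X Y : R, kappa * (tau0 * t0 / 2 * X ^+ 2 + tau1 * t1 / 2 * Y ^+ 2) <=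
      (X - Y) ^+ 2) ->
    let D0 := 1 + t0 * qform mu.2 e in
    let D1 := 1 + t1 * qform nu.2 e in
    0 < D0 -> 0 < D1 ->
  affinity kappa mu nu <=
    expR (- (theta * (ln D0 + t0 * (bform 1%:M mu.1 e - c) ^+ 2 / D0) +
      (1 - theta) * (ln D1 + t1 * (bform 1%:M nu.1 e - c) ^+ 2 / D1)) / 2).
Proof.
move=> k0 mp np e1 H D0 D1 D00 D10.
pose a (x : euclid R d) := bform 1%:M (rowv x) e - c.
have ma : measurable_fun setT a.
  apply: measurable_funB => //; under eq_fun do rewrite -(subr0 (rowv _)).
  exact: measurable_bform.
have ma2 (k : R) : measurable_fun setT (fun x => k * a x ^+ 2).
  by apply: measurable_funM => //; exact: measurable_funX.
have qa (k : R) : quad_bounded (fun x => k * a x ^+ 2).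
  exists (`|k| * (2 + 2 * c ^+ 2)) => x; rewrite normrM -mulrA ler_wpM2l//.
  rewrite ger0_norm ?sqr_ge0// /a.
  have := bform1_sqr_le (rowv x) e1; have := sqnorm_ge0 (rowv x).
  move: (sqnorm _) (bform _ _ _) => N b N0 bN.
  have := mulr_ge0 (sqr_ge0 c) N0; have := sqr_ge0 (b + c); have := sqr_ge0 c.
  by move: bN; rewrite !expr2; lra.
pose I := (Num.sqrt D0)^-1 * expR (- (t0 * (bform 1%:M mu.1 e - c) ^+ 2 / D0) / 2).
pose J := (Num.sqrt D1)^-1 * expR (- (t1 * (bform 1%:M nu.1 e - c) ^+ 2 / D1) / 2).
have I0 : 0 < I by rewrite mulr_gt0 ?expR_gt0// invr_gt0 sqrtr_gt0.
have J0 : 0 < J by rewrite mulr_gt0 ?expR_gt0// invr_gt0 sqrtr_gt0.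
have lnE (D u : R) : 0 < D -> ln ((Num.sqrt D)^-1 * expR (- u / 2)) = - (ln D + u) / 2.
  move=> D0'; have sD : 0 < Num.sqrt D by rewrite sqrtr_gt0.
  rewrite lnM ?posrE ?invr_gt0 ?expR_gt0// expRK lnV ?posrE//.
  have : ln D = 2 * ln (Num.sqrt D).
    by rewrite -[in LHS](sqr_sqrtr (ltW D0')) expr2 lnM ?posrE//; ring.
  by move=> ->; field.
have fg x y : kappa * (tau0 * t0 / 2 * a x ^+ 2 + tau1 * t1 / 2 * a y ^+ 2) <=
    sqnorm (rowv x - rowv y).
  apply: (le_trans (H _ _)).
  have -> : a x - a y = bform 1%:M (rowv x - rowv y) e.
    by rewrite /a bformDl bformNl opprB addrA subrK.
  exact: bform1_sqr_le.
have HI : (\int[gauss mu]_x (expR (- (tau0 * t0 / 2 * a x ^+ 2) / tau0))%:E <= I%:E)%E.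
  have E x : - (tau0 * t0 / 2 * a x ^+ 2) / tau0 =
      - (t0 * (bform 1%:M (rowv x) e - c) ^+ 2) / 2.
    by rewrite -/(a x); move: (a x) => ax; field; rewrite gt_eqF.
  under eq_integral do rewrite E.
  by rewrite [leLHS](integral_gauss_rank1 c mp D00).
have HJ : (\int[gauss nu]_x (expR (- (tau1 * t1 / 2 * a x ^+ 2) / tau1))%:E <= J%:E)%E.
  have E x : - (tau1 * t1 / 2 * a x ^+ 2) / tau1 =
      - (t1 * (bform 1%:M (rowv x) e - c) ^+ 2) / 2.
    by rewrite -/(a x); move: (a x) => ax; field; rewrite gt_eqF.
  under eq_integral do rewrite E.
  by rewrite [leLHS](integral_gauss_rank1 c np D10).
have := scaled_affinity_dual tau0_gt0 tau1_gt0 k0 mp np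
  (ma2 _) (ma2 _) (qa _) (qa _) fg I0 HI J0 HJ.
rewrite (lnE _ _ D00) (lnE _ _ D10); congr (_ <= expR _).
by move: (_ + _ / D0) (_ + _ / D1) => u v; field.
Qed.

(* The scale [kappa] depends on [eta]: a degenerate covariance in direction [e]
   leaves the affinity bounded below at any fixed scale. *)
Lemma scaled_affinity_covariance_lower mu (eta : R) : posdef mu.2 -> 0 < eta ->
  exists kappa del : R, [/\ 0 < kappa, 0 < del & forall nu, posdef nu.2 ->
    eta <= affinity kappa mu nu ->
    forall e, del * sqnorm e <= qform nu.2 e].
Proof.
move=> mp eta0; have [c c0 Hc] := posdef_lower mp.
(* [C] is the bound that [eta <= affinity] imposes on [1 + t0 * sm]. Then [kappa] satisfies C tau0
   kappa = c, half of the 2 c on the left of [h3], and [del] comes from the other half. *)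
pose C := expR (((1 - theta) * ln 2 - 2 * ln eta) / theta).
have C0 : 0 < C by exact: expR_gt0.
pose kappa := c / (C * tau0); pose del := c * tau1 / (4 * C * tau0).
have k0 : 0 < kappa by rewrite divr_gt0// mulr_gt0.
have del0 : 0 < del by rewrite divr_gt0 ?mulr_gt0.
exists kappa, del; split => // nu np etale.
suff unit_case e : sqnorm e = 1 -> del <= qform nu.2 e.
  move=> e; have [->|e0] := eqVneq e 0.
    by rewrite sqnormE !qform0 mulr0.
  have N0 : 0 < sqnorm e by rewrite sqnormE; exact: posdef_gt0 posdef1 e0.
  have sN0 : 0 < Num.sqrt (sqnorm e) by rewrite sqrtr_gt0.
  have sN2 : (Num.sqrt (sqnorm e))^-1 ^+ 2 = (sqnorm e)^-1.
    by rewrite exprVn sqr_sqrtr// ltW.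
  have := unit_case ((Num.sqrt (sqnorm e))^-1 *: e).
  rewrite [sqnorm (_ *: _)]sqnormE !qformZ -sqnormE sN2 mulVf ?gt_eqF//.
  by move=> /(_ erefl); rewrite ler_pdivlMl// mulrC.
move=> e1.
have e0 : e != 0.
  by apply: contra_eq_neq e1 => ->; rewrite sqnormE qform0 eq_sym oner_eq0.
have s0 : 0 < qform nu.2 e by exact: posdef_gt0.
have smu : c <= qform mu.2 e by have := Hc e; rewrite e1 mulr1.
set sig := qform nu.2 e in s0 *; set sm := qform mu.2 e in smu.
(* [t1] is half of the critical value - 1/sig, so the factor for [nu] is exactly 1/2, and [be] is -
   tau1 t1 / 2. A small [sig] makes [be] large and pushes [al] towards 1/kappa. *)
pose be := tau1 / (4 * sig); have be0 : 0 < be by rewrite divr_gt0// mulr_gt0.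
pose al := (be^-1 + kappa)^-1.
have al0 : 0 < al by rewrite invr_gt0 addr_gt0// invr_gt0.
pose t0 := 2 * al / tau0; pose t1 := - (2 * sig)^-1.
have t00 : 0 < t0 by rewrite divr_gt0// mulr_gt0.
have sm0 : 0 < sm by exact: lt_le_trans smu.
have D1E : 1 + t1 * sig = 2^-1 by rewrite /t1; field; rewrite gt_eqF.
have D0 : 1 <= 1 + t0 * sm by rewrite lerDl mulr_ge0// ltW.
(* Centring at the mean of [nu] kills the term with the negative [t1]; the one for [mu] is
   nonnegative and is dropped. *)
have := @scaled_affinity_rank1 kappa mu nu e (bform 1%:M nu.1 e) t0 t1 k0 mp np.
rewrite e1 lexx => /(_ isT); rewrite -/sig -/sm D1E => /=.
move=> /(_ _ (lt_le_trans ltr01 D0)) HH.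
have H2 : 0 < 2^-1 :> R by rewrite invr_gt0.
have {}HH := le_trans etale (HH _ H2).
have : eta <= expR (- (theta * ln (1 + t0 * sm) - (1 - theta) * ln 2) / 2).
  apply: le_trans (HH _) _.
    move=> X Y; have := parallel_square X Y be0 k0; rewrite -/al.
    have -> : tau0 * t0 / 2 = al by rewrite /t0; field; rewrite gt_eqF.
    have -> : tau1 * t1 / 2 = - be by rewrite /t1 /be; field; rewrite gt_eqF.
    by rewrite mulNr.
  rewrite ler_expR ler_pM2r// lerN2 subrr expr0n mulr0 mul0r addr0 lnV ?posrE//.
  rewrite mulrN lerD2r ler_pM2l// lerDl.
  apply: divr_ge0; last exact: le_trans ler01 D0.
  by rewrite mulr_ge0 ?sqr_ge0// ltW.
rewrite -[leLHS]lnK ?posrE// ler_expR => h.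
have : ln (1 + t0 * sm) <= ((1 - theta) * ln 2 - 2 * ln eta) / theta.
  by rewrite ler_pdivlMr//; move: h; move: (ln _) (ln _) (ln _) => a b b'; lra.
rewrite -ler_expR lnK ?posrE ?(lt_le_trans ltr01)// -/C => h1.
have h2 : t0 * sm <= C by apply: le_trans h1; rewrite lerDr.
have h3 : 2 * c <= C * tau0 * (4 * sig / tau1 + kappa).
  have h4 : 2 * c / (tau0 * (4 * sig / tau1 + kappa)) <= C.
    apply: le_trans h2; rewrite /t0 /al /be invf_div.
    have p0 : 0 < 4 * sig / tau1 + kappa by rewrite addr_gt0// divr_gt0// mulr_gt0.
    rewrite [leLHS](_ : _ = 2 / (4 * sig / tau1 + kappa) / tau0 * c).
      by rewrite ler_pM2l// !divr_gt0.
    have q0 : 0 < 4 * sig + kappa * tau1 by apply: addr_gt0; exact: mulr_gt0.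
    by field; rewrite !gt_eqF.
  move: h4; rewrite ler_pdivrMr; first by rewrite mulrA.
  by rewrite mulr_gt0// addr_gt0// divr_gt0// mulr_gt0.
rewrite /del ler_pdivrMr; last by rewrite !mulr_gt0.
have h5 : C * tau0 * kappa = c by rewrite /kappa mulrC mulfVK// gt_eqF// mulr_gt0.
rewrite mulrDr h5 in h3.
have h6 : c <= C * tau0 * (4 * sig / tau1) by move: h3; lra.
rewrite -ler_pdivlMr//; apply: (le_trans h6); rewrite le_eqVlt; apply/orP; left.
by apply/eqP; field; rewrite gt_eqF.
Qed.

(** The roles are exchanged: the growing test function sits on the fixed [mu], centred at its mean.
    What remains contains ln(1 + t1 sig) and the squared gap between means, both nonnegative, so one
    bound [M] controls each. Every positive [kappa] works. *)
Lemma scaled_affinity_upper mu e kappa (eta : R) : posdef mu.2 -> 0 < kappa ->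
    0 < eta -> e != 0 -> sqnorm e <= 1 ->
  exists B : R, forall nu, posdef nu.2 -> eta <= affinity kappa mu nu ->
    qform nu.2 e <= B /\ `|bform 1%:M nu.1 e| <= B.
Proof.
move=> mp k0 eta0 e0 e1.
have sm0 : 0 < qform mu.2 e by exact: posdef_gt0.
set sm := qform mu.2 e in sm0.
pose al := tau0 / (4 * sm); have al0 : 0 < al by rewrite divr_gt0// mulr_gt0.
pose be := (al^-1 + kappa)^-1.
have be0 : 0 < be by rewrite invr_gt0 addr_gt0// invr_gt0.
pose t1 := 2 * be / tau1; pose t0 := - (2 * sm)^-1.
have t10 : 0 < t1 by rewrite divr_gt0// mulr_gt0.
pose M := (theta * ln 2 - 2 * ln eta) / (1 - theta).
(* [expR M / t1] bounds the variance, the next two summands bound the gap between means through |D|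
   <= 1 + D^2, and the last one returns to the mean of [nu]. *)
pose B := expR M / t1 + 1 + `|M| * expR M / t1 + `|bform 1%:M mu.1 e|.
exists B => nu np etale.
have s0 : 0 < qform nu.2 e by exact: posdef_gt0.
set sig := qform nu.2 e in s0 *.
set De := bform 1%:M nu.1 e - bform 1%:M mu.1 e.
have D0E : 1 + t0 * sm = 2^-1 by rewrite /t0; field; rewrite gt_eqF.
have D1 : 1 <= 1 + t1 * sig by rewrite lerDl mulr_ge0// ltW.
have D10 := lt_le_trans ltr01 D1.
have H2 : 0 < 2^-1 :> R by rewrite invr_gt0.
have := @scaled_affinity_rank1 kappa mu nu e (bform 1%:M mu.1 e) t0 t1 k0 mp np e1.
rewrite -/sig -/sm D0E => /= /(_ _ H2 D10) HH.
have : eta <= expR (- (- theta * ln 2 +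
    (1 - theta) * (ln (1 + t1 * sig) + t1 * De ^+ 2 / (1 + t1 * sig))) / 2).
  apply: le_trans etale (le_trans (HH _) _).
    move=> X Y; have := parallel_square Y X al0 k0; rewrite -/be.
    have -> : tau1 * t1 / 2 = be by rewrite /t1; field; rewrite gt_eqF.
    have -> : tau0 * t0 / 2 = - al by rewrite /t0 /al; field; rewrite gt_eqF.
    by rewrite -(sqrrN (Y - X)) opprB mulNr addrC.
  by rewrite subrr expr0n mulr0 mul0r addr0 lnV ?posrE// mulrN -(mulNr theta) -/De.
rewrite -[leLHS]lnK ?posrE// ler_expR => h.
have : ln (1 + t1 * sig) + t1 * De ^+ 2 / (1 + t1 * sig) <= M.
  rewrite ler_pdivlMr//; move: h; move: (ln (1 + _)) (_ / (1 + _)) => a b; lra.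
have q0 : 0 <= t1 * De ^+ 2 / (1 + t1 * sig).
  by apply: divr_ge0 (ltW D10); rewrite mulr_ge0 ?sqr_ge0// ltW.
have l0 : 0 <= ln (1 + t1 * sig) by exact: ln_ge0.
move=> hM.
have h1 : 1 + t1 * sig <= expR M.
  by rewrite -[leLHS]lnK ?posrE// ler_expR; move: hM; lra.
have h2 : t1 * De ^+ 2 / (1 + t1 * sig) <= `|M|.
  by apply: le_trans (ler_norm M); move: hM; lra.
have h3 : t1 * De ^+ 2 <= `|M| * expR M.
  move: h2; rewrite ler_pdivrMr// => h2; apply: (le_trans h2).
  by rewrite ler_wpM2l.
have EM : 0 <= expR M / t1 by rewrite divr_ge0 ?expR_ge0// ltW.
have MM : 0 <= `|M| * expR M / t1 by apply: divr_ge0 (ltW t10); rewrite mulr_ge0// expR_ge0.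
split.
  have : sig <= expR M / t1 by rewrite ler_pdivlMr// mulrC; move: h1; lra.
  have := normr_ge0 (bform 1%:M mu.1 e); rewrite /B.
  by move: EM MM; lra.
have hD : De ^+ 2 <= `|M| * expR M / t1 by rewrite ler_pdivlMr// mulrC.
have hD1 : `|De| <= 1 + `|M| * expR M / t1.
  have := sqr_ge0 (`|De| - 1); rewrite -(real_normK (num_real De)) in hD.
  by move: hD (normr_ge0 De); move: `|De| => D; nra.
have -> : bform 1%:M nu.1 e = De + bform 1%:M mu.1 e by rewrite /De subrK.
apply: (le_trans (ler_normD _ _)); rewrite /B.
by move: hD1 EM; move: `|De| `|bform _ _ _| => a b; lra.
Qed.

End stability_and_coercivity.

(** * Continuity and compactness in mean-covariance coordinates *)

Section parameter_continuity.
Context {R : realType}.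

Lemma cvg_rsum (T I : Type) (F : set_system T) (r : seq I) (f : I -> T -> R)
    (a : I -> R) : Filter F -> (forall i, f i x @[x --> F] --> a i) ->
  \sum_(i <- r) f i x @[x --> F] --> \sum_(i <- r) a i.
Proof.
move=> FF fa; apply: (@cvg_big R I +%R 0 predT) => // x.
exact: add_continuous.
Qed.

Lemma cvg_rprod (T I : Type) (F : set_system T) (r : seq I) (f : I -> T -> R)
    (a : I -> R) : Filter F -> (forall i, f i x @[x --> F] --> a i) ->
  \prod_(i <- r) f i x @[x --> F] --> \prod_(i <- r) a i.
Proof.
move=> FF fa; apply: (@cvg_big R I *%R 1 predT) => // x.
exact: mul_continuous.
Qed.

Lemma cvg_det (T : Type) (F : set_system T) n (M : T -> 'M[R]_n) (N : 'M[R]_n) :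
    Filter F -> (forall i j, M x i j @[x --> F] --> N i j) ->
  \det (M x) @[x --> F] --> \det N.
Proof.
move=> FF MN; apply: cvg_rsum => s; apply: cvgM; first exact: cvg_cst.
by apply: cvg_rprod => i.
Qed.

Lemma cvg_adj (T : Type) (F : set_system T) n (M : T -> 'M[R]_n) (N : 'M[R]_n) :
    Filter F -> (forall i j, M x i j @[x --> F] --> N i j) ->
  forall i j, (\adj (M x)) i j @[x --> F] --> (\adj N) i j.
Proof.
move=> FF MN i j; rewrite mxE; under eq_fun do rewrite mxE.
apply: cvgM; first exact: cvg_cst.
apply: cvg_det => k l; rewrite !mxE; under eq_fun do rewrite !mxE.
exact: MN.
Qed.

(** The constant is explicit, unlike in [bform_bound], because it must tend to 0 with the entries of
    [P]. *)
Lemma bform_sum_le d (P : 'M[R]_d) (x y : 'rV[R]_d) :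
  bform P x y <= (\sum_i \sum_j `|P i j|) * (sqnorm x + sqnorm y).
Proof.
rewrite bformE mulr_suml; apply: ler_sum => i _.
rewrite mulr_suml; apply: ler_sum => j _.
have h : x 0 i * y 0 j <= sqnorm x + sqnorm y /\ - (x 0 i * y 0 j) <= sqnorm x + sqnorm y.
  have := sqr_coord_le x i; have := sqr_coord_le y j.
  have := sqr_ge0 (x 0 i + y 0 j); have := sqr_ge0 (x 0 i - y 0 j).
  have := sqnorm_ge0 x; have := sqnorm_ge0 y.
  move: (x 0 i) (y 0 j) (sqnorm _) (sqnorm _) => a b u v.
  by rewrite !expr2; split; lra.
rewrite mulrAC mulrC (le_trans (ler_norm _))// normrM ler_wpM2l//.
by rewrite ler_norml lerNl; case: h => -> ->.
Qed.

Let quadratic_difference (A1 A2 A3 A4 b b' q q' r r' l l' N : R) :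
    q - q' <= A1 * (N + N) -> b' - b <= A2 * (1 + N) -> r - r' <= A3 ->
    l' - l <= A4 -> 0 <= A3 * N -> 0 <= A4 * N -> 0 <= A1 ->
  l' - (q' - 2 * b' + r') / 2 - (l - (q - 2 * b + r) / 2) <=
    (A1 + A2 + A3 / 2 + A4) * (1 + N).
Proof. lra. Qed.

(** The log-density is a quadratic polynomial whose coefficients are continuous in the parameter;
    [D] collects their differences. Positivity of [nu'] is a premise, since nonsymmetric matrices
    occur in every neighbourhood once d >= 2. *)
Lemma ln_gauss_pdf_near d (nu : gparam R d) (eps : R) : posdef nu.2 -> 0 < eps ->
  \forall nu' \near nu, posdef nu'.2 -> forall x : euclid R d,
    ln (gauss_pdf nu' x) - ln (gauss_pdf nu x) <= eps * (1 + sqnorm (rowv x)).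
Proof.
move=> np eps0.
(* [invmx] branches on invertibility; this formula does not, and agrees with it at positive definite
   covariances. *)
pose Q (v : gparam R d) := (\det v.2)^-1 *: \adj v.2.
have QE (v : gparam R d) : posdef v.2 -> invmx v.2 = Q v.
  by move=> vp; rewrite /invmx posdef_unitmx.
have mcvg j : (fun v : gparam R d => v.1 0 j : R) @ nu --> nu.1 0 j.
  by apply: (@cvg_comp _ _ _ (fun v : gparam R d => v.1) (fun M : 'rV[R]_d => M 0 j));
    [exact: cvg_fst|exact: coord_continuous].
have Scvg i j : (fun v : gparam R d => v.2 i j : R) @ nu --> nu.2 i j.
  by apply: (@cvg_comp _ _ _ (fun v : gparam R d => v.2) (fun M : 'M[R]_d => M i j));
    [exact: cvg_snd|exact: coord_continuous].
have det0 := posdef_det_gt0 np.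
have dcvg : (fun v : gparam R d => \det v.2) @ nu --> \det nu.2 by exact: cvg_det.
have Qcvg i j : (fun v : gparam R d => Q v i j : R) @ nu --> Q nu i j.
  rewrite mxE; under eq_fun do rewrite mxE.
  apply: cvgM; first by apply: cvgV => //; rewrite gt_eqF.
  by apply: cvg_adj.
have mQcvg j : (fun v : gparam R d => (v.1 *m Q v) 0 j : R) @ nu --> (nu.1 *m Q nu) 0 j.
  rewrite mxE; under eq_fun do rewrite mxE.
  by apply: cvg_rsum => i; exact: cvgM.
have qcvg : (fun v : gparam R d => qform (Q v) v.1 : R) @ nu --> qform (Q nu) nu.1.
  rewrite /qform bformE; under eq_fun do rewrite bformE.
  by apply: cvg_rsum => i; apply: cvg_rsum => j; do 2?apply: cvgM.
have ccvg : (fun v : gparam R d => ln (gauss_cst v)) @ nu --> ln (gauss_cst nu).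
  have k0 : 0 < (2 * pi) ^+ d * \det nu.2 :> R.
    by rewrite mulr_gt0// exprn_gt0 ?mulr_gt0 ?pi_gt0.
  have c1 : (fun v : gparam R d => (2 * pi) ^+ d * \det v.2) @ nu -->
      (2 * pi) ^+ d * \det nu.2 by apply: cvgM => //; exact: cvg_cst.
  have c2 : (fun v : gparam R d => gauss_cst v) @ nu --> gauss_cst nu.
    rewrite /gauss_cst; apply: cvgV; first by rewrite gt_eqF// sqrtr_gt0.
    exact: (cvg_comp _ _ c1 (@sqrt_continuous R _)).
  exact: (cvg_comp _ _ c2 (continuous_ln (gauss_cst_gt0 np))).
pose D (v : gparam R d) := \sum_i \sum_j `|Q nu i j - Q v i j| +
  \sum_i `|(v.1 *m Q v) 0 i - (nu.1 *m Q nu) 0 i| +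
  `|qform (Q nu) nu.1 - qform (Q v) v.1| / 2 + `|ln (gauss_cst v) - ln (gauss_cst nu)|.
have Dcvg : D @ nu --> (0 : R).
  have -> : 0 = D nu.
    rewrite /D !subrr normr0 mul0r !addr0 !big1 ?addr0// => i _.
      by rewrite subrr normr0.
    by rewrite big1// => j _; rewrite subrr normr0.
  have nB (f g : gparam R d -> R) : f v @[v --> nu] --> f nu ->
      g v @[v --> nu] --> g nu -> `|f v - g v| @[v --> nu] --> `|f nu - g nu|.
    by move=> fc gc; apply: cvg_norm; exact: cvgB.
  apply: cvgD; last by apply: nB => //; exact: cvg_cst.
  apply: cvgD; last by apply: cvgM; [apply: nB => //; exact: cvg_cst|exact: cvg_cst].
  apply: cvgD.
    by apply: cvg_rsum => i; apply: cvg_rsum => j; apply: nB => //; exact: cvg_cst.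
  by apply: cvg_rsum => i; apply: nB => //; exact: cvg_cst.
have : \forall v \near nu, D v < eps.
  by move/cvgr_lt : Dcvg; exact.
apply: filterS => v Dv vp x.
apply: (@le_trans _ _ (D v * (1 + sqnorm (rowv x)))); last first.
  by apply: ler_wpM2r (ltW Dv); rewrite addr_ge0// sqnorm_ge0.
rewrite !ln_gauss_pdf// !QE//.
have Qs (u : gparam R d) : posdef u.2 -> (Q u)^T = Q u.
  by move=> up; rewrite -QE//; exact: (posdef_inv up).1.
rewrite (qformB _ _ (Qs _ np)) (qformB _ _ (Qs _ vp)).
have z0 := sqnorm_ge0 (rowv x); set z := rowv x in z0 *.
have h1 : qform (Q nu) z - qform (Q v) z <=
    (\sum_i \sum_j `|Q nu i j - Q v i j|) * (sqnorm z + sqnorm z).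
  have -> : qform (Q nu) z - qform (Q v) z = bform (Q nu - Q v) z z.
    by rewrite bformDm /qform /bform mulmxN mulNmx [X in _ = _ + X]mxE.
  apply: le_trans (bform_sum_le _ _ _) _; rewrite le_eqVlt; apply/orP; left.
  apply/eqP; congr (_ * _); apply: eq_bigr => i _; apply: eq_bigr => j _.
  by rewrite !mxE.
have bE (u : gparam R d) : posdef u.2 -> bform (Q u) z u.1 = bform 1%:M (u.1 *m Q u) z.
  by move=> up; rewrite (bform_sym _ _ (Qs _ up)) /bform mulmx1.
have h2 : bform (Q v) z v.1 - bform (Q nu) z nu.1 <=
    (\sum_i `|(v.1 *m Q v) 0 i - (nu.1 *m Q nu) 0 i|) * (1 + sqnorm z).
  rewrite !bE// !bform1E -sumrB mulr_suml; apply: ler_sum => i _.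
  rewrite -mulrBl (le_trans (ler_norm _))// normrM ler_wpM2l//.
  have := sqr_coord_le z i; have := sqr_ge0 (`|z 0 i| - 1).
  rewrite -(real_normK (num_real (z 0 i))); move: `|z 0 i| (sqnorm _) => a b.
  by rewrite !expr2; have := sqr_ge0 a; rewrite expr2; lra.
have h3 := ler_norm (qform (Q nu) nu.1 - qform (Q v) v.1).
have h4 := ler_norm (ln (gauss_cst v) - ln (gauss_cst nu)).
have S0 : 0 <= \sum_i \sum_j `|Q nu i j - Q v i j|.
  by apply: sumr_ge0 => i _; apply: sumr_ge0 => j _.
have h5 := mulr_ge0 (normr_ge0 (qform (Q nu) nu.1 - qform (Q v) v.1)) z0.
have h6 := mulr_ge0 (normr_ge0 (ln (gauss_cst v) - ln (gauss_cst nu))) z0.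
exact: quadratic_difference h1 h2 h3 h4 h5 h6 S0.
Qed.

End parameter_continuity.

Section compact_gaussian_families.
Context {R : realType} {d : nat}.

Lemma continuous_mx_coord (i j : 'I_d) :
  continuous (fun v : gparam R d => v.2 i j : R).
Proof.
move=> v; apply: (@cvg_comp _ _ _ (fun v : gparam R d => v.2) (fun M : 'M[R]_d => M i j)).
  exact: cvg_snd.
exact: coord_continuous.
Qed.

Lemma continuous_mean_coord (j : 'I_d) :
  continuous (fun v : gparam R d => v.1 0 j : R).
Proof.
move=> v; apply: (@cvg_comp _ _ _ (fun v : gparam R d => v.1) (fun M : 'rV[R]_d => M 0 j)).
  exact: cvg_fst.
exact: coord_continuous.
Qed.

(** The image of a box of row vectors of length [d * d] under the continuous [vec_mx]. *)
Lemma mx_box_compact (M : R) :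
  compact [set S : 'M[R]_d | forall i j, `|S i j| <= M].
Proof.
pose box := [set v : 'rV[R]_(d * d) | forall k, `[- M, M]%classic (v 0 k)].
have cbox : compact box.
  by apply: (@rV_compact R _ (fun=> `[- M, M]%classic)) => _; exact: segment_compact.
have cont : continuous (vec_mx : 'rV[R]_(d * d) -> 'M[R]_d).
  move=> v A [P vP PA].
  have : \forall w \near v, forall ij : 'I_d * 'I_d, P ij.1 ij.2 (vec_mx w ij.1 ij.2).
    apply: (@filter_forall _ ('I_d * 'I_d)%type
      (fun ij => [set w : 'rV[R]_(d * d) | P ij.1 ij.2 (vec_mx w ij.1 ij.2)])
      (nbhs v) (nbhs_filter v)) => -[i j] /=.
    have : (fun w : 'rV[R]_(d * d) => vec_mx w i j) @ v --> vec_mx v i j.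
      by rewrite mxE; under eq_fun do rewrite mxE; exact: coord_continuous.
    by apply; exact: vP.
  by apply: filterS => w Pw; apply: PA => i j; exact: (Pw (i, j)).
have := continuous_compact (continuous_subspaceT cont) cbox.
congr compact; apply/seteqP; split.
  move=> _ [v vbox <-] i j; rewrite mxE; have := vbox (mxvec_index i j).
  by rewrite /= in_itv /= ler_norml.
move=> S HS; exists (mxvec S); last by rewrite mxvecK.
move=> k; case/mxvec_indexP: k => i j.
by rewrite /= in_itv /= mxvecE -ler_norml.
Qed.

Lemma closed_continuous_ge0 (T : topologicalType) (f : T -> R) :
  continuous f -> closed [set v | 0 <= f v].
Proof. by move=> fc; exact: ((continuous_closedP f).1 fc _ (@closed_ge R 0)). Qed.

(** The uniform lower bound, a closed condition for each [e], keeps limits among the nondegenerate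
    Gaussians when [del] is positive. *)
Definition gaussian_box (M del : R) : set (gparam R d) :=
  [set v : gparam R d | [/\ v.2^T = v.2, forall j, `|v.1 0 j| <= M, forall i j, `|v.2 i j| <= M &
    forall e, del * sqnorm e <= qform v.2 e]].

Lemma gaussian_box_posdef (M del : R) : 0 < del ->
  gaussian_box M del `<=` gaussians R d.
Proof.
move=> del0 v [vs _ _ vl]; split=> // x x0.
rewrite -/(bform _ _ _) -/(qform _ _); apply: lt_le_trans (vl x).
by rewrite mulr_gt0// sqnormE; exact: posdef_gt0 posdef1 x0.
Qed.

Lemma gaussian_box_compact (M del : R) : compact (gaussian_box M del).
Proof.
pose B1 := [set m : 'rV[R]_d | forall k, `[- M, M]%classic (m 0 k)].
have cB1 : compact B1.
  by apply: (@rV_compact R _ (fun=> `[- M, M]%classic)) => _; exact: segment_compact.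
(* Symmetry is stated as inequalities over all ordered pairs of indices, so that
   [closed_continuous_ge0] applies to it too. *)
pose C1 := \bigcap_(ij in [set: 'I_d * 'I_d])
  [set v : gparam R d | 0 <= v.2 ij.2 ij.1 - v.2 ij.1 ij.2].
pose C2 := \bigcap_(e in [set: 'rV[R]_d])
  [set v : gparam R d | 0 <= qform v.2 e - del * sqnorm e].
have cC1 : closed C1.
  apply: closed_bigI => -[i j] _; apply: closed_continuous_ge0 => v.
  by apply: cvgB; exact: continuous_mx_coord.
have cC2 : closed C2.
  apply: closed_bigI => e _; apply: closed_continuous_ge0 => v.
  apply: cvgB; last exact: cvg_cst.
  rewrite /qform bformE; under eq_fun do rewrite bformE.
  apply: cvg_rsum => i; apply: cvg_rsum => j.
  apply: cvgM; last exact: cvg_cst.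
  by apply: cvgM; [exact: cvg_cst|exact: continuous_mx_coord].
have := compact_closedI (compact_closedI (compact_setX cB1 (@mx_box_compact M)) cC1) cC2.
congr compact; apply/seteqP; split.
  move=> v [[[v1 v2] vC1] vC2]; split.
  - apply/matrixP => i j; rewrite mxE; apply/eqP; rewrite eq_le.
    by have := vC1 (i, j) I; have := vC1 (j, i) I; rewrite /= !subr_ge0 => -> ->.
  - by move=> k; have := v1 k; rewrite /= in_itv/= ler_norml.
  - exact: v2.
  - by move=> e; have := vC2 e I; rewrite /= subr_ge0.
move=> v [vs v1 v2 ve]; split; first split; first split => //.
- by move=> k; rewrite /= in_itv/= -ler_norml.
- by move=> [i j] _ /=; rewrite -[in X in X - _]vs mxE subrr.
- by move=> e _; rewrite /= subr_ge0.
Qed.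

End compact_gaussian_families.

Section coercivity.
Context {R : realType} {d : nat}.
Variables (tau0 tau1 : R).
Hypotheses (tau0_gt0 : 0 < tau0) (tau1_gt0 : 0 < tau1).
Local Notation affinity := (scaled_affinity tau0 tau1).

Let dirac_row (i : 'I_d) : 'rV[R]_d := delta_mx 0 i.

Let bform_dirac (S : 'M[R]_d) i j : bform S (dirac_row i) (dirac_row j) = S i j.
Proof. by rewrite /bform /dirac_row -rowE trmx_delta -colE !mxE. Qed.

(** Off-diagonal covariances are reached by polarization; the factor 1/2 meets the norm bound
    required by [scaled_affinity_upper], and i = j gives the basis vector itself. *)
Let dirac_mean (i j : 'I_d) : 'rV[R]_d := 2^-1 *: (dirac_row i + dirac_row j).

Let qform_dirac_mean (S : 'M[R]_d) i j : S^T = S ->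
  qform S (dirac_mean i j) = 4^-1 * (S i i + 2 * S i j + S j j).
Proof.
move=> Ss; rewrite qformZ qformD// /qform !bform_dirac.
by congr (_ * _); rewrite expr2 -invfM -natrM.
Qed.

Let dirac_mean_neq0 i j : dirac_mean i j != 0.
Proof.
apply/eqP => /rowP /(_ i); rewrite !mxE !eqxx /=; apply/eqP; by rewrite gt_eqF.
Qed.

Let dirac_mean_le1 i j : sqnorm (dirac_mean i j) <= 1.
Proof.
rewrite sqnormE qform_dirac_mean ?trmx1// !mxE !eqxx.
by case: (i == j) => /=; lra.
Qed.

Lemma scaled_affinity_coercive (mu : gparam R d) (eta : R) : posdef mu.2 -> 0 < eta ->
  exists (kappa : R) (K : set (gparam R d)), [/\ 0 < kappa, compact K,
    K `<=` gaussians R d &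
    forall nu, posdef nu.2 -> eta <= affinity kappa mu nu -> K nu].
Proof.
move=> mp eta0.
have [kappa [del [k0 del0 Hl]]] :=
  scaled_affinity_covariance_lower tau0_gt0 tau1_gt0 mp eta0.
have [B HB] := choice (fun ij : 'I_d * 'I_d => scaled_affinity_upper tau0_gt0 tau1_gt0
  mp k0 eta0 (dirac_mean_neq0 ij.1 ij.2) (dirac_mean_le1 ij.1 ij.2)).
pose N := \sum_ij `|B ij|.
have BN ij : B ij <= N.
  by rewrite /N (bigD1 ij)//= (le_trans (ler_norm _))// lerDl sumr_ge0.
have N0 : 0 <= N by exact: sumr_ge0.
exists kappa, (gaussian_box (4 * N) del); split => //.
- exact: gaussian_box_compact.
- exact: gaussian_box_posdef.
move=> nu np etale; have Ss := np.1.
have Hq i j : 4^-1 * (nu.2 i i + 2 * nu.2 i j + nu.2 j j) <= N.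
  rewrite -(qform_dirac_mean _ _ Ss); have [h _] := HB (i, j) nu np etale.
  exact: le_trans h (BN _).
have Sd i : 0 <= nu.2 i i by rewrite -bform_dirac; exact: posdef_ge0.
split => //.
- move=> j; have [_] := HB (j, j) nu np etale.
  have -> : dirac_mean j j = dirac_row j.
    by apply/rowP => k; rewrite !mxE; case: (_ == _) => /=; field.
  have -> : bform 1%:M nu.1 (dirac_row j) = nu.1 0 j.
    by rewrite /bform mulmx1 trmx_delta -colE mxE.
  by move=> h; have := le_trans h (BN _); lra.
- move=> i j; have := Hq i j; have := Hq i i; have := Hq j j.
  have := Sd i; have := Sd j.
  have := posdef_ge0 (dirac_mean i j) np; rewrite (qform_dirac_mean _ _ Ss).
  by rewrite ler_norml; move: (nu.2 i i) (nu.2 j j) (nu.2 i j) => a b c *; lra.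
- exact: Hl np etale.
Qed.

End coercivity.

(** * Maximizers of upper semicontinuous functions along a vanishing scale *)

(** The superlevel sets at attained values generate a proper filter. By semicontinuity no value
    exceeds the one at a cluster point. *)
Lemma usc_compact_max (R : realType) (T : topologicalType) (K : set T)
    (f : T -> R) : compact K -> K !=set0 ->
    (forall x c, K x -> f x < c -> \forall y \near x, K y -> f y < c) ->
  exists2 x, K x & forall y, K y -> f y <= f x.
Proof.
move=> Kc [x0 Kx0] usc.
pose B z := K `&` [set y | f z <= f y].
have FF : ProperFilter (filter_from K B).
  apply: filter_from_proper; last by move=> z Kz; exists z; split => /=.
  apply: filter_from_filter; first by exists x0.
  move=> y z Ky Kz; have [yz|zy] := leP (f y) (f z).
    by exists z => // t [Kt /= zt]; do 2!split => //=; exact: le_trans zt.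
  by exists y => // t [Kt /= yt]; do 2!split => //=; exact: (le_trans (ltW zy)).
have [|x [Kx clx]] := Kc _ FF; first by exists x0 => // t [].
exists x => // y Ky; rewrite leNgt; apply/negP => xy.
have By : filter_from K B (B y) by exists y.
by have [z [[Kz /= yz] /(_ Kz)]] := clx _ _ By (usc _ _ Kx xy); rewrite ltNge yz.
Qed.

(* [Z k] decreases to [Z0] as [k] tends to 0. *)
Section vanishing_scale.
Context (R : realType) (T : topologicalType) (G : set T).
Variables (Z : R -> T -> R) (Z0 : T -> R).
Hypothesis Z_ge : forall (k : R) x, 0 < k -> G x -> Z0 x <= Z k x.
Hypothesis Z_nd : forall (k k' : R) x, 0 < k -> k <= k' -> G x -> Z k x <= Z k' x.
Hypothesis Z_cvg : forall x (e : R), G x -> 0 < e ->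
  exists2 k : R, 0 < k & Z k x <= Z0 x + e.
Hypothesis Z_usc : forall (k : R) x (e : R), 0 < k -> G x -> 0 < e ->
  \forall y \near x, G y -> Z k y <= Z k x + e.
Hypothesis Z_coercive : forall eta : R, 0 < eta -> exists (k : R) (K : set T),
  [/\ 0 < k, compact K, K `<=` G & forall x, G x -> eta <= Z k x -> K x].
Hypothesis Z0_gt0 : exists2 x, G x & 0 < Z0 x.

(** Semicontinuity is used at one scale [k] where Z is already close to Z0; monotonicity extends the
    bound to all smaller scales, hence jointly in [y] and the scale. *)
Lemma Z_lt_near x c : G x -> Z0 x < c ->
  \forall y \near x & k \near 0^'+, G y -> Z k y < c.
Proof.
move=> Gx xc; pose e := (c - Z0 x) / 3.
have e0 : 0 < e by rewrite /e; lra.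
have [k k0 Zk] := Z_cvg Gx e0.
near=> y k' => /= Gy.
have k'0 : 0 < k' by near: k'; exact: nbhs_right_gt.
apply: (@le_lt_trans _ _ (Z k y)).
  by apply: Z_nd => //; near: k'; exact: nbhs_right_ltW.
apply: (@le_lt_trans _ _ (Z k x + e)); last by rewrite /e in Zk *; lra.
by move: Gy; near: y; exact: Z_usc.
Unshelve. all: by end_near. Qed.

Lemma Z0_lt_near x c : G x -> Z0 x < c -> \forall y \near x, G y -> Z0 y < c.
Proof.
move=> Gx xc; have [[U V] /= [Ux V0] UV] := Z_lt_near Gx xc.
have [k [Vk k0]] : exists k, V k /\ 0 < k.
  by have := @filter_ex _ (0^'+ : set_system R) _ _
    (filterI V0 (nbhs_right_gt _)); exact.
apply: filterS Ux => y Uy Gy.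
by apply: le_lt_trans (UV (y, k) _ Gy) => //; exact: Z_ge.
Qed.

(** As Z0 <= Z k, the set lies in a coercivity compact; semicontinuity of Z0 keeps cluster points at
    level [eta]. *)
Lemma Z0_superlevel_compact eta : 0 < eta ->
  compact [set x | G x /\ eta <= Z0 x].
Proof.
move=> eta0; have [k [K [k0 Kc KG HK]]] := Z_coercive eta0.
move=> F PF FS.
have FK : F K.
  apply: filterS FS => x [Gx ex]; apply: HK => //.
  by apply: le_trans ex _; exact: Z_ge.
have [x [Kx clx]] := Kc F PF FK; exists x; split => //; split; first exact: KG.
rewrite leNgt; apply/negP => xe.
have [y [[Gy ey] /(_ Gy)]] := clx _ _ FS (Z0_lt_near (KG _ Kx) xe).
by rewrite ltNge ey.
Qed.

Lemma argmax_Z0_nonempty : argmax G Z0 !=set0.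
Proof.
have [x0 Gx0 x00] := Z0_gt0.
have [||x [Gx x0x] xM] := @usc_compact_max _ _ _ Z0 (Z0_superlevel_compact x00).
- by exists x0; split => /=.
- move=> x c [Gx _] xc; apply: filterS (Z0_lt_near Gx xc) => y + [Gy _].
  exact.
exists x; split => // y Gy.
have [yx|xy] := leP (Z0 y) (Z0 x0); first exact: le_trans x0x.
by apply: xM; split => //; exact: ltW.
Qed.

Lemma argmax_Z0_compact : compact (argmax G Z0).
Proof.
have [x [Gx xM]] := argmax_Z0_nonempty.
have [x0 Gx0 x00] := Z0_gt0.
have := Z0_superlevel_compact (lt_le_trans x00 (xM _ Gx0)).
congr compact; apply/seteqP; split => y [Gy] yM; split => //.
  by move=> z Gz; exact: le_trans (xM _ Gz) yM.
exact: yM.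
Qed.

Lemma argmax_sup (f : T -> R) x : argmax G f x -> sup [set f y | y in G] = f x.
Proof.
move=> [Gx xM]; apply/eqP; rewrite eq_le; apply/andP; split.
  by apply: ge_sup; [exists (f x), x|move=> _ [y Gy <-]; exact: xM].
by apply: ub_le_sup; [exists (f x) => _ [y Gy <-]; exact: xM|exists x].
Qed.

Lemma max_Z0_gt0 : 0 < sup [set Z0 x | x in G].
Proof.
have [x Ax] := argmax_Z0_nonempty; rewrite (argmax_sup Ax).
by have [x0 Gx0 /lt_le_trans] := Z0_gt0; apply; exact: Ax.2.
Qed.

(** Let [x] maximize Z0. Points where Z k' is at most Z0 x cannot beat [x], and the others lie in
    the compact attached to the level Z0 x, provided k' is small. *)
Lemma argmax_Z_nonempty : \forall k \near 0^'+, argmax G (Z k) !=set0.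
Proof.
have [x [Gx xM]] := argmax_Z0_nonempty.
have x0 : 0 < Z0 x by rewrite -(argmax_sup (conj Gx xM)) max_Z0_gt0.
have [k [K [k0 Kc KG HK]]] := Z_coercive x0.
near=> k'.
have k'0 : 0 < k' by near: k'; exact: nbhs_right_gt.
have k'k : k' <= k by near: k'; exact: nbhs_right_ltW.
have sK y : G y -> Z0 x <= Z k' y -> K y.
  by move=> Gy xy; apply: HK => //; exact: le_trans xy (Z_nd _ _ _).
have Kx : K x by apply: sK => //; exact: Z_ge.
have [||y Ky yM] := @usc_compact_max _ _ _ (Z k') Kc; first by exists x.
- move=> z c Kz zc.
  have e0 : 0 < (c - Z k' z) / 2 by lra.
  apply: filterS (Z_usc k'0 (KG _ Kz) e0) => t Ht /KG /Ht; lra.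
exists y; split; first exact: KG.
move=> z Gz; have [zx|xz] := leP (Z k' z) (Z0 x).
  by apply: le_trans zx _; apply: le_trans (yM _ Kx); exact: Z_ge.
by apply: yM; apply: sK => //; exact: ltW.
Unshelve. all: by end_near. Qed.

(** Maximizers of Z k lie in a fixed compact for small k. Around a point of it that does not
    maximize Z0, [Z_lt_near] excludes them, so [P] is only asked near maximizers of Z0;
    near-covering makes this uniform. *)
Lemma argmax_Z_near (P : R -> T -> Prop) :
    (forall x, argmax G Z0 x -> \forall y \near x & k \near 0^'+, G y -> P k y) ->
  \forall k \near 0^'+, forall x, argmax G (Z k) x -> P k x.
Proof.
move=> HP; have [x [Gx xM]] := argmax_Z0_nonempty.
have x0 : 0 < Z0 x by rewrite -(argmax_sup (conj Gx xM)) max_Z0_gt0.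
have [k [K [k0 Kc KG HK]]] := Z_coercive x0.
have /compact_near_coveringP cK := Kc.
have := cK R (0^'+) (fun k y => argmax G (Z k) y -> P k y) _.
have H z : K z ->
    \forall y \near z & k \near 0^'+, argmax G (Z k) y -> P k y.
  move=> Kz; have Gz := KG _ Kz; have [zx|xz] := ltP (Z0 z) (Z0 x).
    have [[U V] /= [Uz V0] UV] := Z_lt_near Gz zx.
    exists (U, V `&` [set k' | 0 < k']) => /=.
      by split => //; apply: filterI V0 _; exact: nbhs_right_gt.
    move=> [y k'] /= [Uy [Vk' k'0]] [Gy yM].
    have := UV (y, k') (conj Uy Vk') Gy => /=.
    by rewrite ltNge (le_trans (Z_ge k'0 Gx))// yM.
  have Az : argmax G Z0 z.
    by split => // y Gy; exact: le_trans (xM _ Gy) xz.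
  by apply: filterS (HP _ Az) => -[y k'] /= HPy [Gy _]; exact: HPy.
move=> /(_ _ H); move=> nearK.
near=> k' => y Ay.
have k'0 : 0 < k' by near: k'; exact: nbhs_right_gt.
have k'k : k' <= k by near: k'; exact: nbhs_right_ltW.
have Ky : K y.
  case: (Ay) => Gy yM; apply: HK => //; apply: le_trans (Z_nd k'0 k'k Gy).
  by apply: le_trans (yM _ Gx); exact: Z_ge.
by move: (y) Ky Ay; near: k'; exact: nearK.
Unshelve. all: by end_near. Qed.

Lemma max_Z_cvg : sup [set Z k x | x in G] @[k --> 0^'+] -->
  sup [set Z0 x | x in G].
Proof.
have [x Ax] := argmax_Z0_nonempty; rewrite (argmax_sup Ax).
apply/cvgrPdist_le => e e0.
near=> k.
have k0 : 0 < k by near: k; exact: nbhs_right_gt.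
have [y Ay] : argmax G (Z k) !=set0 by near: k; exact: argmax_Z_nonempty.
rewrite (argmax_sup Ay).
have : Z k y < Z0 x + e.
  move: (y) Ay; near: k; apply: argmax_Z_near => z [Gz _].
  by apply: Z_lt_near => //; apply: le_lt_trans (Ax.2 _ Gz) _; rewrite ltrDl.
have : Z0 x <= Z k y by apply: le_trans (Ay.2 _ Ax.1); exact: Z_ge Ax.1.
by move=> ? ?; rewrite ler0_norm; lra.
Unshelve. all: by end_near. Qed.

(** A cluster point must first be placed in [G]: the selection eventually stays in a compact, closed
    since the space is Hausdorff. A value below the maximum would then contradict [Z_lt_near]. *)
Lemma argmax_Z_cluster (sel : R -> T) : hausdorff_space T ->
    (forall k : R, 0 < k -> argmax G (Z k) (sel k)) ->
  cluster (sel k @[k --> 0^'+]) `<=` argmax G Z0.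
Proof.
move=> hT Hsel z clz; have [x [Gx xM]] := argmax_Z0_nonempty.
have x0 : 0 < Z0 x by rewrite -(argmax_sup (conj Gx xM)) max_Z0_gt0.
have [k [K [k0 Kc KG HK]]] := Z_coercive x0.
have selx k' : 0 < k' -> Z0 x <= Z k' (sel k').
  by move=> k'0; apply: le_trans ((Hsel _ k'0).2 _ Gx); exact: Z_ge.
have selK : \forall k' \near 0^'+, K (sel k').
  near=> k'.
  have k'0 : 0 < k' by near: k'; exact: nbhs_right_gt.
  have k'k : k' <= k by near: k'; exact: nbhs_right_ltW.
  have Gs := (Hsel _ k'0).1.
  by apply: HK => //; apply: le_trans (selx _ k'0) _; exact: Z_nd.
have Gz : G z.
  apply: KG; have /closure_id -> := compact_closed hT Kc.
  by move=> U Uz; apply: clz.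
split => // y Gy; apply: le_trans (xM _ Gy) _.
rewrite leNgt; apply/negP => zx.
have [[U V] /= [Uz V0] UV] := Z_lt_near Gz zx.
have FV : (sel k' @[k' --> 0^'+]) [set sel k' | k' in V `&` [set k' | 0 < k']].
  by apply: filterS (filterI V0 (nbhs_right_gt _)) => k' Hk'; exists k'.
have [_ [[k' [Vk' k'0] <-] Us]] := clz _ _ FV Uz.
have := UV (sel k', k') (conj Us Vk') (Hsel _ k'0).1.
by rewrite ltNge selx.
Unshelve. all: by end_near. Qed.

Lemma argmax_Z_selection_cvg (sel : R -> T) x0 : argmax G Z0 = [set x0] ->
    (forall k : R, 0 < k -> argmax G (Z k) (sel k)) ->
  sel k @[k --> 0^'+] --> x0.
Proof.
move=> A0 Hsel U Ux0.
have : \forall k \near 0^'+, forall x, argmax G (Z k) x -> U x.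
  apply: argmax_Z_near; rewrite A0 => _ ->.
  by exists (U, setT); [split => //; exact: filterT|case=> ? ? []].
move=> H; apply: filterS (filterI H (nbhs_right_gt _)) => k [+ k0].
by apply; exact: Hsel.
Qed.

Lemma argmax_Z_dist (D : T -> R) : (forall x, 0 <= D x) ->
    (forall x (e : R), argmax G Z0 x -> 0 < e -> \forall y \near x, D y <= e) ->
  ereal_sup [set (D x)%:E | x in argmax G (Z k)] @[k --> 0^'+] --> 0%:E.
Proof.
move=> D0 Dn.
pose f k := ereal_sup [set (D x)%:E | x in argmax G (Z k)].
have f_le e : 0 < e -> \forall k \near 0^'+, (0 <= f k <= e%:E)%E.
  move=> e0; have De : \forall k \near 0^'+, forall x, argmax G (Z k) x -> D x <= e.
    apply: argmax_Z_near => x Ax.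
    exists ([set y | D y <= e], setT); first by split; [exact: Dn|exact: filterT].
    by case=> y k /= [].
  near=> k; apply/andP; split.
    (* An empty supremum would be -oo, so the lower bound needs an actual maximizer. *)
    have [y Ay] : argmax G (Z k) !=set0 by near: k; exact: argmax_Z_nonempty.
    apply: (@le_trans _ _ (D y)%:E); first by rewrite lee_fin.
    by apply: ereal_sup_ubound; exists y.
  apply: ge_ereal_sup => _ [x Ax <-]; rewrite lee_fin.
  by move: (x) Ax; near: k.
apply/fine_cvgP; split.
  apply: filterS (f_le _ ltr01) => k /andP[k0 k1].
  by rewrite ge0_fin_numE// (le_lt_trans k1)// ltry.
apply/cvgrPdist_le => e /f_le; apply: filterS => k /= /andP[k0 k1].
have fk : f k \is a fin_num by rewrite ge0_fin_numE// (le_lt_trans k1)// ltry.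
by rewrite sub0r normrN ger0_norm ?fine_ge0// -lee_fin fineK.
Unshelve. all: by end_near. Qed.

End vanishing_scale.

(** * Barycenters *)

Lemma posr_lower_bound (R : realType) (n : nat) (k : 'I_n -> R) :
  (forall i, 0 < k i) -> exists2 k0, 0 < k0 & forall i, k0 <= k i.
Proof.
move=> kp; have S0 : 0 <= \sum_i (k i)^-1 by apply: sumr_ge0 => i _; rewrite invr_ge0 ltW.
have S1 : 0 < 1 + \sum_i (k i)^-1 by rewrite ltr_pwDl.
exists (1 + \sum_i (k i)^-1)^-1; first by rewrite invr_gt0.
move=> i; rewrite invf_ple ?posrE// (bigD1 i)//= addrCA lerDl addr_ge0//.
by apply: sumr_ge0 => j _; rewrite invr_ge0 ltW.
Qed.

Section barycenter_limits.
Context {R : realType} {d n : nat}.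
Variables (tau0 tau1 : R) (lam a : 'I_n -> R) (mu : 'I_n -> gparam R d).
Hypotheses (tau0_gt0 : 0 < tau0) (tau1_gt0 : 0 < tau1) (n_ge1 : (1 <= n)%N).
Hypotheses (lam_gt0 : forall i, 0 < lam i) (a_gt0 : forall i, 0 < a i).
Hypothesis mu_gauss : forall i, gaussians R d (mu i).
Local Notation G := (gaussians R d).
Local Notation theta := (chernoff_order tau0 tau1).
Local Notation Z := (Zkappa tau0 tau1 lam a mu).
Local Notation Z0 := (Z0 tau0 tau1 lam a mu).
Local Notation affinity := (scaled_affinity tau0 tau1).

Let wt i : R := lam i * a i `^ theta.

Let wt_gt0 i : 0 < wt i. Proof. by rewrite mulr_gt0// powR_gt0. Qed.

Let ZE kappa nu : Z kappa nu = \sum_i wt i * affinity kappa (mu i) nu.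
Proof. by []. Qed.

Let Z0E nu : Z0 nu = \sum_i wt i * chernoff_affinity theta (mu i) nu.
Proof. by []. Qed.

Let W := \sum_i wt i.

Let W_gt0 : 0 < W.
Proof.
rewrite /W; move: (wt) wt_gt0; case: n n_ge1 => // m _ w w0.
by rewrite big_ord_recl ltr_pwDl// sumr_ge0// => i _; exact: ltW.
Qed.

Lemma Zkappa_ge0 kappa nu : 0 <= Z kappa nu.
Proof.
by rewrite ZE sumr_ge0// => i _; rewrite mulr_ge0 ?(ltW (wt_gt0 i))// scaled_affinity_ge0.
Qed.

Lemma Z0_le_Zkappa kappa nu : 0 < kappa -> G nu -> Z0 nu <= Z kappa nu.
Proof.
move=> k0 np; rewrite ZE Z0E ler_sum// => i _; rewrite ler_pM2l//.
by apply: chernoff_le_scaled_affinity => //; exact: mu_gauss.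
Qed.

Lemma Zkappa_nd kappa kappa' nu : 0 < kappa -> kappa <= kappa' -> G nu ->
  Z kappa nu <= Z kappa' nu.
Proof.
move=> k0 kk np; rewrite !ZE ler_sum// => i _; rewrite ler_pM2l//.
by apply: scaled_affinity_nd => //; exact: mu_gauss.
Qed.

Lemma Zkappa_cvg nu (e : R) : G nu -> 0 < e ->
  exists2 kappa : R, 0 < kappa & Z kappa nu <= Z0 nu + e.
Proof.
move=> np e0; have eW : 0 < e / W by exact: divr_gt0.
have H i : exists kappa, 0 < kappa /\
    affinity kappa (mu i) nu <= chernoff_affinity theta (mu i) nu + e / W.
  have [k k0 Hk] := scaled_affinity_cvg tau0_gt0 tau1_gt0 (mu_gauss i) np eW.
  by exists k.
have [k Hk] := choice H.
have [k0 k00 k0k] := posr_lower_bound (fun i => (Hk i).1).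
exists k0 => //; rewrite ZE Z0E.
have -> : e = \sum_i wt i * (e / W) by rewrite -mulr_suml mulrC mulfVK// gt_eqF.
rewrite -big_split ler_sum//= => i _; rewrite -mulrDr ler_pM2l//.
apply: le_trans (Hk i).2; apply: scaled_affinity_nd => //; exact: mu_gauss.
Qed.

Lemma Zkappa_usc kappa nu (e : R) : 0 < kappa -> G nu -> 0 < e ->
  \forall nu' \near nu, G nu' -> Z kappa nu' <= Z kappa nu + e.
Proof.
move=> k0 np e0; have eW : 0 < e / W by exact: divr_gt0.
have H i : \forall nu' \near nu, G nu' ->
    affinity kappa (mu i) nu' <= affinity kappa (mu i) nu + e / W.
  have [eps eps0 Heps] := scaled_affinity_usc tau0_gt0 tau1_gt0 k0 (mu_gauss i) np eW.
  apply: filterS (ln_gauss_pdf_near np eps0) => nu' h np'.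
  by apply: Heps => //; exact: h.
have := @filter_forall _ 'I_n (fun i => [set nu' | G nu' ->
    affinity kappa (mu i) nu' <= affinity kappa (mu i) nu + e / W])
  (nbhs nu) (nbhs_filter nu) H.
apply: filterS => nu' Hnu' np'; rewrite !ZE.
have -> : e = \sum_i wt i * (e / W) by rewrite -mulr_suml mulrC mulfVK// gt_eqF.
rewrite -big_split ler_sum//= => i _; rewrite -mulrDr ler_pM2l//.
exact: Hnu'.
Qed.

(** If the weighted sum reaches [eta], some affinity reaches eta / W. Which one is unknown, hence
    the union of the compacts; monotonicity carries the bound from [k0] to the scale of that
    index. *)
Lemma Zkappa_coercive (eta : R) : 0 < eta -> exists (kappa : R) (K : set (gparam R d)),
  [/\ 0 < kappa, compact K, K `<=` G & forall nu, G nu -> eta <= Z kappa nu -> K nu].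
Proof.
move=> eta0; have eW : 0 < eta / W by exact: divr_gt0.
have H i : exists kK : R * set (gparam R d), [/\ 0 < kK.1, compact kK.2,
    kK.2 `<=` G & forall nu, posdef nu.2 -> eta / W <= affinity kK.1 (mu i) nu -> kK.2 nu].
  have [k [K [? ? ? ?]]] := scaled_affinity_coercive tau0_gt0 tau1_gt0 (mu_gauss i) eW.
  by exists (k, K).
have [kK HkK] := choice H.
have kKp i : 0 < (kK i).1 by case: (HkK i).
have [k0 k00 k0k] := posr_lower_bound kKp.
exists k0, (\big[setU/set0]_i (kK i).2); split => //.
- by apply: bigsetU_compact => i _; case: (HkK i).
- apply: (big_ind (fun K => K `<=` G)) => //.
    by move=> A B AG BG x [/AG|/BG].
  by move=> i _; case: (HkK i).
move=> nu np etaZ.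
have [i Hi] : exists i, eta / W <= affinity k0 (mu i) nu.
  apply: contrapT => /forallNP Hn; move: etaZ; apply/negP; rewrite -ltNge.
  have -> : eta = \sum_i wt i * (eta / W) by rewrite -mulr_suml mulrC mulfVK// gt_eqF.
  rewrite ZE; have Hlt i : wt i * affinity k0 (mu i) nu < wt i * (eta / W).
    by rewrite ltr_pM2l// ltNge; apply/negP; exact: Hn.
  apply: ltr_sum => [|i _]; last exact: Hlt.
  by apply/hasP; exists (Ordinal n_ge1) => //; rewrite mem_index_enum.
rewrite (bigD1 i)//=; left; have [_ _ _] := HkK i; apply => //.
by apply: le_trans Hi _; apply: scaled_affinity_nd => //; exact: mu_gauss.
Qed.

Lemma Z0_positive : exists2 nu, G nu & 0 < Z0 nu.
Proof.
exists (mu (Ordinal n_ge1)); first exact: mu_gauss.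
rewrite Z0E (bigD1 (Ordinal n_ge1))//= ltr_pwDl//.
  rewrite mulr_gt0//.
  by have [pi [_ ? _]] := chernoff_gauss (chernoff_order_in01 tau0_gt0 tau1_gt0)
    (mu_gauss (Ordinal n_ge1)) (mu_gauss (Ordinal n_ge1)).
apply: sumr_ge0 => i _; rewrite mulr_ge0 ?(ltW (wt_gt0 i))//.
have [pi [_ h _]] := chernoff_gauss (chernoff_order_in01 tau0_gt0 tau1_gt0)
  (mu_gauss i) (mu_gauss (Ordinal n_ge1)).
exact: ltW.
Qed.

Let inv_theta_gt0 : 0 < theta^-1.
Proof. by have /andP[t0 _] := chernoff_order_in01 tau0_gt0 tau1_gt0; rewrite invr_gt0. Qed.

(** Phi is kappa tau0 times a constant minus an increasing power of the nonnegative Z, so order is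
    reversed. *)
Lemma Phikappa_le kappa nu nu' : 0 < kappa ->
  (Phikappa tau0 tau1 lam a mu kappa nu <= Phikappa tau0 tau1 lam a mu kappa nu') =
  (Z kappa nu' <= Z kappa nu).
Proof.
move=> k0; rewrite /Phikappa ler_pM2l ?mulr_gt0// lerD2l lerN2 /bkappa.
have := Zkappa_ge0 kappa nu; have := Zkappa_ge0 kappa nu'.
move: (Z kappa nu) (Z kappa nu') => u v v0 u0; apply/idP/idP.
  apply: contraTT; rewrite -!ltNge => h.
  exact: (gt0_ltr_powR inv_theta_gt0 u0 v0 h).
exact: (ge0_ler_powR (ltW inv_theta_gt0) v0 u0).
Qed.

Lemma argmin_Phikappa kappa : 0 < kappa ->
  argmin G (Phikappa tau0 tau1 lam a mu kappa) = argmax G (Z kappa).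
Proof.
move=> k0; apply/seteqP; split=> nu [np H]; split; [exact: np| |exact: np|] => nu' np'.
  exact: (eq_ind _ is_true (H _ np') _ (Phikappa_le nu nu' k0)).
exact: (eq_ind _ is_true (H _ np') _ (esym (Phikappa_le nu nu' k0))).
Qed.

End barycenter_limits.

Lemma dpar_ge0 (R : realType) (d : nat) (nu eta : gparam R d) : 0 <= dpar nu eta.
Proof. exact: sqrtr_ge0. Qed.

Lemma dpar_near (R : realType) (d : nat) (nu : gparam R d) (e : R) : 0 < e ->
  \forall nu' \near nu, dpar nu' nu <= e.
Proof.
move=> e0.
have h : (fun v : gparam R d => dpar v nu) @ nu --> (0 : R).
  pose f (v : gparam R d) := sqnorm (v.1 - nu.1) + sqnorm (v.2 - nu.2).
  have fc : f @ nu --> (0 : R).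
    have -> : 0 = f nu.
      by rewrite /f !subrr /sqnorm !big1 ?addr0// => i _; rewrite big1// => j _; rewrite mxE expr0n.
    rewrite /f /sqnorm; apply: cvgD; apply: cvg_rsum => i; apply: cvg_rsum => j.
      rewrite (ord1 i) !mxE; under eq_fun do rewrite !mxE.
      by apply: cvgM; apply: cvgB; do ?exact: cvg_cst; exact: continuous_mean_coord.
    rewrite !mxE; under eq_fun do rewrite !mxE.
    by apply: cvgM; apply: cvgB; do ?exact: cvg_cst; exact: continuous_mx_coord.
  by have := cvg_comp _ _ fc (@sqrt_continuous R 0); rewrite sqrtr0.
by move/cvgr_le : h; exact.
Qed.

(** A positive limit makes [f] eventually positive, away from the special case of [powR] at 0. *)
Lemma cvg_powR (R : realType) (T : Type) (F : set_system T) (f : T -> R) (l r : R) :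
    Filter F -> 0 < l -> f x @[x --> F] --> l ->
  f x `^ r @[x --> F] --> l `^ r.
Proof.
move=> FF l0 fl.
have h : expR (r * ln (f x)) @[x --> F] --> expR (r * ln l).
  have hl := cvg_comp _ _ fl (continuous_ln l0).
  have hm : r * ln (f x) @[x --> F] --> r * ln l by apply: cvgM hl; exact: cvg_cst.
  exact: (cvg_comp _ _ hm (@continuous_expR R _)).
rewrite [l `^ r]/powR gt_eqF//; apply: cvg_trans h; apply: near_eq_cvg.
have : \forall x \near F, 0 < f x by move/cvgr_gt : fl; exact.
by apply: filterS => x fx; rewrite /powR gt_eqF.
Qed.

Theorem theorem6p14 (R : realType) (d n : nat) (tau0 tau1 : R)
    (lam a : 'I_n -> R) (mu : 'I_n -> gparam R d)
    (tau0_gt0 : 0 < tau0) (tau1_gt0 : 0 < tau1) (n_ge1 : (1 <= n)%N)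
    (lam_gt0 : forall i, 0 < lam i) (lam_sum : \sum_i lam i = 1)
    (a_gt0 : forall i, 0 < a i) (mu_gauss : forall i, gaussians R d (mu i)) :
  let G := gaussians R d in
  let theta := chernoff_order tau0 tau1 in
  let Z0 := Z0 tau0 tau1 lam a mu in
  let Phi := Phikappa tau0 tau1 lam a mu in
  let b := bkappa tau0 tau1 lam a mu in
  let A0 := argmax G Z0 in
  let maxZ0 := sup [set Z0 nu | nu in G] in
  let selection := fun sel : R -> gparam R d =>
    forall kappa : R, 0 < kappa -> argmin G (Phi kappa) (sel kappa) in
  (forall eta : R, 0 < eta -> compact [set nu | G nu /\ eta <= Z0 nu]) /\
  (A0 !=set0 /\ compact A0) /\
  ereal_sup [set (dpar_set nu A0)%:E | nu in argmin G (Phi kappa)]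
    @[kappa --> 0^'+] --> 0%:E /\
  (forall sel, selection sel ->
    cluster (sel kappa @[kappa --> 0^'+]) `<=` A0) /\
  (forall nu0, A0 = [set nu0] -> forall sel, selection sel ->
    sel kappa @[kappa --> 0^'+] --> nu0) /\
  (kappa : R)^-1 * inf [set Phi kappa nu | nu in G]
    @[kappa --> 0^'+] --> tau0 * (mean_mass lam a - maxZ0 `^ theta^-1) /\
  (forall sel, selection sel ->
    b kappa (sel kappa) @[kappa --> 0^'+] --> maxZ0 `^ theta^-1).
Proof.
move=> G theta Z0' Phi b A0 maxZ0 selection.
pose Z := Zkappa tau0 tau1 lam a mu.
have Zge : forall (k : R) nu, 0 < k -> G nu -> Z0' nu <= Z k nu.
  by move=> k nu k0 np; exact: Z0_le_Zkappa.
have Znd : forall (k k' : R) nu, 0 < k -> k <= k' -> G nu -> Z k nu <= Z k' nu.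
  by move=> k k' nu k0 kk np; exact: Zkappa_nd.
have Zcvg : forall nu (e : R), G nu -> 0 < e ->
    exists2 k : R, 0 < k & Z k nu <= Z0' nu + e.
  by move=> nu e np e0; exact: Zkappa_cvg.
have Zusc : forall (k : R) nu (e : R), 0 < k -> G nu -> 0 < e ->
    \forall nu' \near nu, G nu' -> Z k nu' <= Z k nu + e.
  by move=> k nu e k0 np e0; exact: Zkappa_usc.
have Zcoer : forall eta : R, 0 < eta -> exists (k : R) (K : set (gparam R d)),
    [/\ 0 < k, compact K, K `<=` G & forall nu, G nu -> eta <= Z k nu -> K nu].
  by move=> eta eta0; exact: Zkappa_coercive.
have Zpos : exists2 nu, G nu & 0 < Z0' nu by exact: Z0_positive.
have argminE k : 0 < k -> argmin G (Phi k) = argmax G (Z k).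
  by move=> k0; exact: argmin_Phikappa.
have A0n := argmax_Z0_nonempty Zge Znd Zcvg Zusc Zcoer Zpos.
have A0c := argmax_Z0_compact Zge Znd Zcvg Zusc Zcoer Zpos.
have max0 := max_Z0_gt0 Zge Znd Zcvg Zusc Zcoer Zpos.
have maxc := max_Z_cvg Zge Znd Zcvg Zusc Zcoer Zpos.
have ne := argmax_Z_nonempty Zge Znd Zcvg Zusc Zcoer Zpos.
have selE sel : selection sel -> forall k : R, 0 < k -> argmax G (Z k) (sel k).
  move=> Hsel k k0.
  exact: (eq_ind _ (fun A => A (sel k)) (Hsel k k0) _ (argminE k k0)).
(* The power passes to the limit because [max0] makes the limiting maximum positive. *)
have powc : (sup [set Z k nu | nu in G]) `^ theta^-1 @[k --> 0^'+] --> maxZ0 `^ theta^-1.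
  exact: cvg_powR.
split; first by move=> eta eta0; exact: (Z0_superlevel_compact Zge Znd Zcvg Zusc Zcoer).
split; first by split.
split.
  have dlb nu : lbound [set dpar nu eta | eta in A0] 0.
    by move=> _ [eta _ <-]; exact: dpar_ge0.
  have := argmax_Z_dist Zge Znd Zcvg Zusc Zcoer Zpos (D := fun v : gparam R d => dpar_set v A0).
  move=> H; apply: cvg_trans (H _ _).
  - apply: near_eq_cvg; apply: filterS (nbhs_right_gt 0) => k k0.
    exact: (congr1 (fun A => ereal_sup [set (dpar_set nu A0)%:E | nu in A])
      (esym (argminE k k0))).
  - move=> nu; apply: lb_le_inf; last exact: dlb.
    by have [eta Aeta] := A0n; exists (dpar nu eta), eta.
  (* The distance to [A0] is at most the distance to its point [nu]; the bound 0 makes the infimum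
     meaningful. *)
  - move=> nu e Anu e0; apply: filterS (dpar_near nu e0) => nu' h.
    apply: le_trans h; apply: ge_inf; last by exists nu.
    by exists 0; exact: dlb.
split.
  move=> sel /selE Hsel.
  apply: (argmax_Z_cluster Zge Znd Zcvg Zusc Zcoer Zpos _ Hsel).
  exact: norm_hausdorff.
split.
  move=> nu0 A0E sel /selE Hsel.
  exact: (argmax_Z_selection_cvg Zge Znd Zcvg Zusc Zcoer Zpos A0E Hsel).
split.
  have H : tau0 * (mean_mass lam a - (sup [set Z k nu | nu in G]) `^ theta^-1)
      @[k --> 0^'+] --> tau0 * (mean_mass lam a - maxZ0 `^ theta^-1).
    by apply: cvgM; [exact: cvg_cst|apply: cvgB => //; exact: cvg_cst].
  apply: cvg_trans H; apply: near_eq_cvg.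
  (* For small k a minimizer exists, and the infimum is the value of Phi there. *)
  apply: filterS2 (nbhs_right_gt 0) ne => k k0 [nu Anu].
  have Pnu : argmin G (Phi k) nu.
    exact: (eq_ind _ (fun A => A nu) Anu _ (esym (argminE k k0))).
  have -> : inf [set Phi k nu | nu in G] = Phi k nu.
    apply/eqP; rewrite eq_le; apply/andP; split.
      apply: ge_inf; last by exists nu => //; exact: Pnu.1.
      by exists (Phi k nu) => _ [nu' np' <-]; exact: Pnu.2.
    apply: lb_le_inf; first by exists (Phi k nu), nu => //; exact: Pnu.1.
    by move=> _ [nu' np' <-]; exact: Pnu.2.
  rewrite (argmax_sup Anu) /Phi /Phikappa /bkappa -!mulrA mulKf//.
  by rewrite gt_eqF.
move=> sel /selE Hsel.
apply: cvg_trans powc; apply: near_eq_cvg.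
apply: filterS (nbhs_right_gt 0) => k k0.
by rewrite (argmax_sup (Hsel _ k0)).
Qed.
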